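(* Let $f,g:\mathbb{R}\to\mathbb{R}$ be continuous nondecreasing functions, with $f$ positive and strictly increasing, and such that $\lim_{t\to+\infty}f(t)=+\infty$ whenever $\lim_{t\to+\infty}g(t)<+\infty$. Let $\Omega\subset\mathbb{R}^n$ be an open domain with nonempty boundary, let $q\in(0,2]$, and let $u\in USC(\Omega)$ be a viscosity subsolution of $F(x,D^2u)= f(u)+g(u)|Du|^q$ in $\Omega$ (i.e. a viscosity solution of the inequality $F(x,D^2u)\ge f(u)+g(u)|Du|^q$), where $F$ is as in the context. Let $d(x)=\mathrm{dist}(x,\partial\Omega)$. \begin{itemize} \item[(i)] Assume $\lim_{t\to+\infty}g(t)>0$ and that it is NOT the case that [$q\le1$ and $\int_0^{+\infty}\frac{dt}{(t f(t))^{1/2}+(t g^+(t))^{1/(2-q)}}=+\infty$]. Then for all $x\in\Omega$, $$u(x)\le\max\{t_0,\ \mathcal{R}^{-1}(d(x))\},$$ where $t_0=\inf\{t\in\mathbb{R}: g(t)\ge0\}$ and $\mathcal{R}:\mathbb{R}\to(0,+\infty)$ is $$\mathcal{R}(a)=\begin{cases}\displaystyle 2\left(\frac{n}{2-q}\right)^{1/(2-q)}\int_a^{+\infty}\frac{dt}{\left(\int_a^t f(s)\,ds\right)^{1/2}+\left(\int_a^t g^+(s)\,ds\right)^{1/(2-q)}} & \text{if } q<2,\\[2ex] \displaystyle\sqrt{\frac n2}\int_a^{+\infty}\frac{dt}{\left(\int_a^t e^{\frac2n\int_s^t g^+(\tau)\,d\tau}f(s)\,ds\right)^{1/2}} & \text{if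 } q=2.\end{cases}$$ \item[(ii)] Assume $\lim_{t\to+\infty}g(t)=0$ and that $$\int_0^{+\infty}\frac{dt}{\left(\int_0^t e^{-2\int_s^t\left(\frac{g^-(\tau)}{f(\tau)}\right)^{2/q}f(\tau)\,d\tau}f(s)\,ds\right)^{1/2}}<+\infty .$$ Then for all $x\in\Omega$, $u(x)\le\mathcal{R}^{-1}(d(x))$, where $$\mathcal{R}(a)=\frac{n^{1/q}}{\sqrt q}\int_a^{+\infty}\frac{dt}{\left(\int_a^t e^{-2\int_s^t\left(\frac{g^-(r)}{f(r)}\right)^{2/q}f(r)\,dr}f(s)\,ds\right)^{1/2}} .$$ \item[(iii)] Assume $\lim_{t\to+\infty}g(t)<0$ and that $$\int_0^{+\infty}\left[\frac{1}{(t f(t))^{1/2}}+\frac{1}{f(t)^{1/q}}\right]dt<+\infty .$$ Then for all $x\in\Omega$, $u(x)\le\mathcal{R}^{-1}(d(x))$, where $$\mathcal{R}(a)=2\,\frac{n^{1/q}}{q}\int_a^{+\infty}\left[\frac{1}{\left(\int_a^t f(s)\,ds\right)^{1/2}}+\left(\frac{\int_a^t g^-(s)\,ds}{\int_a^t f(s)\,ds}\right)^{1/q}\right]dt .$$ \end{itemize}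
   Context: $\mathcal{S}_n$ is the space of real symmetric $n\times n$ matrices with the usual partial order. $F:\mathbb{R}^n\times\mathcal{S}_n\to\mathbb{R}$ is continuous, satisfies $F(x,O)=0$ for all $x$, and $0\le F(x,X+Y)-F(x,X)\le \mathrm{tr}(Y)$ for all $x\in\mathbb{R}^n$, $X,Y\in\mathcal{S}_n$ with $Y\ge O$. $g^+=\max(g,0)$, $g^-=\max(-g,0)$. $u\in USC(\Omega)$ (upper semicontinuous) is a viscosity solution of $F(x,D^2u)\ge f(u)+g(u)|Du|^q$ in $\Omega$ if for every $x_0\in\Omega$ and every $\phi\in C^2$ such that $u-\phi$ has a local maximum at $x_0$, $F(x_0,D^2\phi(x_0))\ge f(u(x_0))+g(u(x_0))|D\phi(x_0)|^q$. For a strictly decreasing $\mathcal{R}:\mathbb{R}\to(0,+\infty)$ with $\lim_{a\to+\infty}\mathcal{R}(a)=0$ and $b>0$, $\mathcal{R}^{-1}(b)$ denotes the unique $a$ with $\mathcal{R}(a)=b$ if it exists, and $\mathcal{R}^{-1}(b)=-\infty$ otherwise. *)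

(* Defs.v *)
From HB Require Import structures.
From mathcomp Require Import all_boot all_order all_algebra.
From mathcomp Require Import all_classical all_reals all_analysis.
Set Implicit Arguments. Unset Strict Implicit. Unset Printing Implicit Defensive.
Import Order.TTheory GRing.Theory Num.Theory.
Import numFieldNormedType.Exports.
Local Open Scope classical_set_scope.
Local Open Scope ring_scope.

Section Defs.
Variable R : realType.

Definition symmetric_mx (n : nat) (X : 'M[R]_n) : Prop := X^T = X.

Definition psd_mx (n : nat) (Y : 'M[R]_n) : Prop :=
  forall v : 'cV[R]_n, 0 <= (v^T *m Y *m v) 0 0.

Definition enorm (n : nat) (v : 'rV[R]_n) : R :=
  Num.sqrt (\sum_(i < n) (v 0 i) ^+ 2).

Definition boundary (n : nat) (O : set 'rV[R]_n) : set 'rV[R]_n :=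
  closure O `\` O.

Definition dist_bd (n : nat) (O : set 'rV[R]_n) (x : 'rV[R]_n) : R :=
  inf [set enorm (x - y) | y in boundary O].

Definition evec (n : nat) (i : 'I_n) : 'rV[R]_n := delta_mx 0 i.

Definition partial (n : nat) (i : 'I_n) (h : 'rV[R]_n -> R) : 'rV[R]_n -> R :=
  fun x => derive h x (evec i).

Definition C2 (n : nat) (phi : 'rV[R]_n -> R) : Prop :=
  continuous phi /\
  forall i j : 'I_n,
    (forall x, derivable phi x (evec i)) /\ continuous (partial i phi) /\
    (forall x, derivable (partial i phi) x (evec j)) /\
    continuous (partial j (partial i phi)).

Definition grad (n : nat) (phi : 'rV[R]_n -> R) (x : 'rV[R]_n) : 'rV[R]_n :=
  \row_i partial i phi x.

Definition hessian (n : nat) (phi : 'rV[R]_n -> R) (x : 'rV[R]_n) : 'M[R]_n :=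
  \matrix_(i, j) partial j (partial i phi) x.

Definition usc_on (n : nat) (O : set 'rV[R]_n) (u : 'rV[R]_n -> R) : Prop :=
  forall x, O x -> forall e : R, 0 < e ->
    \forall y \near x, O y -> u y < u x + e.

Definition loc_max_on (n : nat) (O : set 'rV[R]_n) (w : 'rV[R]_n -> R)
  (x0 : 'rV[R]_n) : Prop :=
  \forall y \near x0, O y -> w y <= w x0.

Definition visc_sub (n : nat) (F : 'rV[R]_n -> 'M[R]_n -> R) (f g : R -> R)
  (q : R) (O : set 'rV[R]_n) (u : 'rV[R]_n -> R) : Prop :=
  usc_on O u /\
  forall x0 (phi : 'rV[R]_n -> R), O x0 -> C2 phi ->
    loc_max_on O (fun y => u y - phi y) x0 ->
    f (u x0) + g (u x0) * (enorm (grad phi x0)) `^ q <= F x0 (hessian phi x0).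

(* real integral over [a,b] (Lebesgue; coincides with Riemann for continuous h) *)
Definition RI (h : R -> R) (a b : R) : R :=
  Rintegral (@lebesgue_measure R) `[a, b] h.

Definition EI (h : R -> R) (a : R) : \bar R :=
  integral (@lebesgue_measure R) `]a, +oo[ (fun t => (h t)%:E).

Definition pos_part (g : R -> R) : R -> R := fun t => Num.max (g t) 0.
Definition neg_part (g : R -> R) : R -> R := fun t => Num.max (- g t) 0.

Definition Rinv (Rf : R -> \bar R) (b : R) : \bar R :=
  if `[< exists! a, Rf a = b%:E >] then (xget 0 [set a | Rf a = b%:E])%:E
  else -oo%E.

Definition t0_of (g : R -> R) : \bar R :=
  ereal_inf [set t%:E | t in [set t | 0 <= g t]].

Definition Rfun_i (n : nat) (q : R) (f g : R -> R) (a : R) : \bar R :=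
  if q < 2 then
    ((2 * (n%:R / (2 - q)) `^ (1 / (2 - q)))%:E *
    EI (fun t => 1 / ((RI f a t) `^ (1/2) + (RI (pos_part g) a t) `^ (1 / (2 - q))))%R a)%E
  else
    ((Num.sqrt (n%:R / 2))%:E *
    EI (fun t => 1 / (RI (fun s => expR (2 / n%:R * RI (pos_part g) s t) * f s) a t) `^ (1/2))%R a)%E.

Definition Rfun_ii (n : nat) (q : R) (f g : R -> R) (a : R) : \bar R :=
  (((n%:R `^ (1 / q)) / Num.sqrt q)%:E *
  EI (fun t => 1 / (RI (fun s => expR (- 2 * RI (fun r => (neg_part g r / f r) `^ (2 / q) * f r) s t) * f s) a t) `^ (1/2))%R a)%E.

Definition Rfun_iii (n : nat) (q : R) (f g : R -> R) (a : R) : \bar R :=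
  ((2 * (n%:R `^ (1 / q)) / q)%:E *
  EI (fun t => 1 / (RI f a t) `^ (1/2) + (RI (neg_part g) a t / RI f a t) `^ (1 / q))%R a)%E.

End Defs.

(* Main.v *)
(** Radial barriers. Suppose that a has R(a) < dist(x, boundary), and let T(t) be
    the integral from a to t of 1/sqrt(P), where P is chosen so that
    T(+oo) <= R(a). The inverse phi of T satisfies phi'' = P'(phi)/2 and
    phi'/r <= K(phi) as soon as P(s) <= 2 K(t) (s - a) for a < s <= t, and
    w(y) = phi(|y - x|) blows up inside the domain. If moreover
    P'/2 + (n - 1) K <= f + g sqrt(P)^q, then w is a supersolution, so u - w cannot
    have a positive maximum and u(x) <= phi(0) = a. The three cases only differ
    in the choice of P. The estimate u(x) <= R^-1(dist(x, boundary)) follows because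
    R is continuous, strictly decreasing and tends to 0. *)

Require Import Defs.
From HB Require Import structures.
From mathcomp Require Import all_boot all_order all_algebra.
From mathcomp Require Import all_classical all_reals all_analysis.
From mathcomp Require Import measurable_realfun finmap ring lra.
Import Order.TTheory GRing.Theory Num.Theory.
Import numFieldNormedType.Exports.
Local Open Scope classical_set_scope.
Local Open Scope ring_scope.
Set Implicit Arguments. Unset Strict Implicit. Unset Printing Implicit Defensive.

(** * Radial quartic test functions *)

(** The barrier [w] is not an admissible test function: it is only as regular as [P] allows, it
    lives on a ball, and test functions are [C2] on the whole space. At a contact point it is
    replaced by a quartic in |y - x| lying above it, whose second derivative exceeds that of the
    barrier by a margin paid for by the strict increase of [f]. Ellipticity enters only as F(x, Y)
    <= tr Y for Y >= O. Hence the radial eigenvalue phi'' and the tangential eigenvalue phi'/r must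
    both be nonnegative, and their bounds [M] and [K] are added with weights 1 and n - 1. Origin of
    [P]: for q = 2 the gradient term is linear in [P], and [P] solves a linear equation. When g
    tends to 0, Young's inequality makes the condition linear. When g is eventually positive and q <
    2, [P] is the maximum of two explicit solutions, one keeping only f and the other only g. When
    the limit of g is negative, 1/sqrt(P) is taken to be the integrand of R, with its constant, and
    the inequality is verified afterwards. *)

Section ContinuousPointwise.
Variables (R : realType) (T : topologicalType).
Implicit Types f g : T -> R.

Lemma contD f g : continuous f -> continuous g ->
  continuous (fun x => f x + g x).
Proof. by move=> cf cg x; exact: (cvgD (cf x) (cg x)). Qed.

Lemma contM f g : continuous f -> continuous g ->
  continuous (fun x => f x * g x).
Proof. by move=> cf cg x; exact: (cvgM (cf x) (cg x)). Qed.

Lemma contC (k : R) : continuous (fun _ : T => k).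
Proof. exact: cst_continuous. Qed.

End ContinuousPointwise.

Section Radial.
Variables (R : realType) (n : nat).
Implicit Types (x y c v : 'rV[R]_n).

Definition sqdist c y : R := \sum_(i < n) (y 0 i - c 0 i) ^+ 2.

(** Only even powers of the distance to [c] occur, so the function is smooth at [c] too; three
    coefficients are just enough to prescribe value, slope and second derivative at one radius. *)
Definition radial_quartic (al be ga : R) c y : R :=
  al + be * sqdist c y + ga * sqdist c y ^+ 2.

Lemma is_derive_coord x v (i : 'I_n) :
  is_derive x v (fun y : 'rV[R]_n => y 0 i) (v 0 i).
Proof.
have D : derivable (fun y : 'rV[R]_n => y) x v by exact: derivable_id.
have E := derive_mx D; have /derivable_mxP D' := D.
split; first exact: D'.
have := congr1 (fun M : 'rV[R]_n => M 0 i) E; rewrite /= mxE derive_id.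
by move=> ->.
Qed.

Lemma is_derive_sqdist c x v :
  is_derive x v (sqdist c) (\sum_(i < n) 2 * (x 0 i - c 0 i) * v 0 i).
Proof.
have -> : sqdist c = \sum_(i < n) (fun y : 'rV[R]_n => (y 0 i - c 0 i) ^+ 2).
  by apply/funext => y; rewrite fct_sumE.
apply: is_derive_sum => i.
have H : is_derive x v (fun y : 'rV[R]_n => y 0 i - c 0 i) (v 0 i).
  rewrite -[v 0 i]subr0.
  exact: (is_deriveB (is_derive_coord x v i) (is_derive_cst (c 0 i) x v)).
have := is_deriveX 2 H; rewrite /= expr1 => {}H.
by apply: is_derive_eq H _.
Qed.

Lemma sqdist_evec (c x : 'rV[R]_n) (i : 'I_n) :
  \sum_(j < n) 2 * (x 0 j - c 0 j) * (evec R i) 0 j = 2 * (x 0 i - c 0 i).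
Proof.
rewrite (bigD1 i)//= big1 ?addr0 => [|j ji]; rewrite /evec mxE eqxx/=.
  by rewrite eqxx mulr1.
by rewrite (negbTE ji) mulr0.
Qed.

Lemma continuous_coordB c (i : 'I_n) :
  continuous (fun y : 'rV[R]_n => y 0 i - c 0 i).
Proof.
by move=> x; apply: continuousB; [exact: coord_continuous|exact: cst_continuous].
Qed.

Lemma continuous_sqdist c : continuous (sqdist c).
Proof.
have cc i : continuous (fun y : 'rV[R]_n => (y 0 i - c 0 i) ^+ 2).
  move=> x; apply: (@continuous_comp _ _ _ (fun y : 'rV[R]_n => y 0 i - c 0 i)
    (fun z : R => z ^+ 2)); first exact: continuous_coordB.
  exact: exprn_continuous.
by apply: continuous_big => [|i _]; [exact: add_continuous|exact: cc].
Qed.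

Lemma partial_radial al be ga c (i : 'I_n) :
  partial i (radial_quartic al be ga c) =
  (fun y => (be + 2 * ga * sqdist c y) * (2 * (y 0 i - c 0 i))) /\
  forall x, derivable (radial_quartic al be ga c) x (evec R i).
Proof.
have H x : is_derive x (evec R i) (radial_quartic al be ga c)
    ((be + 2 * ga * sqdist c x) * (2 * (x 0 i - c 0 i))).
  have H1 := is_derive_sqdist c x (evec R i).
  have H2 := is_deriveX 2 H1.
  rewrite sqdist_evec in H1 H2.
  have := is_deriveD (is_deriveD (is_derive_cst al x (evec R i))
    (is_deriveZ be H1)) (is_deriveZ ga H2).
  move=> H3; apply: is_derive_eq H3 _.
  by rewrite /GRing.scale/= expr1; ring.
split; first by apply/funext => x; rewrite /partial; apply: derive_val.
by move=> x; have [] := H x.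
Qed.

Lemma partial2_radial al be ga c (i j : 'I_n) :
  partial j (partial i (radial_quartic al be ga c)) =
  (fun y => (be + 2 * ga * sqdist c y) * (2 * (i == j)%:R) +
     8 * ga * (y 0 i - c 0 i) * (y 0 j - c 0 j)) /\
  forall x, derivable (partial i (radial_quartic al be ga c)) x (evec R j).
Proof.
rewrite (partial_radial al be ga c i).1.
have H x : is_derive x (evec R j)
    (fun y => (be + 2 * ga * sqdist c y) * (2 * (y 0 i - c 0 i)))
    ((be + 2 * ga * sqdist c x) * (2 * (i == j)%:R) +
     8 * ga * (x 0 i - c 0 i) * (x 0 j - c 0 j)).
  have H1 := is_derive_sqdist c x (evec R j); rewrite sqdist_evec in H1.
  have H2 := is_deriveD (is_derive_cst be x (evec R j)) (is_deriveZ (2 * ga) H1).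
  have H3 := is_deriveZ 2 (is_deriveB (is_derive_coord x (evec R j) i)
    (is_derive_cst (c 0 i) x (evec R j))).
  have H4 := is_deriveM H2 H3.
  apply: is_derive_eq H4 _.
  rewrite /GRing.scale/= /GRing.scale/= /cst/= /evec mxE eqxx/=.
  rewrite !fctE.
  change (((2 * ga) \*: sqdist c) x) with (2 * ga * sqdist c x).
  ring.
split; first by apply/funext => x; rewrite /partial; apply: derive_val.
by move=> x; have [] := H x.
Qed.

Lemma continuous_radial_factor be ga c :
  continuous (fun y => be + 2 * ga * sqdist c y).
Proof.
apply: contD; first exact: contC.
by apply: contM; [exact: contC|exact: continuous_sqdist].
Qed.

Lemma C2_radial al be ga c : C2 (radial_quartic al be ga c).
Proof.
have cc := @continuous_coordB c; have cs := @continuous_sqdist c.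
split.
  apply: contD; first by apply: contD; [exact: contC|apply: contM => //; exact: contC].
  by apply: contM; [exact: contC|exact: contM].
move=> i j; have [E D] := partial_radial al be ga c i.
have [E2 D2] := partial2_radial al be ga c i j.
split; first exact: D.
split; last (split; first exact: D2).
  rewrite E; apply: contM; first exact: continuous_radial_factor.
  by apply: contM; [exact: contC|exact: cc].
rewrite E2; apply: contD.
  by apply: contM; [exact: continuous_radial_factor|exact: contC].
apply: contM; last exact: cc.
by apply: contM; [exact: contC|exact: cc].
Qed.

Lemma enorm_sub c y : enorm (y - c) = Num.sqrt (sqdist c y).
Proof. by congr Num.sqrt; apply: eq_bigr => i _; rewrite !mxE. Qed.

Lemma sqdist_ge0 c y : 0 <= sqdist c y.
Proof. by apply: sumr_ge0 => i _; exact: sqr_ge0. Qed.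

Lemma enorm_sub_sqr c y : enorm (y - c) ^+ 2 = sqdist c y.
Proof. by rewrite enorm_sub sqr_sqrtr// sqdist_ge0. Qed.

Lemma enorm_ge0 (v : 'rV[R]_n) : 0 <= enorm v.
Proof. exact: sqrtr_ge0. Qed.

Lemma enorm_scale (k : R) (v : 'rV[R]_n) : enorm (k *: v) = `|k| * enorm v.
Proof.
rewrite /enorm -sqrtr_sqr -sqrtrM ?sqr_ge0//; congr Num.sqrt.
by rewrite mulr_sumr; apply: eq_bigr => i _; rewrite mxE exprMn.
Qed.

Lemma grad_radial al be ga c y :
  grad (radial_quartic al be ga c) y = (2 * (be + 2 * ga * sqdist c y)) *: (y - c).
Proof.
apply/rowP => i; rewrite !mxE (partial_radial al be ga c i).1; ring.
Qed.

Lemma cauchy_schwarz_sum (a b : 'I_n -> R) :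
  (\sum_i a i * b i) ^+ 2 <= (\sum_i a i ^+ 2) * (\sum_i b i ^+ 2).
Proof.
set s := \sum_i a i * b i; set A := \sum_i a i ^+ 2; set B := \sum_i b i ^+ 2.
have A0 : 0 <= A by apply: sumr_ge0 => i _; exact: sqr_ge0.
have : 0 <= \sum_i (A * b i - s * a i) ^+ 2.
  by apply: sumr_ge0 => i _; exact: sqr_ge0.
have -> : \sum_i (A * b i - s * a i) ^+ 2 = A * (A * B - s ^+ 2).
  transitivity (\sum_i (A ^+ 2 * b i ^+ 2 - 2 * A * s * (a i * b i)
      + s ^+ 2 * a i ^+ 2)).
    by apply: eq_bigr => i _; ring.
  rewrite big_split/= big_split/= sumrN -!mulr_sumr -/s -/A -/B; ring.
have [Az|A0' ] := eqVneq A 0.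
  suff -> : s = 0 by rewrite Az !mul0r expr0n.
  apply: big1 => i _.
  have /psumr_eq0P A00 := Az.
  have /eqP := A00 (fun i _ => sqr_ge0 (a i)) i isT.
  by rewrite sqrf_eq0 => /eqP ->; rewrite mul0r.
by rewrite pmulr_rge0 ?subr_ge0// lt_def A0'.
Qed.

(** The Hessian is a multiple of the identity plus a rank one matrix along [y - c]. Its eigenvalues
    are twice the two quantities assumed nonnegative, the first in tangential directions and the
    second in the radial one. Cauchy-Schwarz enters when [ga < 0]. *)
Lemma psd_hessian_radial al be ga c y :
  0 <= be + 2 * ga * sqdist c y ->
  0 <= be + 6 * ga * sqdist c y ->
  psd_mx (hessian (radial_quartic al be ga c) y).
Proof.
move=> b0 b1 v.
set B := be + 2 * ga * sqdist c y in b0.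
set s := \sum_i (y 0 i - c 0 i) * v i 0.
set V := \sum_i (v i 0) ^+ 2.
have -> : (v^T *m hessian (radial_quartic al be ga c) y *m v) 0 0 =
    2 * B * V + 8 * ga * s ^+ 2.
  transitivity (\sum_j \sum_i v i 0 *
     (B * (2 * (i == j)%:R) + 8 * ga * (y 0 i - c 0 i) * (y 0 j - c 0 j)) * v j 0).
    rewrite mxE; apply: eq_bigr => j _; rewrite mxE mulr_suml.
    by apply: eq_bigr => i _; rewrite !mxE (partial2_radial al be ga c i j).1.
  transitivity (\sum_j (2 * B * (v j 0) ^+ 2 +
      8 * ga * s * ((y 0 j - c 0 j) * v j 0))).
    apply: eq_bigr => j _.
    transitivity (\sum_i ((2 * B * v j 0 * (v i 0 * (i == j)%:R)) +
      8 * ga * (y 0 j - c 0 j) * v j 0 * ((y 0 i - c 0 i) * v i 0))).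
      by apply: eq_bigr => i _; ring.
    have E : \sum_i v i 0 * (i == j)%:R = v j 0.
      rewrite (bigD1 j)//= eqxx mulr1 big1 ?addr0//.
      by move=> i /negbTE ->; rewrite mulr0.
    rewrite big_split/= -!mulr_sumr -/s E; ring.
  rewrite big_split/= -!mulr_sumr -/s -/V; ring.
have V0 : 0 <= V by apply: sumr_ge0 => i _; exact: sqr_ge0.
have CS : s ^+ 2 <= sqdist c y * V by exact: cauchy_schwarz_sum.
have [g0|g0] := leP 0 ga.
  have := sqr_ge0 s; nra.
have : 8 * ga * (sqdist c y * V) <= 8 * ga * s ^+ 2.
  by rewrite ler_nM2l// nmulr_llt0//; lra.
have : 0 <= 2 * (be + 6 * ga * sqdist c y) * V by rewrite !mulr_ge0.
rewrite /B; nra.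
Qed.

Lemma tr_hessian_radial al be ga c y :
  \tr (hessian (radial_quartic al be ga c) y) =
  n%:R * (2 * (be + 2 * ga * sqdist c y)) + 8 * ga * sqdist c y.
Proof.
transitivity (\sum_(i < n) (2 * (be + 2 * ga * sqdist c y) +
    8 * ga * (y 0 i - c 0 i) ^+ 2)).
  apply: eq_bigr => i _; rewrite mxE (partial2_radial al be ga c i i).1 eqxx mulr1; ring.
by rewrite big_split/= sumr_const card_ord -[(2 * _) *+ n]mulr_natl -mulr_sumr.
Qed.

Lemma sym_hessian_radial al be ga c y :
  symmetric_mx (hessian (radial_quartic al be ga c) y).
Proof.
apply/matrixP => i j; rewrite !mxE.
rewrite (partial2_radial al be ga c i j).1 (partial2_radial al be ga c j i).1.
by rewrite eq_sym; ring.
Qed.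

End Radial.

(** * Balls inside the domain and maxima of semicontinuous functions *)

Section Domain.
Variables (R : realType) (n : nat).
Implicit Types (O : set 'rV[R]_n) (x y c : 'rV[R]_n).

Lemma dist_bd_le O c z : boundary O z -> dist_bd O c <= enorm (c - z).
Proof.
move=> bz; apply: ge_inf; last by exists z.
by exists 0 => _ [y _ <-]; exact: enorm_ge0.
Qed.

Lemma coord_le_enorm (v : 'rV[R]_n) i : `|v 0 i| <= enorm v.
Proof.
rewrite -sqrtr_sqr; apply: ler_wsqrtr; rewrite (bigD1 i)//= lerDl.
by apply: sumr_ge0 => j _; exact: sqr_ge0.
Qed.

Lemma norm_le_enorm (v : 'rV[R]_n) : `|v| <= enorm v.
Proof.
rewrite {1}/Num.norm/= mx_normrE; apply/bigmax_leP; split; first exact: enorm_ge0.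
by move=> [i j] _ /=; rewrite ord1; exact: coord_le_enorm.
Qed.

Lemma enormN (v : 'rV[R]_n) : enorm (- v) = enorm v.
Proof. by rewrite -scaleN1r enorm_scale normrN1 mul1r. Qed.

Lemma dist_bd_gt0 O c : open O -> boundary O !=set0 -> O c -> 0 < dist_bd O c.
Proof.
move=> oO [z0 bz0] Oc.
have /nbhs_ballP[e /= e0 eO] : nbhs c O by exact: open_nbhs_nbhs.
apply: (lt_le_trans e0); apply: lb_le_inf; first by exists (enorm (c - z0)), z0.
move=> _ [z [_ nOz] <-]; rewrite leNgt; apply/negP => ez; apply: nOz; apply: eO.
by rewrite -ball_normE/=; apply: le_lt_trans ez; exact: norm_le_enorm.
Qed.

(** On the segment from [c] to [y], a point of the closure of [O] outside [O] would be a boundary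
    point at distance at most [rho] from [c]. Hence [O] is both open and closed relative to the
    segment, and connectedness fills it. *)
Lemma closed_ball_sub O c rho : open O -> O c -> rho < dist_bd O c ->
  forall y, enorm (y - c) <= rho -> O y.
Proof.
move=> oO Oc rd y yr.
pose h (t : R) : 'rV[R]_n := c + t *: (y - c).
have ch : continuous h.
  move=> t; apply: cvgD; first exact: cvg_cst.
  by apply: cvgZl; exact: cvg_id.
pose S := h @` `[0, 1].
have cS : connected S.
  apply: connected_continuous_connected; first exact: segment_connected.
  exact: continuous_subspaceT.
have S1 : S y by exists 1; rewrite /= ?in_itv/= ?lexx ?ler01// /h scale1r addrC subrK.
have S0 : S c by exists 0; rewrite /= ?in_itv/= ?lexx ?ler01// /h scale0r addr0.
suff : S `&` O = S by move=> SO; have : S y by []; rewrite -SO => -[].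
apply: cS; first by exists c.
  by exists O.
exists (closure O); first exact: closed_closure.
apply/seteqP; split=> z [Sz]; first by move=> Oz; split=> //; exact: subset_closure.
move=> cOz; split => //; apply: contrapT => nOz.
have := @dist_bd_le O c z (conj cOz nOz).
apply/negP; rewrite -ltNge; apply: le_lt_trans rd; apply: le_trans yr.
case: Sz => t; rewrite /= in_itv/= => /andP[t0 t1] <-.
rewrite /h opprD addrA subrr sub0r enormN enorm_scale ger0_norm//.
by rewrite ler_piMl// enorm_ge0.
Qed.

(** If no maximum is attained, the sets where [v < v y], enlarged by the complement of [K] so that
    their interiors cover [K], have a finite subcover; the index with the largest value of [v] lies
    in none of them. *)
Lemma usc_max (K : set 'rV[R]_n) (v : 'rV[R]_n -> R) : compact K -> K !=set0 ->
  (forall x, K x -> forall e : R, 0 < e -> \forall y \near x, K y -> v y < v x + e) ->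
  exists2 x0, K x0 & forall y, K y -> v y <= v x0.
Proof.
move=> cK [k0 Kk0] uv; apply: contrapT => nmax.
have big x : K x -> exists2 y, K y & v x < v y.
  move=> Kx; apply: contrapT => nb; apply: nmax; exists x => // y Ky.
  by rewrite leNgt; apply/negP => xy; apply: nb; exists y.
pose U y := [set x | v x < v y /\ K x].
have := cK; rewrite compact_cover.
move=> /(_ _ K (fun y => (~` K `|` U y)°)) [].
- by move=> y Ky; exact: open_interior.
- move=> x Kx; have [y Ky xy] := big x Kx; exists y => //.
  rewrite /interior/=; have e0 : 0 < v y - v x by rewrite subr_gt0.
  apply: filterS (uv x Kx _ e0) => z zz.
  have [Kz|nKz] := pselect (K z); [right|by left].
  by split => //; have := zz Kz; rewrite addrC subrK.
move=> D DK cov.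
have [d Dd dmax] : exists2 d, K d & forall e, e \in D -> v e <= v d.
  have : forall s : seq 'rV[R]_n, (forall x, x \in s -> K x) ->
      exists2 d, K d & forall e, e \in s -> v e <= v d.
    elim=> [|x s IH] sK; first by exists k0.
    have [y ys|d Kd dm] := IH; first by apply: sK; rewrite inE ys orbT.
    have Kx : K x by apply: sK; rewrite inE eqxx.
    have [xd|dx] := leP (v x) (v d).
      by exists d => // e; rewrite inE => /orP[/eqP ->//|/dm].
    exists x => // e; rewrite inE => /orP[/eqP ->//|/dm ed].
    exact: le_trans ed (ltW dx).
  move=> /(_ (enum_fset D)) [x xD|d Kd dm]; first exact/set_mem/DK.
  by exists d.
have [e eD /interior_subset [/(_ Dd)//|[de _]]] := cov d Dd.
by have := dmax e eD; rewrite leNgt de.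
Qed.

Lemma continuous_enorm_sub c : continuous (fun y : 'rV[R]_n => enorm (y - c)).
Proof.
have -> : (fun y : 'rV[R]_n => enorm (y - c)) = Num.sqrt \o sqdist c.
  by apply/funext => y; rewrite enorm_sub.
move=> y; apply: continuous_comp; first exact: continuous_sqdist.
exact: sqrt_continuous.
Qed.

Lemma near_enorm_gt c x (z : R) : z < enorm (x - c) ->
  \forall y \near x, z < enorm (y - c).
Proof. by move=> zx; exact: (cvgr_gt _ (@continuous_enorm_sub c x)). Qed.

Lemma near_enorm_lt c x (z : R) : enorm (x - c) < z ->
  \forall y \near x, enorm (y - c) < z.
Proof. by move=> zx; exact: (cvgr_lt _ (@continuous_enorm_sub c x)). Qed.

Lemma compact_closed_eball c rho : compact [set y : 'rV[R]_n | enorm (y - c) <= rho].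
Proof.
apply: bounded_closed_compact.
  exists (`|c| + rho); split => //; first exact: num_real.
  move=> M rM y /= yr; apply: le_trans (ltW rM).
  rewrite -[y in `|y|](subrK c) addrC.
  apply: le_trans (ler_normD _ _) _; rewrite lerD2l.
  exact: le_trans (norm_le_enorm _) yr.
rewrite [X in closed X](_ : _ =
    (fun y : 'rV[R]_n => enorm (y - c)) @^-1` `]-oo, rho]%classic); last first.
  by apply/seteqP; split => y; rewrite /= in_itv.
apply: closed_comp; last exact: interval_closed.
by move=> y _; exact: continuous_enorm_sub.
Qed.

End Domain.

(** * Monotonicity and differentiation on the line *)

Section Calculus.
Variable R : realType.
Implicit Types (f g df : R -> R) (a b x : R).

Lemma MVT_ge0 f df a b : a <= b ->
  (forall x, a < x < b -> is_derive x 1 f (df x)) ->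
  (forall x, a < x < b -> 0 <= df x) ->
  {within `[a, b], continuous f} -> f a <= f b.
Proof.
rewrite le_eqVlt => /predU1P[->//|ab] D df0 cf.
have D' x : x \in `]a, b[ -> is_derive x 1 f (df x) by rewrite in_itv; exact: D.
have [x] := @MVT R f df a b ab D' cf.
by rewrite in_itv/= => /df0 fx E; rewrite -subr_ge0 E mulr_ge0// subr_ge0 ltW//.
Qed.

Lemma MVT_gt0 f df a b : a < b ->
  (forall x, a < x < b -> is_derive x 1 f (df x)) ->
  (forall x, a < x < b -> 0 < df x) ->
  {within `[a, b], continuous f} -> f a < f b.
Proof.
move=> ab D df0 cf.
have D' x : x \in `]a, b[ -> is_derive x 1 f (df x) by rewrite in_itv; exact: D.
have [x] := @MVT R f df a b ab D' cf.
by rewrite in_itv/= => /df0 fx E; rewrite -subr_gt0 E mulr_gt0// subr_gt0.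
Qed.

Lemma is_derive_cont f x (d : R) : is_derive x 1 f d -> {for x, continuous f}.
Proof.
by move=> [D _]; apply: differentiable_continuous; apply/derivable1_diffP.
Qed.

Lemma near_eq_continuous (h w : R -> R) x : (\forall s \near x, h s = w s) ->
  {for x, continuous h} -> {for x, continuous w}.
Proof.
move=> hw ch; have E : h x = w x := nbhs_singleton hw.
have H : h s @[s --> x] --> w x by rewrite -E; exact: ch.
by apply: cvg_trans H; exact: near_eq_cvg.
Qed.

Lemma within_cont f a b : (forall x, a <= x <= b -> {for x, continuous f}) ->
  {within `[a, b], continuous f}.
Proof.
move=> cf; apply: continuous_in_subspaceT => x /set_mem/=; rewrite in_itv/=.
exact: cf.
Qed.

Lemma derive_sign f x (d : R) : is_derive x 1 f d -> 0 < d -> f x = 0 ->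
  \forall y \near x, y != x -> 0 < f y * (y - x).
Proof.
move=> [D Dv] d0 fx0.
have : (fun h : R => h^-1 *: (f (h + x) - f x)) h @[h --> 0^'] --> d.
  have := D; rewrite /derivable => /cvg_ex[l Hl].
  have E : 'D_1 f x = l.
    by rewrite /derive; apply/cvg_lim => //.
  rewrite -Dv E; move: Hl; rewrite /=.
  by under eq_fun do rewrite /GRing.scale/= mulr1.
move=> /cvgrPdist_lt /(_ d d0) /nbhs_ballP[e /= e0 He].
apply/nbhs_ballP; exists e => //= y; rewrite /ball/= => xye yx.
have := He (y - x); rewrite /ball/= sub0r normrN distrC => /(_ xye).
rewrite subr_eq0 => /(_ yx); rewrite subrK fx0 subr0 => H.
have {H} : 0 < (y - x)^-1 * f y.
  by move: H; rewrite /GRing.scale/= ltr_norml => /andP[_]; lra.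
move=> H; have yx0 : 0 < (y - x) ^+ 2 by rewrite exprn_even_gt0//= subr_eq0.
have := mulr_gt0 H yx0.
rewrite expr2 mulrACA mulVf ?subr_eq0// mul1r//.
Qed.

Lemma der_eq f x (d e : R) : is_derive x 1 f d -> d = e -> is_derive x 1 f e.
Proof. by move=> D <-. Qed.

Lemma der_id x : is_derive x 1 (fun y : R => y) 1.
Proof. exact: is_derive_id. Qed.

Lemma der_cst (k x : R) : is_derive x 1 (fun _ : R => k) 0.
Proof. exact: is_derive_cst. Qed.

Lemma derD f g x (d e : R) : is_derive x 1 f d -> is_derive x 1 g e ->
  is_derive x 1 (fun y => f y + g y) (d + e).
Proof. by move=> D E; exact: is_deriveD. Qed.

Lemma derB f g x (d e : R) : is_derive x 1 f d -> is_derive x 1 g e ->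
  is_derive x 1 (fun y => f y - g y) (d - e).
Proof. by move=> D E; exact: is_deriveB. Qed.

Lemma derM f g x (d e : R) : is_derive x 1 f d -> is_derive x 1 g e ->
  is_derive x 1 (fun y => f y * g y) (d * g x + f x * e).
Proof.
move=> D E; apply: der_eq (is_deriveM D E) _.
by rewrite /GRing.scale/=; ring.
Qed.

Lemma der_comp f g x (d e : R) : is_derive x 1 g e -> is_derive (g x) 1 f d ->
  is_derive x 1 (fun y => f (g y)) (d * e).
Proof. by move=> E D; exact: is_derive1_comp. Qed.

Lemma der_expR g x (e : R) : is_derive x 1 g e ->
  is_derive x 1 (fun y => expR (g y)) (e * expR (g x)).
Proof. by move=> E; rewrite mulrC; exact: (der_comp E). Qed.

Lemma derV f x (d : R) : is_derive x 1 f d -> f x != 0 ->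
  is_derive x 1 (fun y => (f y)^-1) (- (f x) ^- 2 * d).
Proof. by move=> D f0; exact: is_deriveV. Qed.

End Calculus.

(** * Comparison with the radial barrier *)

Section Profile.
Variables (R : realType) (a : R) (T P : R -> R).
Hypothesis T0 : T a = 0.
Hypothesis cT : forall t, a <= t -> {for t, continuous T}.
Hypothesis dT : forall t, a < t -> is_derive t 1 T (1 / Num.sqrt (P t)).
Hypothesis P0 : forall t, a < t -> 0 < P t.

Lemma profile_lt x y : a <= x -> x < y -> T x < T y.
Proof.
move=> ax xy; apply: (@MVT_gt0 _ T (fun t => 1 / Num.sqrt (P t))) => //.
- by move=> t /andP[xt _]; apply: dT; exact: le_lt_trans xt.
- move=> t /andP[xt _]; rewrite divr_gt0// sqrtr_gt0 P0//.
  exact: le_lt_trans xt.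
- by apply: within_cont => t /andP[xt _]; apply: cT; exact: le_trans xt.
Qed.

Lemma profile_le x y : a <= x -> a <= y -> (T x <= T y) = (x <= y).
Proof.
move=> ax ay; apply/idP/idP => [|]; last first.
  by rewrite le_eqVlt => /predU1P[->//|xy]; exact/ltW/profile_lt.
by apply: contraTT; rewrite -!ltNge => yx; exact: profile_lt.
Qed.

(** Along [h s = a + k / 2 * s ^+ 2] the bound on [P] reads [P (h s) <= (k * s) ^+ 2], so [T \o h]
    has derivative at least 1. For the inverse of [T] this says that the barrier lies below a
    paraboloid of opening [k]. *)
Lemma profile_center (k t1 r : R) : 0 < k -> (forall s, a < s -> s <= t1 ->
  P s <= 2 * k * (s - a)) -> 0 <= r -> a + k / 2 * r ^+ 2 <= t1 ->
  r <= T (a + k / 2 * r ^+ 2).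
Proof.
move=> k0 Pk r0 rt1.
pose h (s : R) := a + k / 2 * s ^+ 2.
have dh (s : R) : is_derive s 1 h (k * s).
  have H := is_deriveD (is_derive_cst a s 1)
    (is_deriveZ (k / 2) (is_deriveX 2 (is_derive_id s (1 : R)))).
  apply: is_derive_eq H _; rewrite /GRing.scale/= expr1; by field.
have ha (s : R) : 0 <= s -> a <= h s by move=> s0; rewrite /h; nra.
have ha' (s : R) : 0 < s -> a < h s.
  by move=> s0; rewrite /h ltrDl mulr_gt0 ?exprn_gt0// divr_gt0.
suff : (T \o h) 0 - 0 <= (T \o h) r - r.
  by rewrite /= /h expr0n/= mulr0 addr0 T0 subrr subr_ge0.
pose df s := k * s * (1 / Num.sqrt (P (h s))) - 1.
have D (s : R) : 0 < s -> is_derive s 1 (fun s => (T \o h) s - s) (df s).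
  move=> s0; have H := is_deriveB (is_derive1_comp (dT (ha' s s0)) (dh s))
    (is_derive_id s (1 : R)).
  by apply: is_derive_eq H _; rewrite /df/= mulrC.
apply: (@MVT_ge0 _ (fun s => (T \o h) s - s) df) => //.
- by move=> s /andP[s0 _]; exact: D.
- move=> s /andP[s0 sr]; rewrite /df subr_ge0 mulrA mulr1 ler_pdivlMr ?mul1r; last first.
    by rewrite sqrtr_gt0 P0// ha'.
  have := Pk (h s) (ha' s s0).
  have -> : h s <= t1.
    by apply: le_trans rt1; rewrite /h lerD2l ler_pM2l ?divr_gt0// ler_sqr// ?nnegrE// ltW.
  move=> /(_ isT); have -> : h s - a = k / 2 * s ^+ 2 by rewrite /h; ring.
  move=> H.
  have ks : 0 <= k * s by rewrite mulr_ge0 ?ltW.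
  rewrite -(ger0_norm ks) -sqrtr_sqr; apply: ler_wsqrtr; apply: le_trans H _.
  by rewrite le_eqVlt; apply/orP; left; apply/eqP; field.
- apply: within_cont => s /andP[s0 _].
  apply: continuousB; last exact: cvg_id.
  apply: continuous_comp; first exact: is_derive_cont (dh s).
  by apply: cT; exact: ha.
Qed.

(** The radius [r] at which the paraboloid reaches the level [t] satisfies both [r <= T t] and
    [sqrt (P t) <= k * r]. This bounds slope over radius, that is, the tangential eigenvalue of the
    barrier. *)
Lemma profile_slope (k t : R) : a < t -> (forall s, a < s -> s <= t ->
  P s <= 2 * k * (s - a)) -> 0 < k /\ Num.sqrt (P t) <= k * T t.
Proof.
move=> at0 Pk.
have k0 : 0 < k.
  have := lt_le_trans (P0 at0) (Pk t at0 (lexx t)); nra.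
split=> //; pose r := Num.sqrt (2 * (t - a) / k).
have r2 : r ^+ 2 = 2 * (t - a) / k.
  by rewrite sqr_sqrtr// divr_ge0 ?ltW// mulr_gt0// subr_gt0.
have ht : a + k / 2 * r ^+ 2 = t by rewrite r2; field; rewrite gt_eqF.
have := @profile_center k t r k0 Pk (sqrtr_ge0 _); rewrite ht lexx => /(_ isT) rT.
apply: (@le_trans _ _ (k * r)); last by rewrite ler_pM2l.
have kr : 0 <= k * r by rewrite mulr_ge0 ?sqrtr_ge0// ltW.
rewrite -(ger0_norm kr) -sqrtr_sqr; apply: ler_wsqrtr.
apply: le_trans (Pk t at0 (lexx t)) _.
by rewrite exprMn r2 le_eqVlt; apply/orP; left; apply/eqP; field; rewrite gt_eqF.
Qed.

(** The conclusion [r <= T (th r)] says that [th] stays above the inverse of [T] near [T t0]. Value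
    and slope agree there, and the second derivative of [th] is larger. As [P] may fail to be
    differentiable, [th1 ^+ 2] and [P \o th] are compared through a line; it follows that
    [T (th r) - r] decreases up to [T t0] and increases after it. *)
Lemma profile_touch (t0 m m' : R) (th th1 th2 : R -> R) : a < t0 -> m < m' ->
  (forall e, 0 < e -> \forall s \near t0,
     (P s - P t0) * (s - t0) <= (2 * m + e) * (s - t0) ^+ 2) ->
  (forall r : R, is_derive r 1 th (th1 r)) -> (forall r : R, is_derive r 1 th1 (th2 r)) ->
  th (T t0) = t0 -> th1 (T t0) = Num.sqrt (P t0) -> th2 (T t0) = m' ->
  \forall r \near T t0, a < th r /\ r <= T (th r).
Proof.
move=> at0 mm' slope dth dth1 thE th1E th2E.
set r0 := T t0; set p0 := Num.sqrt (P t0).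
have p0_gt0 : 0 < p0 by rewrite sqrtr_gt0 P0.
(* As functions of the value [th], the squared slope [th1 ^+ 2] grows at rate [2 * m'] at the
   contact point and [P] at rate at most [2 * m]; [k] is midway. *)
pose k := m + m'.
pose E (r : R) := th1 r ^+ 2 - P t0 - k * (th r - t0).
pose D0 (r : R) := th r - t0.
have Edef (r : R) : is_derive r 1 E
    (2 * th1 r * th2 r - k * th1 r).
  have H := is_deriveB (is_deriveB (is_deriveX 2 (dth1 r)) (is_derive_cst (P t0) r 1))
    (is_deriveZ k (is_deriveB (dth r) (is_derive_cst t0 r 1))).
  by apply: is_derive_eq H _; rewrite /GRing.scale/= expr1 !subr0; ring.
have sqp0 : p0 ^+ 2 = P t0 by rewrite sqr_sqrtr// ltW// P0.
have S1 : \forall r \near r0, r != r0 ->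
    0 < E r * (r - r0).
  apply: (derive_sign (Edef r0)); last by rewrite /E thE th1E sqp0; ring.
  by rewrite th1E th2E /k -/p0; nra.
have S2 : \forall r \near r0, r != r0 -> 0 < D0 r * (r - r0).
  have H := is_deriveB (dth r0) (is_derive_cst t0 r0 1).
  have {}H : is_derive r0 1 D0 (th1 r0).
    by apply: is_derive_eq H _; rewrite subr0.
  by apply: (derive_sign H); rewrite ?th1E// /D0 thE subrr.
have cth : th r @[r --> r0] --> t0 by rewrite -[X in _ --> X]thE; exact: is_derive_cont (dth r0).
have cth1 : th1 r @[r --> r0] --> p0 by rewrite /p0 -th1E; exact: is_derive_cont (dth1 r0).
have S3 : \forall r \near r0, a < th r.
  exact: (cvgr_gt t0 cth).
have S4 : \forall r \near r0, 0 < th1 r by exact: (cvgr_gt p0 cth1).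
have S5 : \forall r \near r0,
    (P (th r) - P t0) * (th r - t0) <= k * (th r - t0) ^+ 2.
  have e0 : 0 < m' - m by rewrite subr_gt0.
  have := slope _ e0; have -> : 2 * m + (m' - m) = k by rewrite /k; ring.
  by move=> H; exact: (cth _ H).
have : \forall r \near r0, [/\ a < th r, 0 < th1 r &
    (r0 < r -> 1 <= th1 r * (1 / Num.sqrt (P (th r)))) /\
    (r < r0 -> th1 r * (1 / Num.sqrt (P (th r))) <= 1)].
  near=> r.
  have ar : a < th r by near: r.
  have t1 : 0 < th1 r by near: r.
  have sp : 0 < Num.sqrt (P (th r)) by rewrite sqrtr_gt0 P0.
  have sp2 : Num.sqrt (P (th r)) ^+ 2 = P (th r) by rewrite sqr_sqrtr// ltW// P0.
  have s1 : r != r0 -> 0 < E r * (r - r0) by near: r.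
  have s2 : r != r0 -> 0 < D0 r * (r - r0) by near: r.
  have s5 : (P (th r) - P t0) * (th r - t0) <= k * (th r - t0) ^+ 2 by near: r.
  split => //; split => rr0.
    have d0 : 0 < r - r0 by rewrite subr_gt0.
    have rn : r != r0 by rewrite gt_eqF.
    have := s1 rn; rewrite pmulr_lgt0// /E => {}s1.
    have := s2 rn; rewrite pmulr_lgt0// /D0 => {}s2.
    move: s5; rewrite expr2 mulrA ler_pM2r// => s5.
    rewrite mulrA mulr1 ler_pdivlMr// mul1r.
    by rewrite -ler_sqr ?nnegrE ?ltW// sp2; lra.
  have d0 : r - r0 < 0 by rewrite subr_lt0.
  have rn : r != r0 by rewrite lt_eqF.
  have := s1 rn; rewrite nmulr_lgt0// /E => {}s1.
  have := s2 rn; rewrite nmulr_lgt0// /D0 => {}s2.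
  move: s5; rewrite expr2 mulrA ler_nM2r// => s5.
  rewrite mulrA mulr1 ler_pdivrMr// mul1r.
  by rewrite -ler_sqr ?nnegrE ?ltW// sp2; lra.
move=> /nbhs_ballP[e /= e0 He]; apply/nbhs_ballP; exists e => //= r rr.
have inb (s : R) : (r0 <= s <= r) || (r <= s <= r0) -> ball r0 e s.
  move: rr; rewrite /ball/= !ltr_norml => /andP[r1 r2] /orP[|] /andP[s1 s2]; apply/andP; split; lra.
have inbl (s : R) : r0 < s < r -> ball r0 e s.
  by move=> /andP[s1 s2]; apply: inb; rewrite (ltW s1) (ltW s2).
have inbr (s : R) : r < s < r0 -> ball r0 e s.
  by move=> /andP[s1 s2]; apply: inb; rewrite (ltW s1) (ltW s2) orbT.
split; first by have [] := He r rr.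
pose df s := th1 s * (1 / Num.sqrt (P (th s))) - 1.
have D (s : R) : ball r0 e s -> is_derive s 1 (fun s => (T \o th) s - s) (df s).
  move=> /He[ar _ _]; have H := is_deriveB (is_derive1_comp (dT ar) (dth s))
    (is_derive_id s (1 : R)).
  by apply: is_derive_eq H _; rewrite /df/= mulrC.
have G0 : (T \o th) r0 - r0 = 0 by rewrite /= thE subrr.
rewrite -subr_ge0 -[X in X <= _]G0.
have [rr0|rr0] := leP r0 r.
  apply: (@MVT_ge0 _ (fun s => (T \o th) s - s) df) => //.
  - by move=> s s1; exact/D/inbl.
  - move=> s s1; rewrite subr_ge0.
    by have [_ _ [H _]] := He s (inbl s s1); apply: H; case/andP: s1.
  - apply: within_cont => s s1; apply: is_derive_cont (D s _).
    by apply: inb; rewrite s1.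
rewrite -[X in X <= _]opprK -[X in _ <= X]opprK lerN2.
apply: (@MVT_ge0 _ (fun s => - ((T \o th) s - s)) (fun s => - df s)) => //.
- exact: ltW.
- by move=> s s1; apply: is_deriveN; exact/D/inbr.
- move=> s s1; rewrite oppr_ge0 subr_le0.
  by have [_ _ [_ H]] := He s (inbr s s1); apply: H; case/andP: s1.
- apply: within_cont => s s1; apply: continuousN; apply: is_derive_cont (D s _).
  by apply: inb; rewrite s1 orbT.
Unshelve. all: by end_near.
Qed.

End Profile.

Section Barrier.
Variables (R : realType) (n : nat) (F : 'rV[R]_n -> 'M[R]_n -> R) (f g : R -> R).
Variables (q : R) (O : set 'rV[R]_n) (u : 'rV[R]_n -> R).
Hypothesis n0 : (0 < n)%N.
Hypothesis f_incr : {homo f : x y / x < y}.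
Hypothesis g_incr : {homo g : x y / x <= y}.
Hypothesis F0 : forall x, F x 0 = 0.
Hypothesis F_ell : forall x (X Y : 'M[R]_n), symmetric_mx X -> symmetric_mx Y ->
  psd_mx Y -> 0 <= F x (X + Y) - F x X /\ F x (X + Y) - F x X <= \tr Y.
Hypothesis q0 : 0 < q.
Hypothesis usub : visc_sub F f g q O u.

Lemma F_le_tr x Y : symmetric_mx Y -> psd_mx Y -> F x Y <= \tr Y.
Proof.
move=> sY pY; have s0 : symmetric_mx (0 : 'M[R]_n) by rewrite /symmetric_mx trmx0.
by have [_] := @F_ell x _ _ s0 sY pY; rewrite add0r F0 subr0.
Qed.

Variables (c : 'rV[R]_n) (a rho : R) (T P M K : R -> R).
Hypothesis ballO : forall y, enorm (y - c) <= rho -> O y.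
Hypothesis T0 : T a = 0.
Hypothesis cT : forall t, a <= t -> {for t, continuous T}.
Hypothesis dT : forall t, a < t -> is_derive t 1 T (1 / Num.sqrt (P t)).
Hypothesis P0 : forall t, a < t -> 0 < P t.
Hypothesis Trho : forall t, a < t -> T t <= rho.
Hypothesis M0 : forall t, a < t -> 0 <= M t.
Hypothesis slopeP : forall t e : R, a < t -> 0 < e -> \forall s \near t,
  (P s - P t) * (s - t) <= (2 * M t + e) * (s - t) ^+ 2.
Hypothesis PK : forall s t, a < s -> s <= t -> P s <= 2 * K t * (s - a).
Hypothesis MK : forall t, a < t ->
  M t + (n%:R - 1) * K t <= f t + g t * Num.sqrt (P t) `^ q.
(** At the centre the gradient vanishes and the test paraboloid has Hessian [K t] times the
    identity; its trace must get below any value larger than [f a]. *)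
Hypothesis Ka : forall e, f a < e -> exists2 t, a < t & n%:R * K t <= e.

Lemma barrier : u c <= a.
Proof.
have [uscu visc] := usub.
have rho0 : 0 <= rho.
  have a1 : a < a + 1 by rewrite ltrDl.
  apply: le_trans (Trho a1); rewrite -T0.
  exact/ltW/(profile_lt cT dT P0).
have enc : enorm (c - c) = 0.
  rewrite enorm_sub /sqdist big1 ?sqrtr0// => i _.
  by rewrite subrr expr0n.
have [xm xmK um] : exists2 x, enorm (x - c) <= rho &
    forall y, enorm (y - c) <= rho -> u y <= u x.
  apply: (@usc_max R n [set y | enorm (y - c) <= rho] u).
  - exact: compact_closed_eball.
  - by exists c; rewrite /= enc.
  move=> x /ballO Ox e e0; apply: filterS (uscu x Ox e e0) => y H /ballO; exact: H.
rewrite leNgt; apply/negP => uca.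
(* The level [b] is above every value of [u] on the ball and plays the part of infinity: only the
   piece of the barrier below [b] is used, on the ball of radius [T b]. *)
pose b := Num.max (u xm) a + 1.
have ab : a < b by rewrite /b ltr_pwDr// le_max lexx orbT.
have ub y : enorm (y - c) <= rho -> u y < b.
  move=> /um H; apply: le_lt_trans H _.
  by rewrite /b ltr_pwDr// le_max lexx.
pose r1 := T b.
have r1rho : r1 <= rho by exact: Trho.
(* The inverse of [T] on [[0, r1]]; outside this interval [a] is a default value. *)
pose phi r := xget a [set t | a <= t <= b /\ T t = r].
have phiP r : 0 <= r -> r <= r1 -> a <= phi r <= b /\ T (phi r) = r.
  move=> rr0 rr1; rewrite /phi; case: xgetP => [t -> []//|no].
  have [t] : exists2 t, t \in `[a, b] & T t = r.
    apply: IVT; first exact: ltW.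
      by apply: within_cont => s /andP[s1 _]; exact: cT.
    rewrite T0 ge_min rr0/= le_max; apply/orP; right; exact: rr1.
  by rewrite in_itv/= => abt Tt; have := no t; case.
have phi0 : phi 0 = a.
  have [|/andP[p1 p2] p3] := phiP 0 (lexx 0).
    rewrite -T0; exact/ltW/(profile_lt cT dT P0).
  apply/eqP; rewrite eq_le p1 andbT -(profile_le cT dT P0)// p3 T0//.
pose v y := u y - phi (enorm (y - c)).
have [x0 /= x0K vmax] : exists2 x, enorm (x - c) <= r1 &
    forall y, enorm (y - c) <= r1 -> v y <= v x.
  apply: (@usc_max R n [set y | enorm (y - c) <= r1] v).
  - exact: compact_closed_eball.
  - by exists c; rewrite /= enc -T0; exact/ltW/(profile_lt cT dT P0).
  move=> x /= xr1 e e0.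
  have Ox : O x by apply: ballO; exact: le_trans r1rho.
  have e2 : 0 < e / 2 by rewrite divr_gt0.
  set t := phi (enorm (x - c)).
  have [/andP[at1 tb] Tt] := phiP _ (enorm_ge0 _) xr1.
  have H1 := uscu x Ox _ e2.
  (* Upper semicontinuity of [v] only asks that the barrier be lower semicontinuous. Either
     [t - e / 2] is below [a], hence below the values of [phi], or [T (t - e / 2)] is below the
     radius of [x] and stays below the radius of nearby points. *)
  have H2 : \forall y \near x, enorm (y - c) <= r1 -> t < phi (enorm (y - c)) + e / 2.
    have [ta|at2] := ltP (t - e / 2) a.
      apply: filterS H1 => y _ yr1; have [/andP[ay _] _] := phiP _ (enorm_ge0 _) yr1.
      by rewrite -ltrBlDr; exact: lt_le_trans ay.
    have lt1 : T (t - e / 2) < enorm (x - c).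
      rewrite -[X in _ < X]Tt; apply: (profile_lt cT dT P0) => //.
      by rewrite -/t gtrBl.
    apply: filterS (near_enorm_gt lt1) => y Hy yr1.
    have [/andP[ay _] Ty] := phiP _ (enorm_ge0 _) yr1.
    rewrite -ltrBlDr ltNge -(profile_le cT dT P0)// -ltNge Ty//.
  apply: filterS2 H1 H2 => y h1 h2 yr1; rewrite /v -/t.
  have Oy : O y by apply: ballO; exact: le_trans r1rho.
  have := h1 Oy; have := h2 yr1; lra.
set r0 := enorm (x0 - c) in x0K *.
set t0 := phi r0.
have r00 : 0 <= r0 by exact: enorm_ge0.
have [/andP[at0 t0b] Tt0] := phiP _ r00 x0K.
have r1_ge0 : 0 <= r1 by exact: le_trans x0K.
have vx0 : t0 < u x0.
  have := vmax c; rewrite enc => /(_ r1_ge0); rewrite /v enc phi0 -/r0 -/t0 => H.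
  by rewrite -subr_gt0; apply: lt_le_trans H; rewrite subr_gt0.
(* On the sphere of radius [r1] the barrier equals [b] and exceeds [u], whereas [v] is positive at
   its maximum point because it is positive at [c]. *)
have r0r1 : r0 < r1.
  rewrite lt_neqAle x0K andbT; apply/eqP => r0r1.
  have : b <= t0 by rewrite -(profile_le cT dT P0 (ltW ab) at0) Tt0 r0r1.
  move=> bt0; have := ub x0 (le_trans x0K r1rho).
  by apply/negP; rewrite -leNgt; apply: le_trans bt0 (ltW vx0).
have Ox0 : O x0 by apply: ballO; exact: le_trans r1rho.
have near_r1 : \forall y \near x0, enorm (y - c) <= r1.
  by apply: filterS (near_enorm_lt r0r1) => y /ltW.
have touch al be ga : radial_quartic al be ga c x0 = t0 ->
    (\forall y \near x0, enorm (y - c) <= r1 ->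
       phi (enorm (y - c)) <= radial_quartic al be ga c y) ->
    f (u x0) + g (u x0) * enorm (grad (radial_quartic al be ga c) x0) `^ q
      <= F x0 (hessian (radial_quartic al be ga c) x0).
  move=> psi0 psi; apply: visc => //; first exact: C2_radial.
  apply: filterS2 near_r1 psi => y yr1 H Oy.
  have := H yr1; have := vmax y yr1; rewrite psi0 /v -/r0 -/t0; lra.
have sq0 : sqdist c x0 = r0 ^+ 2 by rewrite enorm_sub_sqr.
(* At the centre a paraboloid touches: [e] lies strictly between [f a] and [f (u x0)], and [Ka]
   supplies an opening [K t1] whose trace is at most [e]. *)
have [r0z|r0nz] := eqVneq r0 0.
  have t0a : t0 = a by rewrite /t0 r0z.
  have fa : f a < f (u x0) by apply: f_incr; rewrite -t0a.
  pose e := (f a + f (u x0)) / 2.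
  have fae : f a < e by rewrite /e; lra.
  have [t1 at1 Kt1] := Ka fae.
  have [k0 _] := profile_slope T0 cT dT P0 (t := t1) (k := K t1) at1
    (fun s as1 st1 => PK as1 st1).
  have Z0 : sqdist c x0 = 0 by rewrite sq0 r0z expr0n.
  have := touch a (K t1 / 2) 0; rewrite grad_radial /radial_quartic Z0.
  rewrite mul0r !mulr0 !addr0 t0a => /(_ erefl).
  have H : \forall y \near x0, enorm (y - c) <= r1 -> phi (enorm (y - c)) <=
     a + K t1 / 2 * sqdist c y.
    have nz : \forall y \near x0, a + K t1 / 2 * sqdist c y < t1.
      have cz : continuous (fun y => a + K t1 / 2 * sqdist c y).
        apply: contD; first exact: contC.
        by apply: contM; [exact: contC|exact: continuous_sqdist].
      by apply: (cvgr_lt _ (cz x0)); rewrite Z0 mulr0 addr0.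
    apply: filterS nz => y yz yr1.
    have [/andP[ay _] Ty] := phiP _ (enorm_ge0 _) yr1.
    have yt1 : a + K t1 / 2 * enorm (y - c) ^+ 2 <= t1.
      by rewrite enorm_sub_sqr; exact: ltW.
    have := @profile_center _ _ _ _ T0 cT dT P0 _ t1 _ k0
       (fun s as1 st1 => PK as1 st1) (enorm_ge0 _) yt1.
    rewrite -[X in X <= T _]Ty (profile_le cT dT P0)// ?enorm_sub_sqr//.
    by rewrite lerDl mulr_ge0 ?sqdist_ge0// divr_ge0// ltW.
  have H' : \forall y \near x0, enorm (y - c) <= r1 -> phi (enorm (y - c)) <=
     a + K t1 / 2 * sqdist c y + 0 * sqdist c y ^+ 2.
    by apply: filterS H => y Hy; rewrite mul0r addr0.
  move=> /(_ H').
  rewrite enorm_scale -/r0 r0z mulr0 powR0 ?gt_eqF// mulr0 addr0.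
  apply/negP; rewrite -ltNge.
  apply: (@le_lt_trans _ _ (\tr (hessian (radial_quartic a (K t1 / 2) 0 c) x0))).
    apply: F_le_tr; first exact: sym_hessian_radial.
    by apply: psd_hessian_radial; rewrite Z0 mulr0 addr0 divr_ge0// ltW.
  rewrite tr_hessian_radial Z0 !mulr0 !addr0.
  have -> : 2 * (K t1 / 2) = K t1 by field.
  by apply: le_lt_trans Kt1 _; rewrite /e; lra.
have r0p : 0 < r0 by rewrite lt_def r0nz r00.
have at0' : a < t0.
  rewrite ltNge; apply/negP; rewrite -(profile_le cT dT P0 at0 (lexx a)) Tt0 T0.
  by rewrite leNgt r0p.
set p0 := Num.sqrt (P t0).
have p0p : 0 < p0 by rewrite sqrtr_gt0 P0.
have fx : f t0 < f (u x0) by exact: f_incr.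
(* Half of the strict gap in [f] pays for raising the second derivative above [M t0]; the other half
   yields the contradiction. *)
pose e := (f (u x0) - f t0) / 2.
have e0 : 0 < e by rewrite divr_gt0// subr_gt0.
(* The test function has the value t0, the slope p0 and the second derivative M' > M t0
   at radius r0, so that it touches the barrier from above. *)
pose M' := M t0 + e; pose B := p0 / r0.
pose ga := (M' - B) / (8 * r0 ^+ 2).
pose be := B / 2 - 2 * ga * r0 ^+ 2.
pose al := t0 - be * r0 ^+ 2 - ga * r0 ^+ 4.
have M'0 : 0 < M' by rewrite /M' ltr_wpDl// M0.
have B0 : 0 < B by rewrite divr_gt0.
have EB : be + 2 * ga * r0 ^+ 2 = B / 2 by rewrite /be; ring.
have EM : be + 6 * ga * r0 ^+ 2 = M' / 2 by rewrite /be /ga; field.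
pose th (r : R) := al + be * r ^+ 2 + ga * r ^+ 4.
pose th1 (r : R) := 2 * be * r + 4 * ga * r ^+ 3.
pose th2 (r : R) := 2 * be + 12 * ga * r ^+ 2.
have dth (r : R) : is_derive r 1 th (th1 r).
  have H := is_deriveD (is_deriveD (is_derive_cst al r 1)
    (is_deriveZ be (is_deriveX 2 (is_derive_id r (1 : R)))))
    (is_deriveZ ga (is_deriveX 4 (is_derive_id r (1 : R)))).
  by apply: is_derive_eq H _; rewrite /GRing.scale/= expr1 /th1; ring.
have dth1 (r : R) : is_derive r 1 th1 (th2 r).
  have H := is_deriveD (is_deriveZ (2 * be) (is_derive_id r (1 : R)))
    (is_deriveZ (4 * ga) (is_deriveX 3 (is_derive_id r (1 : R)))).
  by apply: is_derive_eq H _; rewrite /GRing.scale/= /th2; ring.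
have psiE y : radial_quartic al be ga c y = th (enorm (y - c)).
  by rewrite /radial_quartic /th -enorm_sub_sqr -exprM.
have th_t0 : th r0 = t0 by rewrite /th /al; ring.
have := touch al be ga; rewrite psiE => /(_ th_t0).
have H : \forall y \near x0, enorm (y - c) <= r1 ->
     phi (enorm (y - c)) <= radial_quartic al be ga c y.
  have MM' : M t0 < M' by rewrite ltrDl.
  have := @profile_touch _ _ _ _ dT P0 t0 _ _ th th1 th2 at0' MM'
    (fun e e0 => slopeP at0' e0) dth dth1.
  rewrite Tt0 => /(_ th_t0) [| |d /= d0 Hd].
  - have -> : th1 r0 = r0 * (2 * (be + 2 * ga * r0 ^+ 2)) by rewrite /th1; ring.
    by rewrite EB /B -/p0; field.
  - have -> : th2 r0 = 2 * (be + 6 * ga * r0 ^+ 2) by rewrite /th2; ring.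
    by rewrite EM; field.
  have l1 : enorm (x0 - c) < r0 + d by rewrite ltrDl.
  have l2 : r0 - d < enorm (x0 - c) by rewrite gtrBl.
  apply: filterS2 (near_enorm_lt l1) (near_enorm_gt l2) => y y1 y2 yr1.
  rewrite psiE; have /Hd[ay ry] : ball_ [eta Num.Def.normr] r0 d (enorm (y - c)).
    by rewrite /ball_/= ltr_norml; apply/andP; split; lra.
  have [/andP[ay' _] Ty] := phiP _ (enorm_ge0 _) yr1.
  by rewrite -(profile_le cT dT P0)// ?Ty// ltW.
move=> /(_ H).
rewrite grad_radial enorm_scale -/r0 sq0 EB.
have -> : `|2 * (B / 2)| * r0 = p0.
  by rewrite ger0_norm; [rewrite /B; field|rewrite mulr_ge0// divr_ge0// ltW].
(* There is one radial eigenvalue [M'], and the [n - 1] tangential ones equal [B]. *)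
have FT : F x0 (hessian (radial_quartic al be ga c) x0) <= M' + (n%:R - 1) * B.
  apply: (le_trans (F_le_tr _ _ _)); first exact: sym_hessian_radial.
    apply: psd_hessian_radial; rewrite sq0 ?EB ?EM divr_ge0// ltW//.
  rewrite tr_hessian_radial sq0 EB.
  have -> : 8 * ga * r0 ^+ 2 = M' - B by rewrite /ga; field.
  by rewrite le_eqVlt; apply/orP; left; apply/eqP; field.
have [K0 Kt0] := profile_slope T0 cT dT P0 (t := t0) (k := K t0) at0'
    (fun s as1 st1 => PK as1 st1).
have BK : B <= K t0 by rewrite ler_pdivrMr// -Tt0.
have n1 : 0 <= n%:R - 1 :> R by rewrite subr_ge0 ler1n.
have nBK : (n%:R - 1) * B <= (n%:R - 1) * K t0 by rewrite ler_wpM2l.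
have gg : g t0 * p0 `^ q <= g (u x0) * p0 `^ q.
  by rewrite ler_wpM2r ?powR_ge0// g_incr// ltW.
have := MK at0'; rewrite -/p0 => MKt0 V.
have : f (u x0) <= f t0 + e by rewrite /M' in FT; lra.
by rewrite /e; lra.
Qed.

End Barrier.

(** * Improper integrals *)

Section Primitive.
Variable R : realType.
Notation mu := (@lebesgue_measure R).

Lemma RI_base (h : R -> R) (b t : R) : continuous h -> b < t ->
  is_derive t 1 (RI h b) (h t).
Proof.
move=> ch bt.
have t1 : t < t + 1 by rewrite ltrDl.
have ih : mu.-integrable `[b, t + 1] (EFin \o h).
  apply: continuous_compact_integrable; first exact: segment_compact.
  exact: continuous_subspaceT.
have lbt : (b%:E < t%:E)%E by rewrite lte_fin.
have [] := continuous_FTC1 t1 ih lbt (ch t).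
by move=> D DE; split; [exact: D|rewrite -derive1E].
Qed.

Lemma RI_sub (h : R -> R) (b s t : R) : continuous h -> b < s -> s <= t ->
  RI h s t = RI h b t - RI h b s.
Proof.
move=> ch bs; rewrite le_eqVlt => /predU1P[<-|st].
  by rewrite subrr /RI set_itv1 Rintegral_set1.
have D x : s <= x -> is_derive x 1 (RI h b) (h x).
  by move=> sx; apply: RI_base => //; exact: lt_le_trans sx.
rewrite {1}/RI /Rintegral (@continuous_FTC2 R h (RI h b))//.
- exact: continuous_subspaceT.
- split.
  + by move=> x; rewrite in_itv/= => /andP[/ltW /D[]].
  + apply: cvg_at_right_filter; exact: is_derive_cont (D s (lexx s)).
  + apply: cvg_at_left_filter; exact: is_derive_cont (D t (ltW st)).
- by move=> x; rewrite in_itv/= => /andP[/ltW /D[_ <-] _]; rewrite derive1E.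
Qed.

(** [RI] vanishes on reversed bounds, so a primitive on the whole line needs a sign split at 0. To
    differentiate it at [t], the base point is moved to some [b] strictly to the left of both 0 and
    [t], which changes it by a constant. *)
Lemma RI_primitive (h : R -> R) : continuous h ->
  exists H : R -> R, (forall t : R, is_derive t 1 H (h t)) /\
    forall a b : R, a <= b -> RI h a b = H b - H a.
Proof.
move=> ch; pose H (t : R) := if 0 <= t then RI h 0 t else - RI h t 0.
have HE (b t : R) : b < 0 -> b < t -> H t = RI h b t - RI h b 0.
  move=> b0 bt; rewrite /H; case: leP => t0; first exact: RI_sub.
  by rewrite (RI_sub ch bt (ltW t0)) opprB.
have exb (t : R) : exists2 b, b < 0 & b < t.
  exists (Num.min t 0 - 1).
    by rewrite ltrBlDr (@le_lt_trans _ _ 0)// ?ge_min ?lexx ?orbT// add0r.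
  by rewrite ltrBlDr (@le_lt_trans _ _ t)// ?ge_min ?lexx// ltrDl.
exists H; split=> [t|a b ab].
  have [b b0 bt] := exb t.
  have D := is_deriveB (RI_base ch bt) (is_derive_cst (RI h b 0) t 1).
  rewrite -[h t]subr0; apply: near_eq_is_derive D.
  near=> s; rewrite (HE b)//.
  by near: s; exact: lt_nbhsr.
have [c c0 ca] := exb a.
rewrite (HE c)// ?(lt_le_trans ca)// (HE c)// (RI_sub ch ca ab); ring.
Unshelve. all: by end_near.
Qed.

End Primitive.

Section ImproperIntegral.
Variable R : realType.
Notation mu := (@lebesgue_measure R).
Implicit Types (h w : R -> R) (a : R).

(** The integrands may be singular at [a] itself. *)
Definition cont_after a h := forall t, a < t -> {for t, continuous h}.

Lemma cont_after_measurable a h : cont_after a h ->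
  measurable_fun `]a, +oo[ h.
Proof.
move=> ch; apply: open_continuous_measurable_fun.
  exact: interval_open.
by move=> t /set_mem/=; rewrite in_itv/= andbT; exact: ch.
Qed.

Lemma EI_le a h w : cont_after a h -> cont_after a w ->
  (forall t, a < t -> 0 <= h t <= w t) -> (EI h a <= EI w a)%E.
Proof.
move=> ch cw hw; apply: ge0_le_integral => //.
- by move=> t /=; rewrite in_itv/= andbT lee_fin => /hw/andP[].
- by apply/measurable_EFinP; exact: cont_after_measurable.
- by apply/measurable_EFinP; exact: cont_after_measurable.
- by move=> t /=; rewrite in_itv/= andbT lee_fin => /hw/andP[].
Qed.

Lemma EI_eq a h w : (forall t, a < t -> h t = w t) -> EI h a = EI w a.
Proof.
move=> hw; apply: eq_integral => t /set_mem/=; rewrite in_itv/= andbT => /hw ->//.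
Qed.

Lemma EI_sub a b h : a <= b -> cont_after a h -> (forall t, a < t -> 0 <= h t) ->
  (EI h b <= EI h a)%E.
Proof.
move=> ab ch h0; apply: ge0_subset_integral => //.
- by apply/measurable_EFinP; exact: cont_after_measurable.
- by move=> t /=; rewrite in_itv/= andbT lee_fin; exact: h0.
- by move=> t /=; rewrite !in_itv/= !andbT; exact: le_lt_trans.
Qed.

Lemma EI_scale_fin a h (k : R) : 0 <= k -> cont_after a h ->
  (forall t, a < t -> 0 <= h t) -> (EI h a < +oo)%E ->
  (EI (fun t => (k * h t)%R) a < +oo)%E.
Proof.
move=> k0 ch h0 hfin; rewrite /EI.
under eq_integral do rewrite EFinM.
rewrite ge0_integralZl//.
- by rewrite lte_mul_pinfty.
- by apply/measurable_EFinP; exact: cont_after_measurable.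
- by move=> t /=; rewrite in_itv/= andbT lee_fin; exact: h0.
Qed.

Lemma EI_split_fin a b h w1 w2 : a <= b -> cont_after a h ->
  (forall t, a < t -> 0 <= h t) ->
  cont_after a w1 -> (forall t, a < t -> 0 <= w1 t) -> (EI w1 a < +oo)%E ->
  cont_after b w2 -> (EI w2 b < +oo)%E ->
  (forall t, a < t -> t <= b -> h t <= w1 t) ->
  (forall t, b < t -> h t <= w2 t) -> (EI h a < +oo)%E.
Proof.
move=> ab ch h0 cw1 w10 w1fin cw2 w2fin hw1 hw2.
have chb : cont_after b h by move=> t bt; apply: ch; exact: le_lt_trans bt.
have /measurable_EFinP m1 := cont_after_measurable ch.
have /measurable_EFinP m2 := cont_after_measurable cw1.
rewrite /EI (@itv_bndbnd_setU _ _ _ (BRight b)) ?bnd_simp//.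
rewrite ge0_integral_setU//=; last 3 first.
- rewrite -itv_bndbnd_setU ?bnd_simp//.
- move=> t /= []; rewrite in_itv/= => /andP[H _]; rewrite lee_fin h0//.
  exact: le_lt_trans H.
- apply/disj_setPS => t [/=]; rewrite !in_itv/= => /andP[_ tb] /andP[bt _].
  by have := lt_le_trans bt tb; rewrite ltxx.
apply: lte_add_pinfty.
  have s1 : (`]a, b]%classic : set R) `<=` `]a, +oo[.
    by move=> t /=; rewrite !in_itv/= => /andP[->].
  apply: (@le_lt_trans _ _ (\int[mu]_(t in `]a, b]) (w1 t)%:E)%E).
    apply: ge0_le_integral => //.
    - by move=> t /=; rewrite in_itv/= lee_fin => /andP[? _]; exact: h0.
    - by apply: measurable_funS m1.
    - by apply: measurable_funS m2.
    - by move=> t /=; rewrite in_itv/= lee_fin => /andP[]; exact: hw1.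
  apply: le_lt_trans w1fin; apply: ge0_subset_integral => //.
  by move=> t /=; rewrite in_itv/= andbT lee_fin; exact: w10.
apply: le_lt_trans w2fin; apply: (@EI_le b) => // t bt.
by rewrite hw2// h0//; exact: le_lt_trans bt.
Qed.

(** Boundedness of the primitive replaces limits at both ends: on compact intervals exhausting the
    half-line the integral is a difference of two values of [F], hence at most [2 * L], and monotone
    convergence concludes. *)
Lemma EI_fin_primitive a h (F : R -> R) (L : R) : cont_after a h ->
  (forall t, a < t -> 0 <= h t) -> (forall t : R, a < t -> is_derive t 1 F (h t)) ->
  (forall t, a < t -> `|F t| <= L) -> (EI h a < +oo)%E.
Proof.
move=> ch h0 dF FL.
(* With [m.+1] in the right end the first interval would be a single point, and the fundamental
   theorem needs distinct ends. *)
pose S (m : nat) : set R := `[a + m.+1%:R^-1, a + m.+2%:R]%classic.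
have aS m t : S m t -> a < t.
  rewrite /S/= in_itv/= => /andP[H _]; apply: lt_le_trans H.
  by rewrite ltrDl invr_gt0.
have SE : `]a, +oo[%classic = \bigcup_m S m.
  apply/seteqP; split=> [t /=|t [m _ /aS at0]]; last by rewrite /= in_itv/= andbT.
  rewrite in_itv/= andbT => at0.
  have ta : 0 < t - a by rewrite subr_gt0.
  pose m := maxn (Num.truncn (t - a)) (Num.truncn (t - a)^-1).
  exists m => //; rewrite /S /= in_itv/=; apply/andP; split.
    rewrite -lerBrDl -[leRHS]invrK lef_pV2 ?posrE ?invr_gt0// ltW//.
    apply: lt_le_trans (truncnS_gt _) _.
    by rewrite ler_nat ltnS leq_maxr.
  rewrite -lerBlDl ltW//; apply: lt_le_trans (truncnS_gt _) _.
  by rewrite ler_nat ltnS leqW// leq_maxl.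
rewrite /EI SE.
have mS m : measurable (S m) by exact: measurable_itv.
have ndS : nondecreasing_seq S.
  move=> m p mp; apply/subsetPset => t; rewrite /S /= !in_itv/= => /andP[H1 H2].
  apply/andP; split.
    by apply: le_trans H1; rewrite lerD2l lef_pV2 ?posrE// ler_nat ltnS.
  by apply: le_trans H2 _; rewrite lerD2l ler_nat !ltnS.
have mh m : measurable_fun (S m) (EFin \o h).
  have /measurable_EFinP m1 := cont_after_measurable ch.
  apply: measurable_funS m1 => //.
  by move=> t /aS; rewrite /= in_itv/= andbT.
have cvS : (\int[mu]_(t in S m) (h t)%:E)%E @[m --> \oo] -->
    (\int[mu]_(t in \bigcup_m S m) (h t)%:E)%E.
  apply: ge0_nondecreasing_set_cvg_integral => // m t St.
  by rewrite lee_fin h0// (aS m).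
rewrite -(cvg_lim _ cvS)//.
apply: (@le_lt_trans _ _ (2 * L)%:E); last exact: ltry.
apply: lime_le; first by apply/cvg_ex; eexists; exact: cvS.
apply: nearW => m; rewrite /=.
have lt1 : a + m.+1%:R^-1 < a + m.+2%:R.
  rewrite ltrD2l; apply: (@le_lt_trans _ _ 1); last by rewrite ltr1n.
  by rewrite invf_le1// ler1n.
have al : a < a + m.+1%:R^-1 by rewrite ltrDl invr_gt0.
have al2 := lt_trans al lt1.
rewrite /S (@continuous_FTC2 R h F)//.
- rewrite -EFinB lee_fin; have := FL _ al; have := FL _ al2.
  rewrite !ler_norml => /andP[? ?] /andP[? ?]; lra.
- by apply: within_cont => t /andP[t1 _]; apply: ch; exact: lt_le_trans t1.
- split.
  + move=> t; rewrite in_itv/= => /andP[t1 _].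
    by have [] := dF t (lt_trans al t1).
  + apply: cvg_at_right_filter; exact: is_derive_cont (dF _ al).
  + apply: cvg_at_left_filter; exact: is_derive_cont (dF _ al2).
- move=> t; rewrite in_itv/= => /andP[t1 _]; rewrite derive1E.
  by have [_ ->] := dF t (lt_trans al t1).
Qed.

(** Lebesgue measure is [k] times its image under [s |-> k * s + b]: the two measures agree on
    half-open intervals, and uniqueness of Lebesgue measure gives the substitution rule. *)
Lemma EI_affine (k b c : R) h : 0 < k -> cont_after (k * c + b) h ->
  (forall t, k * c + b < t -> 0 <= h t) ->
  EI h (k * c + b) = (k%:E * EI (fun s => h (k * s + b)%R) c)%E.
Proof.
move=> k0 ch h0; pose phi (s : measurableTypeR R) : measurableTypeR R := k * s + b.
have mphi : measurable_fun [set: measurableTypeR R] phi.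
  apply: (@continuous_measurable_fun R phi) => x.
  apply: cvgD; last exact: cvg_cst.
  by apply: cvgM; [exact: cvg_cst|exact: cvg_id].
have prephi (x y : R) : phi @^-1` `]x, y] = `](x - b) / k, (y - b) / k]%classic.
  apply/seteqP; split => s; rewrite /= /phi !in_itv/= ltr_pdivrMr// ler_pdivlMr//;
  by rewrite ltrBlDr lerBrDr mulrC.
pose kn := NngNum (ltW k0).
pose m1 : {measure set (measurableTypeR R) -> \bar R} :=
  measure_function_pushforward__canonical__measure_function_Measure mu mphi.
pose m2 : {measure set (measurableTypeR R) -> \bar R} := mscale kn m1.
have muE (A : set (measurableTypeR R)) : measurable A -> mu A = m2 A.
  move=> mA; apply: (@lebesgue_measure_unique R m2) => //= _ [[x y]] _ <-.
  rewrite /m2/= /mscale/= /m1/= /pushforward prephi !lebesgue_measure_itv/= !lte_fin.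
  rewrite ltr_pM2r ?invr_gt0// ltrD2r; case: ifP => // xy; last by rewrite mule0.
  by rewrite -!EFinB -EFinM; congr EFin; field; rewrite gt_eqF.
have pre : `]c, +oo[%classic = phi @^-1` `]k * c + b, +oo[.
  by apply/seteqP; split => s; rewrite /= /phi !in_itv/= !andbT ltrD2r ltr_pM2l.
have /measurable_EFinP mh := cont_after_measurable ch.
have h0' t : `]k * c + b, +oo[%classic t -> (0 <= (h t)%:E)%E.
  by rewrite /= in_itv/= andbT lee_fin; exact: h0.
rewrite {1}/EI (eq_measure_integral m2); last by move=> A mA _; exact: muE.
rewrite /m2 ge0_integral_mscale//=; congr (_ * _)%E.
rewrite /m1/= (ge0_integral_pushforward mphi)//.
  by rewrite /EI pre.
by move=> t /set_mem; exact: h0'.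
Qed.

Lemma EI_shift a h : cont_after a h -> (forall t, a < t -> 0 <= h t) ->
  EI h a = EI (fun s => h (s + a)) 0.
Proof.
move=> ch h0; have E : a = 1 * 0 + a by rewrite mulr0 add0r.
rewrite [in LHS]E EI_affine ?mul1e//; last 2 first.
- by rewrite -E.
- by rewrite -E.
by apply: EI_eq => t _; rewrite mul1r.
Qed.

Lemma EI_integrable a h : cont_after a h -> (forall t, a < t -> 0 <= h t) ->
  (EI h a < +oo)%E -> mu.-integrable `]a, +oo[ (EFin \o h).
Proof.
move=> ch h0 hfin; apply/integrableP; split; first by apply/measurable_EFinP; exact: cont_after_measurable.
apply: le_lt_trans hfin; rewrite le_eqVlt; apply/orP; left; apply/eqP.
apply: eq_integral => t /set_mem/=; rewrite in_itv/= andbT => /h0 ht.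
by rewrite ger0_norm.
Qed.

Lemma improper_primitive a h : cont_after a h -> (forall t, a < t -> 0 <= h t) ->
  (EI h a < +oo)%E -> exists T : R -> R, [/\ T a = 0,
    forall t, a <= t -> {for t, continuous T},
    forall t : R, a < t -> is_derive t 1 T (h t) &
    forall t, a < t -> ((T t)%:E <= EI h a)%E].
Proof.
move=> ch h0 hfin.
(* Extension by zero gives a function integrable on the whole line, and the integral over [[a, t]]
   is zero for [t < a]; this makes [T] continuous at [a] from both sides although [h] may be
   singular there. *)
pose h' := h \_ `]a, +oo[.
have ih' : mu.-integrable setT (EFin \o h').
  have H := EI_integrable ch h0 hfin.
  have := (integrable_mkcond (mu := mu) (EFin \o h) (measurable_itv `]a, +oo[)).1 H.
  by rewrite /h' restrict_EFin.
have h'E t : a < t -> h' t = h t.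
  by move=> at0; rewrite /h' patchE mem_set//= in_itv/= andbT.
have h'0 t : 0 <= h' t.
  rewrite /h' patchE; case: ifP => //; move=> /set_mem/=; rewrite in_itv/= andbT.
  exact: h0.
have ih'S (A : set R) : measurable A -> mu.-integrable A (EFin \o h').
  by move=> mA; apply: integrableS ih'.
pose T t := (\int[mu]_(x in `[a, t]) h' x)%R.
have dT t : a < t -> is_derive t 1 T (h t).
  move=> at0; have t1 : t < t + 1 by rewrite ltrDl.
  have ct : {for t, continuous h'}.
    apply: near_eq_continuous (ch t at0).
    by near=> s; rewrite h'E//; near: s; exact: lt_nbhsr.
  have lat : (a%:E < t%:E)%E by rewrite lte_fin.
  have [] := continuous_FTC1 t1 (ih'S _ (measurable_itv `[a, t + 1])) lat ct.
  by move=> D DE; split; [exact: D|rewrite -derive1E DE h'E].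
have Ta : T a = 0 by rewrite /T set_itv1 Rintegral_set1.
exists T; split => //.
- move=> t; rewrite le_eqVlt => /predU1P[<-|at0]; last exact: is_derive_cont (dT t at0).
  have a1 : a < a + 1 by rewrite ltrDl.
  have := parameterized_integral_cvg_left a1 (ih'S _ (measurable_itv `[a, a + 1])).
  by move=> H; suff: T x @[x --> a] --> T a by []; rewrite Ta.
- move=> t at0; rewrite /T /Rintegral fineK.
    rewrite /EI [leRHS]integral_mkcond -/h'.
    have -> : ((fun t => (h t)%:E) \_ `]a, +oo[)%classic = EFin \o h'.
      by rewrite /h' restrict_EFin.
    apply: ge0_subset_integral => //; first by case/integrableP: ih'.
    by move=> x _; rewrite lee_fin.
  apply: integrable_fin_num => //; exact: ih'S.
Unshelve. all: by end_near.
Qed.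

End ImproperIntegral.

(** * Integrals decreasing in a parameter *)

Section Family.
Variables (R : realType) (k : R -> R -> R).
Notation mu := (@lebesgue_measure R).
Notation halfline := (`]0, +oo[%classic : set (measurableTypeR R)).
Hypothesis k_ge0 : forall a s, 0 < s -> 0 <= k a s.
Hypothesis k_dec : forall a b s, a < b -> 0 < s -> k b s < k a s.
Hypothesis k_conta : forall s, 0 < s -> continuous (k^~ s).
Hypothesis k_conts : forall a, cont_after 0 (k a).
(** Since the family decreases in its parameter, finiteness at some smaller parameter suffices; this
    leaves the freedom to start the integral before a convenient point. *)
Hypothesis k_fin : forall a, exists2 b, b <= a & (EI (k b) 0 < +oo)%E.
Hypothesis k_lim : forall s, 0 < s -> k m%:R s @[m --> \oo] --> (0 : R).

Let measurable_halfline : measurable halfline.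
Proof. exact: measurable_itv. Qed.

Lemma family_le a b s : a <= b -> 0 < s -> k b s <= k a s.
Proof.
by rewrite le_eqVlt => /predU1P[->//|ab] s0; exact/ltW/k_dec.
Qed.

Lemma family_fin a : (EI (k a) 0 < +oo)%E.
Proof.
have [b ba bfin] := k_fin a; apply: le_lt_trans bfin.
by apply: EI_le => // t t0; rewrite k_ge0//= family_le.
Qed.

Definition family_int a : R := (\int[mu]_(s in `]0, +oo[) k a s)%R.

Lemma family_integrable a : mu.-integrable halfline (EFin \o k a).
Proof.
apply: EI_integrable; [exact: k_conts|by move=> t; exact: k_ge0|exact: family_fin].
Qed.

Lemma family_intE a : EI (k a) 0 = (family_int a)%:E.
Proof.
rewrite /family_int /Rintegral fineK//.
by apply: integrable_fin_num => //; exact: family_integrable.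
Qed.

(** Otherwise the nonnegative difference of the integrands would have integral zero and vanish
    almost everywhere, but it is positive at every point of a half-line, which is not negligible. *)
Lemma family_int_dec a b : a < b -> family_int b < family_int a.
Proof.
move=> ab; rewrite ltNge; apply/negP => Gab.
have iD : mu.-integrable halfline (EFin \o (fun s => k a s - k b s)).
  have := integrableB measurable_halfline (family_integrable a)
    (family_integrable b).
  by [].
have I0 : (\int[mu]_(s in halfline) `|(k a s - k b s)%R%:E| = 0)%E.
  transitivity (\int[mu]_(s in halfline) (k a s - k b s)%R%:E)%E.
    apply: eq_integral => s /set_mem/=; rewrite in_itv/= andbT => s0.
    by rewrite ger0_norm// subr_ge0 ltW// k_dec.
  have := RintegralB measurable_halfline (family_integrable a)
    (family_integrable b); rewrite -/(family_int a) -/(family_int b) => E.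
  have G0 : (\int[mu]_(s in halfline) (k a s - k b s))%R <= 0.
    by rewrite E subr_le0.
  apply/eqP; rewrite eq_le; apply/andP; split; last first.
    apply: integral_ge0 => s /=; rewrite in_itv/= andbT => s0.
    by rewrite lee_fin subr_ge0 ltW// k_dec.
  rewrite -[X in (X <= _)%E]fineK ?lee_fin//.
  exact: integrable_fin_num.
have mD : measurable_fun halfline (EFin \o (fun s => k a s - k b s)).
  by have /integrableP[] := iD.
have := (ae_eq_integral_abs mu measurable_halfline mD).1 I0.
move=> [N [mN N0 sub]].
have : (mu `]0%R, +oo[ <= mu N)%E.
  apply: le_measure; [exact: mem_set|exact: mem_set|].
  move=> s /= s0; apply: sub => /= H; have := H s0.
  move: s0; rewrite in_itv/= andbT => s0 [] /eqP; rewrite subr_eq0 => /eqP kab.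
  by have := k_dec ab s0; rewrite kab ltxx.
by rewrite N0 lebesgue_measure_itv/= ltry.
Qed.

(** For parameters in []a - 1, a + 1[] the integrand at [a - 1] is a common majorant. *)
Lemma family_int_continuous : continuous family_int.
Proof.
move=> a.
have H := @continuity_under_integral R _ (measurableTypeR R) mu k halfline
  measurable_halfline (a - 1) (a + 1).
apply: (H _ _ (k (a - 1))).
- by move=> x _; exact: family_integrable.
- apply: aeW => s /=; rewrite in_itv/= andbT => s0 x _; exact: k_conta.
- exact: family_integrable.
- move=> x /=; rewrite in_itv/= => /andP[ax _]; apply: aeW => s /=.
  rewrite in_itv/= andbT => s0; rewrite ger0_norm ?k_ge0//.
  by apply: family_le => //; exact: ltW.
- by apply: mem_set; rewrite /= in_itv/= ltrDl gtrBl ltr01.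
Qed.

(** Dominated convergence along the integers with majorant [k 0] is enough, as a single parameter is
    wanted. *)
Lemma family_int_small d : 0 < d -> exists a, family_int a < d.
Proof.
move=> d0.
have mk a : measurable_fun halfline (EFin \o k a).
  by have /integrableP[] := family_integrable a.
have [] := @dominated_convergence _ (measurableTypeR R) R mu halfline
   measurable_halfline (fun m => EFin \o k m%:R) (cst 0%E) (EFin \o k 0).
- by move=> m; exact: mk.
- exact: measurable_cst.
- apply: aeW => s /=; rewrite in_itv/= andbT => s0.
  by apply: cvg_EFin; [exact: nearW|exact: k_lim].
- exact: family_integrable.
- apply: aeW => s m /=; rewrite in_itv/= andbT => s0.
  by rewrite lee_fin ger0_norm ?k_ge0// family_le.
move=> _ _; rewrite integral0.
have -> : [sequence (\int[mu]_(x in `]0%R, +oo[) (EFin \o k n%:R) x)%E]_n =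
    (fun m => (family_int m%:R)%:E).
  by apply/funext => m; rewrite /= -family_intE.
move=> /fine_cvgP[_] /cvgrPdist_lt /(_ d d0) [m _ /(_ m (leqnn m))] /=.
rewrite sub0r normrN => H; exists m%:R; exact: le_lt_trans (ler_norm _) H.
Qed.

End Family.

(** * The generalised inverse of a decreasing function *)

Section Inverse.
Variable R : realType.

(** If [G b < d], continuity gives some [a] slightly below [b], still above [l], with [G a < d],
    which the last hypothesis forbids. So [d <= G b]; as [G] also takes values below [d], the level
    [d] is attained exactly once, not before [b], and the value -oo of [Rinv] is excluded. The bound
    [l] is the level above which barriers are available. *)
Lemma Rinv_bound (Rf : R -> \bar R) (G : R -> R) (l : \bar R) (d b : R) :
  (forall a, Rf a = (G a)%:E) -> continuous G ->
  (forall a b, a < b -> G b < G a) -> (exists a, G a < d) ->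
  (l < b%:E)%E -> (forall a, (l < a%:E)%E -> a < b -> G a < d -> False) ->
  (b%:E <= Rinv Rf d)%E.
Proof.
move=> RfE cG decG [a1 a1d] lb noa.
have Gb : d <= G b.
  rewrite leNgt; apply/negP => Gbd.
  have /nbhs_ballP[e /= e0 He] : \forall a \near b, G a < d.
    exact: (cvgr_lt _ (cG b)).
  have [a [la ab abe]] : exists a, [/\ (l < a%:E)%E, a < b & ball b e a].
    have [r [lr rb]] : exists r : R, (l <= r%:E)%E /\ r < b.
      case: l lb {noa} => [r| |]//; first by rewrite lte_fin; exists r.
      by move=> _; exists (b - 1); rewrite leNye gtrBl.
    pose a := Num.max ((r + b) / 2) (b - e / 2).
    have ra : r < a by rewrite lt_max; apply/orP; left; lra.
    have ab : a < b by rewrite gt_max; apply/andP; split; lra.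
    have ea : b - e / 2 <= a by rewrite le_max lexx orbT.
    exists a; split => //; first by apply: le_lt_trans lr _; rewrite lte_fin.
    by rewrite /ball/= ltr_norml; apply/andP; split; lra.
  by apply: (noa a) => //; exact: He.
have ba1 : b <= a1.
  by rewrite leNgt; apply/negP => /decG; rewrite ltNge (le_trans (ltW a1d) Gb).
have [a] : exists2 a, a \in `[b, a1] & G a = d.
  apply: IVT => //; first exact: continuous_subspaceT.
  by rewrite ge_min (ltW a1d) orbT/= le_max Gb.
rewrite in_itv/= => /andP[ba _] Gad.
have inj x : Rf x = d%:E -> x = a.
  rewrite RfE => -[Gx]; apply/eqP; rewrite eq_le !leNgt; apply/andP; split;
  by apply/negP => /decG; rewrite Gx Gad ltxx.
have Ra : Rf a = d%:E by rewrite RfE Gad.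
rewrite /Rinv; case: asboolP => [_|[]]; last by exists a; split => // x /inj.
case: xgetP => [x -> /= /inj ->|/(_ a)]; first by rewrite lee_fin.
by move=> /(_ Ra).
Qed.

End Inverse.

Section PowerContinuity.
Variable R : realType.

Lemma cont_powR (h : R -> R) (r t : R) : 0 < r -> (forall s, 0 <= h s) ->
  {for t, continuous h} -> {for t, continuous (fun s => h s `^ r)}.
Proof.
(* The power rule covers positive bases only, so a zero of [h] is treated by hand. *)
move=> r0 h0 ch; have := h0 t; rewrite le_eqVlt => /predU1P[ht|ht].
  apply/cvgrPdist_lt => e e0; rewrite -ht powR0 ?gt_eqF//.
  have e1 : 0 < e `^ (1 / r) by exact: powR_gt0.
  have : \forall s \near t, h s < e `^ (1 / r) by apply: (cvgr_lt _ ch); rewrite -ht.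
  apply: filterS => s hs; rewrite sub0r normrN ger0_norm ?powR_ge0//.
  have := gt0_ltr_powR r0 (h0 s) (ltW e1) hs.
  by rewrite -powRrM mul1r mulVf ?gt_eqF// powRr1// ltW.
apply: (@continuous_comp _ _ _ h (fun x => x `^ r)) => //.
apply: differentiable_continuous; apply/derivable1_diffP.
by apply: derivable_powR; rewrite in_itv/= ht.
Qed.

Lemma is_derive_powR (x r : R) : 0 < x -> is_derive x 1 (fun y => y `^ r) (r * x `^ (r - 1)).
Proof.
move=> x0; have xi : x \in `]0, +oo[ by rewrite in_itv/= x0.
split; first exact: derivable_powR.
by rewrite -derive1E powR_derive1.
Qed.

End PowerContinuity.

(** * Integrability of an inverse square-root singularity *)

Section LocalSingularity.
Variable R : realType.

Lemma EI_fin_sqrt (a b c : R) (h w : R -> R) : a < b -> 0 <= c ->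
  cont_after a h -> (forall t, a < t -> 0 <= h t) ->
  (forall t, a < t -> t <= b -> h t <= c / Num.sqrt (t - a)) ->
  cont_after b w -> (EI w b < +oo)%E -> (forall t, b < t -> h t <= w t) ->
  (EI h a < +oo)%E.
Proof.
move=> ab c0 ch h0 hc cw wfin hw.
(* The primitive [2 * sqrt (t - a)] of the model singularity is unbounded at infinity. The majorant
   [w0] is the derivative of a bounded function with the same singularity at [a]; the constant [k]
   below absorbs the factor by which the two differ on []a, b]]. *)
pose F (t : R) := - (1 + Num.sqrt (t - a))^-1.
pose w0 (t : R) := (1 + Num.sqrt (t - a)) ^- 2 * (2 * Num.sqrt (t - a))^-1.
have sp t : 0 < 1 + Num.sqrt (t - a) by rewrite ltr_pwDl// sqrtr_ge0.
have dF (t : R) : a < t -> is_derive t 1 F (w0 t).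
  move=> at0; have ta : 0 < t - a by rewrite subr_gt0.
  have D1 : is_derive t 1 (fun t => Num.sqrt (t - a)) (2 * Num.sqrt (t - a))^-1.
    have D0 := derB (der_id t) (der_cst a t).
    by apply: der_eq (der_comp D0 (is_derive1_sqrt ta)) _; rewrite subr0 mulr1.
  have D2 := derD (der_cst 1 t) D1.
  have D3 := derB (der_cst 0 t) (derV D2 (lt0r_neq0 (sp t))).
  have -> : F = (fun t => 0 - (1 + Num.sqrt (t - a))^-1).
    by apply/funext => y; rewrite /F sub0r.
  by apply: der_eq D3 _; rewrite /w0; ring.
have w00 t : 0 <= w0 t.
  by rewrite /w0 mulr_ge0 ?invr_ge0 ?exprn_ge0 ?mulr_ge0 ?sqrtr_ge0// ltW.
have cw0 : cont_after a w0.
  move=> t at0; have ta : 0 < t - a by rewrite subr_gt0.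
  have cs : {for t, continuous (fun t => Num.sqrt (t - a))}.
    apply: (@continuous_comp _ _ _ (fun t => t - a) Num.sqrt).
      by apply: continuousB; [exact: cvg_id|exact: cvg_cst].
    exact: sqrt_continuous.
  apply: (@continuousM _ _ (fun t => (1 + Num.sqrt (t - a)) ^- 2)
     (fun t => (2 * Num.sqrt (t - a))^-1)).
    apply: (@continuousV _ _ (fun t => (1 + Num.sqrt (t - a)) ^+ 2)).
      by rewrite expf_neq0// lt0r_neq0.
    apply: (@continuous_comp _ _ _ (fun t => 1 + Num.sqrt (t - a)) (fun x => x ^+ 2)).
      by apply: continuousD; [exact: cvg_cst|exact: cs].
    exact: exprn_continuous.
  apply: (@continuousV _ _ (fun t => 2 * Num.sqrt (t - a))).
    by rewrite mulf_neq0// lt0r_neq0// sqrtr_gt0.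
  by apply: continuousM; [exact: cvg_cst|exact: cs].
have w0fin : (EI w0 a < +oo)%E.
  apply: (@EI_fin_primitive _ a w0 F 1) => // t at0.
  rewrite /F normrN ger0_norm ?invr_ge0 ?(ltW (sp _))//.
  by rewrite invf_le1// lerDl sqrtr_ge0.
pose k := 2 * c * (1 + Num.sqrt (b - a)) ^+ 2.
have k0 : 0 <= k by rewrite /k !mulr_ge0// exprn_ge0// ltW.
apply: (@EI_split_fin _ a b h (fun t => k * w0 t) w) => //.
- exact: ltW.
- by move=> t at0; apply: continuousM; [exact: cvg_cst|exact: cw0].
- by move=> t at0; rewrite mulr_ge0.
- exact: EI_scale_fin.
- move=> t at0 tb; apply: le_trans (hc t at0 tb) _.
  have s0 : 0 < Num.sqrt (t - a) by rewrite sqrtr_gt0 subr_gt0.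
  have st : Num.sqrt (t - a) <= Num.sqrt (b - a) by rewrite ler_wsqrtr// lerD2r.
  rewrite /k /w0.
  have -> : 2 * c * (1 + Num.sqrt (b - a)) ^+ 2 *
      ((1 + Num.sqrt (t - a)) ^- 2 * (2 * Num.sqrt (t - a))^-1) =
      c / Num.sqrt (t - a) * ((1 + Num.sqrt (b - a)) ^+ 2 / (1 + Num.sqrt (t - a)) ^+ 2).
    by field; rewrite (lt0r_neq0 (sp t)) (lt0r_neq0 s0).
  rewrite ler_peMr ?divr_ge0 ?sqrtr_ge0// ler_pdivlMr ?exprn_gt0// mul1r.
  by rewrite ler_sqr ?nnegrE ?(ltW (sp _))// lerD2l.
Qed.

End LocalSingularity.

(** * From profiles to the pointwise bound *)

Section Assembly.
Variables (R : realType) (n : nat) (F : 'rV[R]_n -> 'M[R]_n -> R) (f g : R -> R).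
Variables (q : R) (O : set 'rV[R]_n) (u : 'rV[R]_n -> R).
Hypothesis n0 : (0 < n)%N.
Hypothesis f_incr : {homo f : x y / x < y}.
Hypothesis g_incr : {homo g : x y / x <= y}.
Hypothesis F0 : forall x, F x 0 = 0.
Hypothesis F_ell : forall x (X Y : 'M[R]_n), symmetric_mx X -> symmetric_mx Y ->
  psd_mx Y -> 0 <= F x (X + Y) - F x X /\ F x (X + Y) - F x X <= \tr Y.
Hypothesis oO : open O.
Hypothesis bO : boundary O !=set0.
Hypothesis q0 : 0 < q.
Hypothesis usub : visc_sub F f g q O u.

Variables (C : R) (h : R -> R -> R) (Rf : R -> \bar R) (l : \bar R).
Hypothesis C0 : 0 < C.
Hypothesis RfE : forall a, Rf a = (C%:E * EI (h a) a)%E.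
Hypothesis h_ge0 : forall a t, a < t -> 0 <= h a t.
Hypothesis h_cont : forall a, cont_after a (h a).
Hypothesis h_dec : forall a b s, a < b -> 0 < s -> h b (s + b) < h a (s + a).
Hypothesis h_conta : forall s, 0 < s -> continuous (fun a => h a (s + a)).
Hypothesis h_fin : forall a, exists2 b, b <= a & (EI (h b) b < +oo)%E.
Hypothesis h_lim : forall s, 0 < s -> h m%:R (s + m%:R) @[m --> \oo] --> (0 : R).

(* [P] is the squared slope of the barrier as a function of its value, [M] bounds
   its second derivative from above and [K] bounds slope/radius. [P] need not be
   differentiable, hence the one-sided difference quotient. *)
Definition is_profile (a : R) (P M K : R -> R) :=
  [/\ (forall t, a < t -> 0 < P t) /\ cont_after a P,
      (forall t, a < t -> 1 / Num.sqrt (P t) <= C * h a t) /\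
      (forall t, a < t -> 0 <= M t),
      forall t e : R, a < t -> 0 < e -> \forall s \near t,
        (P s - P t) * (s - t) <= (2 * M t + e) * (s - t) ^+ 2,
      forall s t, a < s -> s <= t -> P s <= 2 * K t * (s - a) &
      (forall t, a < t -> M t + (n%:R - 1) * K t <= f t + g t * Num.sqrt (P t) `^ q) /\
      forall e, f a < e -> exists2 t, a < t & n%:R * K t <= e].

Hypothesis profiles : forall a, (l < a%:E)%E -> exists P M K, is_profile a P M K.

(** Translation by [a] moves all the integrals to one half-line, where the integrands decrease with
    [a] at every point. If [G a] is below the distance, the closed ball of radius [G a] lies in [O]
    and [T] stays below [G a], so the barrier works with [rho] equal to [G a]. *)
Lemma profile_bound x : O x -> (l < (u x)%:E)%E ->
  ((u x)%:E <= Rinv Rf (dist_bd O x))%E.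
Proof.
move=> Ox lu; pose k a s := h a (s + a).
have sa a (s : R) : 0 < s -> a < s + a by rewrite ltrDr.
have k_ge0 a s : 0 < s -> 0 <= k a s by move=> s0; exact/h_ge0/sa.
have kE a : EI (h a) a = EI (k a) 0.
  by apply: EI_shift => // t; exact: h_ge0.
have k_conts a : cont_after 0 (k a).
  move=> s s0; apply: (@continuous_comp _ _ _ (fun s => s + a) (h a)).
    by apply: continuousD; [exact: cvg_id|exact: cvg_cst].
  exact/h_cont/sa.
have k_fin a : exists2 b, b <= a & (EI (k b) 0 < +oo)%E.
  by have [b ba bf] := h_fin a; exists b => //; rewrite -kE.
have intE := family_intE k_ge0 h_dec k_conts k_fin.
pose G a := C * family_int k a.
have RfG a : Rf a = (G a)%:E by rewrite RfE kE intE EFinM.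
have d0 := dist_bd_gt0 oO bO Ox.
apply: (@Rinv_bound _ Rf G l) => //.
- move=> a; apply: continuousM; first exact: cvg_cst.
  exact: (family_int_continuous k_ge0 h_dec h_conta k_conts k_fin).
- move=> a b ab; rewrite ltr_pM2l//.
  exact: (family_int_dec k_ge0 h_dec k_conts k_fin).
- have [|a Ha] := family_int_small k_ge0 h_dec k_conts k_fin h_lim (d := dist_bd O x / C).
    by rewrite divr_gt0.
  by exists a; rewrite /G mulrC -ltr_pdivlMr.
move=> a la au Gad.
have [P [M [K [[P0 cP] [Ph M0] slope PK [MK Ka]]]]] := profiles la.
pose p t := 1 / Num.sqrt (P t).
have p0 t : a < t -> 0 <= p t by rewrite divr_ge0 ?sqrtr_ge0.
have cp : cont_after a p.
  move=> t at0; apply: continuousM; first exact: cvg_cst.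
  apply: (@continuousV _ _ (fun t => Num.sqrt (P t))).
    by rewrite lt0r_neq0// sqrtr_gt0 P0.
  apply: (@continuous_comp _ _ _ P Num.sqrt); first exact: cP.
  exact: sqrt_continuous.
have pG : (EI p a <= (G a)%:E)%E.
  rewrite -RfG RfE /EI -ge0_integralZl//=.
  - apply: (@EI_le _ a p (fun t => C * h a t)) => //.
    + by move=> t at0; apply: continuousM; [exact: cvg_cst|exact: h_cont].
    + by move=> t at0; rewrite p0//= Ph.
  - by apply/measurable_EFinP; exact: cont_after_measurable.
  - by move=> t /=; rewrite in_itv/= andbT lee_fin; exact: h_ge0.
  - by rewrite lee_fin ltW.
have pfin : (EI p a < +oo)%E by apply: le_lt_trans pG _; exact: ltry.
have [T [Ta cT dT TE]] := improper_primitive cp p0 pfin.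
suff : u x <= a by rewrite leNgt au.
apply: (@barrier _ _ F f g q O u n0 f_incr g_incr F0 F_ell q0 usub x a (G a) T P M K) => //.
- exact: (closed_ball_sub oO Ox Gad).
- by move=> t at0; rewrite -lee_fin; exact: le_trans (TE t at0) pG.
Qed.

End Assembly.

(** * Primitives of monotone functions *)

Section MonotonePrimitive.
Variables (R : realType) (h H : R -> R).
Hypothesis dH : forall t : R, is_derive t 1 H (h t).

Lemma primitive_continuous : continuous H.
Proof. by move=> t; exact: is_derive_cont (dH t). Qed.

Lemma primitive_mvt a b : a < b -> exists2 c, a < c < b & H b - H a = h c * (b - a).
Proof.
move=> ab.
have cH : {within `[a, b], continuous H}.
  by apply: within_cont => x _; exact: primitive_continuous.
have [c] := @MVT R H h a b ab (fun x _ => dH x) cH.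
by rewrite in_itv/= => cab E; exists c.
Qed.

Lemma primitive_le a b v : a <= b -> (forall c, a < c < b -> h c <= v) ->
  H b - H a <= v * (b - a).
Proof.
rewrite le_eqVlt => /predU1P[->|ab hv]; first by rewrite !subrr mulr0.
by have [c cab ->] := primitive_mvt ab; rewrite ler_wpM2r ?hv// subr_ge0 ltW.
Qed.

Lemma primitive_ge a b v : a <= b -> (forall c, a < c < b -> v <= h c) ->
  v * (b - a) <= H b - H a.
Proof.
rewrite le_eqVlt => /predU1P[->|ab hv]; first by rewrite !subrr mulr0.
by have [c cab ->] := primitive_mvt ab; rewrite ler_wpM2r ?hv// subr_ge0 ltW.
Qed.

Lemma is_derive_shift (s a : R) :
  is_derive a 1 (fun a => H (s + a) - H a) (h (s + a) - h a).
Proof.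
have D2 := derB (der_comp (derD (der_cst s a) (der_id a)) (dH (s + a))) (dH a).
by apply: der_eq D2 _; rewrite add0r mulr1.
Qed.

Lemma primitive_shift_le a b s : {homo h : x y / x <= y} -> a <= b -> 0 <= s ->
  H (s + a) - H a <= H (s + b) - H b.
Proof.
move=> hh ab s0; apply: (@MVT_ge0 _ (fun a => H (s + a) - H a)
  (fun a => h (s + a) - h a)) => //.
- by move=> x _; exact: is_derive_shift.
- by move=> x _; rewrite subr_ge0 hh// lerDr.
- by apply: within_cont => x _; exact: is_derive_cont (is_derive_shift s x).
Qed.

Lemma primitive_shift_lt a b s : {homo h : x y / x < y} -> a < b -> 0 < s ->
  H (s + a) - H a < H (s + b) - H b.
Proof.
move=> hh ab s0; apply: (@MVT_gt0 _ (fun a => H (s + a) - H a)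
  (fun a => h (s + a) - h a)) => //.
- by move=> x _; exact: is_derive_shift.
- by move=> x _; rewrite subr_gt0 hh// ltrDr.
- by apply: within_cont => x _; exact: is_derive_cont (is_derive_shift s x).
Qed.

Lemma primitive_shift_cont s : continuous (fun a => H (s + a) - H a).
Proof. by move=> a; exact: is_derive_cont (is_derive_shift s a). Qed.

End MonotonePrimitive.

(** * Solutions of the linear equation Y' = f + m Y *)

Section LinearEquation.
Variables (R : realType) (f m G Ps : R -> R).
Hypothesis f_incr : {homo f : x y / x < y}.
Hypothesis f_gt0 : forall t, 0 < f t.
Hypothesis m_incr : {homo m : x y / x <= y}.
Hypothesis dG : forall t : R, is_derive t 1 G (m t).
Hypothesis dPs : forall t : R, is_derive t 1 Ps (expR (- G t) * f t).

(** Variation of constants for the solution vanishing at [a]; the base point enters only through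
    [Ps a]. *)
Definition lin_sol a t := expR (G t) * (Ps t - Ps a).
Notation Y := lin_sol.

Let f_le : {homo f : x y / x <= y}.
Proof. by move=> x y; rewrite le_eqVlt => /predU1P[->//|/f_incr/ltW]. Qed.

Let Ps_incr x y : x < y -> Ps x < Ps y.
Proof.
move=> xy; have [c _ E] := primitive_mvt dPs xy.
by rewrite -subr_gt0 E !mulr_gt0 ?expR_gt0// subr_gt0.
Qed.

Lemma lin_sol_id a : Y a a = 0. Proof. by rewrite /Y subrr mulr0. Qed.

Lemma lin_sol_derive a (t : R) : is_derive t 1 (Y a) (f t + m t * Y a t).
Proof.
have D := derM (der_expR (dG t)) (derB (dPs t) (der_cst (Ps a) t)).
apply: der_eq D _; rewrite /Y subr0 !mulrA.
by rewrite expRxMexpNx_1; ring.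
Qed.

Lemma lin_sol_gt0 a t : a < t -> 0 < Y a t.
Proof. by move=> at0; rewrite mulr_gt0 ?expR_gt0// subr_gt0 Ps_incr. Qed.

Lemma lin_sol_ge0 a t : a <= t -> 0 <= Y a t.
Proof.
by rewrite le_eqVlt => /predU1P[->|/lin_sol_gt0/ltW//]; rewrite lin_sol_id.
Qed.

Lemma lin_sol_cont a : continuous (Y a).
Proof. by move=> t; exact: is_derive_cont (lin_sol_derive a t). Qed.

Lemma lin_sol_shift_cont s : continuous (fun a => Y a (s + a)).
Proof.
apply: contM; last exact: primitive_shift_cont dPs s.
move=> a; apply: (is_derive_cont (d := m (s + a) * 1 * expR (G (s + a)))).
have D := der_expR (der_comp (derD (der_cst s a) (der_id a)) (dG (s + a))).
by apply: der_eq D _; rewrite add0r.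
Qed.

(** [D] is the difference of the two translated solutions times an integrating factor. What remains
    of its derivative is the increment of [f], which is positive, plus the increment of [m] times a
    nonnegative solution. *)
Lemma lin_sol_shift_lt a b s : a < b -> 0 < s -> Y a (s + a) < Y b (s + b).
Proof.
move=> ab s0.
pose D (x : R) := expR (0 - G (x + b)) * (Y b (x + b) - Y a (x + a)).
pose dD (x : R) := expR (0 - G (x + b)) *
  (f (x + b) - f (x + a) + (m (x + b) - m (x + a)) * Y a (x + a)).
have DD (x : R) : is_derive x 1 D (dD x).
  have dx c := derD (der_id x) (der_cst c x).
  have H := derM (der_expR (derB (der_cst 0 x) (der_comp (dx b) (dG (x + b)))))
    (derB (der_comp (dx b) (lin_sol_derive b (x + b)))
          (der_comp (dx a) (lin_sol_derive a (x + a)))).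
  by apply: der_eq H _; rewrite /dD; ring.
have : D 0 < D s.
  apply: (@MVT_gt0 _ D dD) => //.
    move=> x /andP[x0 _]; rewrite mulr_gt0 ?expR_gt0//.
    apply: ltr_pwDl; first by rewrite subr_gt0 f_incr// ltrD2l.
    rewrite mulr_ge0//; first by rewrite subr_ge0 m_incr// lerD2l ltW.
    by apply: lin_sol_ge0; rewrite lerDr ltW.
  by apply: within_cont => x _; exact: is_derive_cont (DD x).
rewrite /D !add0r !lin_sol_id subrr mulr0 pmulr_rgt0 ?expR_gt0//.
by rewrite subr_gt0.
Qed.

(** The constant [v] is a nonpositive lower bound of [m] beyond [a], so coefficients of either sign
    are covered. The bound controls the singularity of [lin_h] at [a] and, when [m] is nonpositive,
    the limit as the base point goes to infinity. *)
Lemma lin_sol_lower a t (v : R) : v <= 0 -> v <= m a -> a <= t ->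
  expR (v * (t - a)) * (f a * (t - a)) <= Y a t.
Proof.
move=> v0 vm at0.
pose E (x : R) := expR (- v * (x - a)) * Y a x.
pose dE (x : R) := expR (- v * (x - a)) * (f x + (m x - v) * Y a x).
have DE (x : R) : is_derive x 1 E (dE x).
  have H := derM (der_expR (derM (der_cst (- v) x) (derB (der_id x) (der_cst a x))))
    (lin_sol_derive a x).
  by apply: der_eq H _; rewrite /dE; ring.
have : f a * (t - a) <= E t - E a.
  apply: (primitive_ge DE) => // x /andP[ax _].
  have e1 : 1 <= expR (- v * (x - a)).
    by apply: expR_ge1Dx_ge0 || rewrite -expR0 ler_expR mulr_ge0 ?oppr_ge0// subr_ge0 ltW.
  have f1 : f a <= f x + (m x - v) * Y a x.
    rewrite ler_wpDr ?f_le ?(ltW ax)// mulr_ge0 ?lin_sol_ge0 ?(ltW ax)//.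
    by rewrite subr_ge0 (le_trans vm)// m_incr// ltW.
  have f0 := ltW (f_gt0 a).
  by rewrite -[leLHS]mul1r; apply: ler_pM.
rewrite /E lin_sol_id mulr0 subr0 => H.
rewrite -[leRHS]mul1r -[X in _ <= X * _](expRxMexpNx_1 (v * (t - a))) -mulrA.
by rewrite ler_pM2l ?expR_gt0// -mulNr.
Qed.

Lemma lin_sol_lower0 a t : 0 <= m a -> a <= t -> f a * (t - a) <= Y a t.
Proof.
by move=> m0 at0; have := lin_sol_lower (lexx 0) m0 at0; rewrite mul0r expR0 mul1r.
Qed.

(** Feeding the linear lower bound back into the equation gains a factor [m a]; this is what makes
    the solution large when [f] stays bounded and [g] does not. *)
Lemma lin_sol_lower2 a t : 0 <= m a -> a <= t ->
  f a * m a * (t - a) ^+ 2 / 2 <= Y a t.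
Proof.
move=> m0 at0.
pose E (x : R) := Y a x - f a * m a / 2 * (x - a) * (x - a).
pose dE (x : R) := f x + m x * Y a x - f a * m a * (x - a).
have DE (x : R) : is_derive x 1 E (dE x).
  have dx := derB (der_id x) (der_cst a x).
  have H := derB (lin_sol_derive a x) (derM (derM (der_cst (f a * m a / 2) x) dx) dx).
  by apply: der_eq H _; rewrite /dE; field.
have : E a <= E t.
  apply: (@MVT_ge0 _ E dE) => //.
    move=> x /andP[ax _]; rewrite /dE subr_ge0 ler_wpDl ?(ltW (f_gt0 x))//.
    rewrite [f a * _]mulrC -mulrA; apply: ler_pM => //.
    - by rewrite mulr_ge0 ?(ltW (f_gt0 _))// subr_ge0 ltW.
    - by rewrite m_incr// ltW.
    - by apply: lin_sol_lower0 => //; exact: ltW.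
  by apply: within_cont => x _; exact: is_derive_cont (DE x).
rewrite /E lin_sol_id subrr mulr0 subr0 subr_ge0; apply: le_trans.
by rewrite le_eqVlt; apply/orP; left; apply/eqP; field.
Qed.

Lemma lin_sol_upper_neg a s t : (forall x, m x <= 0) -> a < s -> s <= t ->
  Y a s <= f t * (s - a).
Proof.
move=> m0 as0 st; have := @primitive_le _ _ _ (lin_sol_derive a) a s (f t) (ltW as0).
rewrite lin_sol_id subr0; apply => x /andP[ax xs].
apply: (@le_trans _ _ (f x)); last by rewrite f_le// (le_trans (ltW xs)).
by rewrite gerDl mulr_le0_ge0// lin_sol_ge0// ltW.
Qed.

Lemma lin_sol_homo a x y : 0 <= m a -> a <= x -> x <= y -> Y a x <= Y a y.
Proof.
move=> m0 ax xy; apply: (@MVT_ge0 _ (Y a) (fun t => f t + m t * Y a t)) => //.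
- by move=> t _; exact: lin_sol_derive.
- move=> t /andP[xt _]; have at0 := le_trans ax (ltW xt).
  rewrite addr_ge0 ?(ltW (f_gt0 _))// mulr_ge0 ?lin_sol_ge0//.
  exact: le_trans m0 (m_incr at0).
- by apply: within_cont => t _; exact: lin_sol_cont.
Qed.

Lemma lin_sol_upper_pos a s t : 0 <= m a -> a < s -> s <= t ->
  Y a s <= (f t + m t * Y a t) * (s - a).
Proof.
move=> m0 as0 st.
have := @primitive_le _ _ _ (lin_sol_derive a) a s (f t + m t * Y a t) (ltW as0).
rewrite lin_sol_id subr0; apply => x /andP[ax xs].
have xt := le_trans (ltW xs) st; have mx := le_trans m0 (m_incr (ltW ax)).
apply: lerD; first exact: f_le.
apply: ler_pM => //; first exact/lin_sol_ge0/ltW.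
- exact: m_incr.
- by apply: lin_sol_homo => //; exact: ltW.
Qed.

Lemma lin_sol_growth a t1 t (v : R) : v <= m t1 -> a <= t1 -> t1 <= t ->
  Y a t1 * expR (v * (t - t1)) <= Y a t.
Proof.
move=> vm at1 t1t.
pose E (x : R) := expR (- v * (x - t1)) * Y a x.
pose dE (x : R) := expR (- v * (x - t1)) * (f x + (m x - v) * Y a x).
have DE (x : R) : is_derive x 1 E (dE x).
  have H := derM (der_expR (derM (der_cst (- v) x) (derB (der_id x) (der_cst t1 x))))
    (lin_sol_derive a x).
  by apply: der_eq H _; rewrite /dE; ring.
have : E t1 <= E t.
  apply: (@MVT_ge0 _ E dE) => //.
    move=> x /andP[t1x _]; rewrite mulr_ge0 ?(ltW (expR_gt0 _))//.
    rewrite addr_ge0 ?(ltW (f_gt0 _))// mulr_ge0//.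
      by rewrite subr_ge0 (le_trans vm)// m_incr// ltW.
    by apply: lin_sol_ge0; rewrite (le_trans at1)// ltW.
  by apply: within_cont => x _; exact: is_derive_cont (DE x).
rewrite /E subrr mulr0 expR0 mul1r => H.
rewrite mulrC -[leRHS]mul1r -[X in _ <= X * _](expRxMexpNx_1 (v * (t - t1))) -mulrA.
by rewrite ler_pM2l ?expR_gt0// -mulNr.
Qed.

Lemma lin_sol_base a b t : b <= a -> Y a t <= Y b t.
Proof.
rewrite le_eqVlt => /predU1P[->//|ba].
by rewrite /Y ler_pM2l ?expR_gt0// lerD2l lerN2 ltW// Ps_incr.
Qed.

(** For constant [kap] the solution saturates at [1 / (2 * kap)]. For nonincreasing [kap] the value
    at [t] is frozen: [E] is nondecreasing up to [t], because [expR (- G x) / 2] has derivative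
    [kap x * (expR (- G x) * f x)]. *)
Lemma lin_sol_half (kap : R -> R) a t : {homo kap : x y /~ x <= y} ->
  (forall x, m x = - 2 * (kap x * f x)) -> a <= t -> kap t * Y a t <= 1 / 2.
Proof.
move=> hk mk at0.
pose E (x : R) := expR (- G x) / 2 - kap t * Ps x.
pose dE (x : R) := expR (- G x) * f x * (kap x - kap t).
have DE (x : R) : is_derive x 1 E (dE x).
  have H := derB (derM (der_expR (derB (der_cst 0 x) (dG x))) (der_cst (2^-1) x))
    (derM (der_cst (kap t) x) (dPs x)).
  have -> : E = (fun x => expR (0 - G x) / 2 - kap t * Ps x).
    by apply/funext => y; rewrite sub0r.
  by apply: der_eq H _; rewrite /dE mk !sub0r; field.
have : E a <= E t.
  apply: (@MVT_ge0 _ E dE) => //.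
    move=> x /andP[_ xt]; rewrite !mulr_ge0 ?(ltW (expR_gt0 _)) ?(ltW (f_gt0 _))//.
    by rewrite subr_ge0 hk// ltW.
  by apply: within_cont => x _; exact: is_derive_cont (DE x).
rewrite /E => H.
have H1 : kap t * (Ps t - Ps a) <= expR (- G t) / 2.
  by have := expR_gt0 (- G a); rewrite mulrBr; lra.
rewrite /Y mulrCA; have := ler_wpM2l (ltW (expR_gt0 (G t))) H1.
by move=> /le_trans; apply; rewrite mulrA expRxMexpNx_1.
Qed.

Definition lin_h a t := 1 / Num.sqrt (Y a t).

Lemma lin_h_ge0 a t : 0 <= lin_h a t.
Proof. by rewrite divr_ge0 ?sqrtr_ge0. Qed.

Lemma cont_inv_sqrt (y : R -> R) t : 0 < y t -> {for t, continuous y} ->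
  {for t, continuous (fun s => 1 / Num.sqrt (y s))}.
Proof.
move=> y0 cy; apply: continuousM; first exact: cvg_cst.
apply: (@continuousV _ _ (fun t => Num.sqrt (y t))).
  by rewrite lt0r_neq0// sqrtr_gt0.
apply: (@continuous_comp _ _ _ y Num.sqrt); first exact: cy.
exact: sqrt_continuous.
Qed.

Lemma lin_h_cont a : cont_after a (lin_h a).
Proof. by move=> t at0; apply: cont_inv_sqrt; [exact: lin_sol_gt0|exact: lin_sol_cont]. Qed.

Lemma lin_h_conta s : 0 < s -> continuous (fun a => lin_h a (s + a)).
Proof.
move=> s0 a; apply: (@cont_inv_sqrt (fun a => Y a (s + a))).
  by rewrite lin_sol_gt0// ltrDr.
exact: lin_sol_shift_cont.
Qed.

Lemma lin_h_dec a b s : a < b -> 0 < s -> lin_h b (s + b) < lin_h a (s + a).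
Proof.
move=> ab s0; have Ya : 0 < Y a (s + a) by rewrite lin_sol_gt0// ltrDr.
have Yab := lin_sol_shift_lt ab s0.
have Yb := lt_trans Ya Yab.
by rewrite /lin_h !div1r ltf_pV2 ?posrE ?sqrtr_gt0//; rewrite ltr_sqrt.
Qed.

Lemma lin_h_local a b : a < b -> exists2 c, 0 <= c &
  forall t, a < t -> t <= b -> lin_h a t <= c / Num.sqrt (t - a).
Proof.
move=> ab; pose v := Num.min 0 (m a).
have v0 : v <= 0 by rewrite ge_min lexx.
have vm : v <= m a by rewrite ge_min lexx orbT.
pose e := expR (v * (b - a)) * f a.
have e0 : 0 < e by rewrite mulr_gt0 ?expR_gt0.
exists (1 / Num.sqrt e) => [|t at0 tb]; first by rewrite divr_ge0 ?sqrtr_ge0.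
have ta : 0 < t - a by rewrite subr_gt0.
have eta := mulr_gt0 e0 ta.
rewrite /lin_h !div1r -invfM -sqrtrM ?(ltW e0)// lef_pV2 ?posrE ?sqrtr_gt0 ?lin_sol_gt0//.
apply: ler_wsqrtr; apply: le_trans (lin_sol_lower v0 vm (ltW at0)).
rewrite /e -mulrA ler_pM2r ?mulr_gt0// ler_expR ler_wnM2l// lerD2r//.
Qed.

End LinearEquation.

Section LinearIntegral.
Variables (R : realType) (f m0 G0 Ps : R -> R) (c : R).
Hypothesis cf : continuous f.
Hypothesis RIm : forall a b : R, a <= b -> RI m0 a b = G0 b - G0 a.
Hypothesis RIPs : forall a b : R, a <= b ->
  RI (fun t => expR (- (c * G0 t)) * f t) a b = Ps b - Ps a.
Hypothesis cI : continuous (fun t => expR (- (c * G0 t)) * f t).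

(** The kernel splits as a factor in [t] times a factor in [s], so the iterated integral in the
    definition of [R] is the solution of the linear equation that vanishes at [a]. *)
Lemma RI_lin_sol a t : a <= t ->
  RI (fun s => expR (c * RI m0 s t) * f s) a t = lin_sol (fun t => c * G0 t) Ps a t.
Proof.
move=> at0; rewrite /lin_sol -RIPs// /RI.
rewrite -RintegralZl//; last first.
  apply: continuous_compact_integrable; first exact: segment_compact.
  exact: continuous_subspaceT.
apply: eq_Rintegral => s /set_mem/=; rewrite in_itv/= => /andP[as0 st].
by rewrite -[X in c * X]/(RI m0 s t) RIm// mulrBr expRD mulrA.
Qed.

End LinearIntegral.

(** * Limits, positive and negative parts, difference quotients *)

Section Limits.
Variable R : realType.

Lemma near_pinfty_nat (Q : R -> Prop) : (\forall t \near +oo, Q t) ->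
  exists N : nat, forall m : nat, (N <= m)%N -> Q m%:R.
Proof.
move=> [M [_ MQ]]; exists (Num.truncn `|M|).+1 => m Nm; apply: MQ.
apply: le_lt_trans (ler_norm _) _; apply: lt_le_trans (truncnS_gt _) _.
by rewrite ler_nat.
Qed.

Lemma inv_cvg0 (x k : nat -> R) : (forall m, 0 <= k m) ->
  (forall m, 0 < x m -> k m <= 1 / x m) ->
  (forall A, exists N : nat, forall m : nat, (N <= m)%N -> A < x m) ->
  k m @[m --> \oo] --> (0 : R).
Proof.
move=> k0 kx xA; apply/cvgrPdist_lt => e e0.
have [N HN] := xA e^-1; exists N => // m /= /HN xm.
have ei : 0 < e^-1 by rewrite invr_gt0.
have x0 := lt_trans ei xm.
rewrite sub0r normrN ger0_norm//; apply: le_lt_trans (kx m x0) _.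
by rewrite div1r -[ltRHS]invrK ltf_pV2 ?posrE.
Qed.

Lemma inv_sqrt_cvg0 (y k : nat -> R) : (forall m, 0 <= k m) ->
  (forall m, 0 < y m -> k m <= 1 / Num.sqrt (y m)) ->
  (forall A, exists N : nat, forall m : nat, (N <= m)%N -> A < y m) ->
  k m @[m --> \oo] --> (0 : R).
Proof.
move=> k0 ky yA; apply: (@inv_cvg0 (fun m => Num.sqrt (y m))) => //.
  by move=> m; rewrite sqrtr_gt0; exact: ky.
move=> A; have [N HN] := yA (A ^+ 2); exists N => m /HN Ay.
apply: le_lt_trans (ler_norm A) _; rewrite -sqrtr_sqr ltr_sqrt//.
exact: le_lt_trans (sqr_ge0 _) Ay.
Qed.

(** A finite limit of [g] will force [f] to tend to infinity; otherwise [g] does. Either way the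
    integrand of [R] vanishes as its base point goes to infinity. *)
Lemma limit_dichotomy (g : R -> R) :
  (exists l : \bar R, (0 < l)%E /\ (g t)%:E @[t --> +oo] --> l) ->
  (exists t, 0 < g t) /\
  ((exists l : R, g t @[t --> +oo] --> l) \/ forall A, \forall t \near +oo, A < g t).
Proof.
have ex (Q : R -> Prop) : (\forall t \near +oo, Q t) -> exists t, Q t.
  by move=> /near_pinfty_nat[N HN]; exists N%:R; exact: HN.
move=> [[r| |] [l0 gl]] //.
  have {}gl : g t @[t --> +oo] --> r by move/fine_cvgP : gl => [].
  split; last by left; exists r.
  by apply: ex; apply: (cvgr_gt r gl); rewrite lte_fin in l0.
have gA A : \forall t \near +oo, A < g t.
  by move/cvgeyPgt : gl => /(_ A); apply: filterS => t; rewrite lte_fin.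
by split; [exact: ex|right].
Qed.

Lemma cont_right_lt (phi : R -> R) a e : {for a, continuous phi} -> phi a < e ->
  exists2 t, a < t & phi t <= e.
Proof.
move=> cphi pe.
have /nbhs_ballP[d /= d0 Hd] : \forall t \near a, phi t < e by exact: (cvgr_lt _ cphi).
exists (a + d / 2); first by rewrite ltrDl divr_gt0.
apply: ltW; apply: Hd; rewrite /ball/= opprD addrA subrr sub0r normrN.
by rewrite ger0_norm ?divr_ge0 ?(ltW d0)//; lra.
Qed.

Lemma pos_part_ge0 (g : R -> R) t : 0 <= pos_part g t.
Proof. by rewrite /pos_part le_max lexx orbT. Qed.

Lemma neg_part_ge0 (g : R -> R) t : 0 <= neg_part g t.
Proof. by rewrite /neg_part le_max lexx orbT. Qed.

Lemma pos_part_cont (g : R -> R) : continuous g -> continuous (pos_part g).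
Proof. by move=> cg t; apply: continuous_max; [exact: cg|exact: cvg_cst]. Qed.

Lemma neg_part_cont (g : R -> R) : continuous g -> continuous (neg_part g).
Proof.
move=> cg; apply: (@pos_part_cont (fun t => - g t)) => t.
by apply: continuousN; exact: cg.
Qed.

Lemma pos_part_homo (g : R -> R) : {homo g : x y / x <= y} ->
  {homo pos_part g : x y / x <= y}.
Proof. by move=> hg x y /hg gxy; rewrite /pos_part ge_max !le_max gxy lexx !orbT. Qed.

Lemma neg_part_homo (g : R -> R) : {homo g : x y / x <= y} ->
  {homo neg_part g : x y /~ x <= y}.
Proof. by move=> hg x y /hg gxy; rewrite /neg_part ge_max !le_max lerN2 gxy lexx !orbT. Qed.

Lemma pos_partE (g : R -> R) t : 0 <= g t -> pos_part g t = g t.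
Proof. by move=> g0; rewrite /pos_part max_l. Qed.

Lemma neg_partE (g : R -> R) t : g t <= 0 -> neg_part g t = - g t.
Proof. by move=> g0; rewrite /neg_part max_l// oppr_ge0. Qed.

Lemma t0_lt_ge0 (g : R -> R) (a : R) : {homo g : x y / x <= y} ->
  (t0_of g < a%:E)%E -> 0 <= g a.
Proof.
by move=> hg /ereal_inf_lt[_ [t gt <-]]; rewrite lte_fin => /ltW/hg; exact: le_trans.
Qed.

Lemma slope_of_derive (P : R -> R) (t d : R) : is_derive t 1 P (2 * d) ->
  forall e, 0 < e -> \forall s \near t,
    (P s - P t) * (s - t) <= (2 * d + e) * (s - t) ^+ 2.
Proof.
move=> dP e e0.
pose E (s : R) := (2 * d + e) * (s - t) - (P s - P t).
have D := derB (derM (der_cst (2 * d + e) t) (derB (der_id t) (der_cst t t)))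
  (derB dP (der_cst (P t) t)).
have {}D : is_derive t 1 E e by apply: der_eq D _; ring.
have E0 : E t = 0 by rewrite /E !subrr mulr0 subr0.
apply: filterS (derive_sign D e0 E0) => s Hs.
have [->|st] := eqVneq s t; first by rewrite !subrr mulr0 expr0n/= mulr0.
by have := Hs st; rewrite /E; nra.
Qed.

(** Young's inequality for the product of the power with 1, with conjugate exponents [r^-1] and
    [(1 - r)^-1]. *)
Lemma young_power (x r : R) : 0 <= x -> 0 < r -> r <= 1 -> x `^ r <= r * x + (1 - r).
Proof.
move=> x0 r0; rewrite le_eqVlt => /predU1P[->|r1].
  by rewrite powRr1// subrr addr0 mul1r.
have ri : 0 < r^-1 by rewrite invr_gt0.
have r1i : 0 < (1 - r)^-1 by rewrite invr_gt0 subr_gt0.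
have E : r^-1^-1 + (1 - r)^-1^-1 = 1 by rewrite !invrK; ring.
have := conjugate_powR (powR_ge0 x r) ler01 ri r1i E.
by rewrite powR1 mulr1 -powRrM mulfV ?gt_eqF// powRr1// !invrK mul1r; lra.
Qed.

Lemma homo_cvg_le (g : R -> R) (l : R) t : {homo g : x y / x <= y} ->
  g s @[s --> +oo] --> l -> g t <= l.
Proof.
move=> hg gl; rewrite leNgt; apply/negP => lg.
have [N HN] := near_pinfty_nat (cvgr_lt l gl (g t) lg).
pose m := maxn N (Num.truncn `|t|).+1.
have := HN m (leq_maxl _ _); rewrite ltNge hg//.
apply: le_trans (ler_norm _) _; apply: le_trans (ltW (truncnS_gt _)) _.
by rewrite ler_nat leq_maxr.
Qed.

Lemma cvg_pinfty_nat (f : R -> R) A : f t @[t --> +oo] --> +oo ->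
  exists N : nat, forall m : nat, (N <= m)%N -> A < f m%:R.
Proof. by move=> /cvgryPgt/(_ A)/near_pinfty_nat. Qed.

Lemma powR_half (x : R) : 0 <= x -> x `^ (1 / 2) = Num.sqrt x.
Proof. by move=> x0; rewrite div1r powR12_sqrt. Qed.

Lemma inv_sqrt_scale (C y : R) : 0 < C -> 0 < y ->
  1 / Num.sqrt (C ^- 2 * y) = C * (1 / Num.sqrt y).
Proof.
move=> C0 y0; rewrite sqrtrM ?invr_ge0 ?exprn_ge0 ?ltW//.
rewrite sqrtrV ?exprn_ge0 ?ltW// sqrtr_sqr gtr0_norm//.
by field; rewrite (lt0r_neq0 C0) lt0r_neq0// sqrtr_gt0.
Qed.

End Limits.

(** * Elementary inequalities for powers *)

Section PowerInequalities.
Variable R : realType.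

(** A nondecreasing function has integral at least [t / 2] times its value at [t / 2] over the upper
    half of [[0, t]], so the integral hypotheses of the theorem get used at [t / 2]. *)
Lemma EI_fin_half (h : R -> R) : cont_after 0 h -> (forall t, 0 <= h t) ->
  (EI h 0 < +oo)%E -> (EI (fun t => h (t / 2)%R) 1 < +oo)%E.
Proof.
move=> ch h0 hfin; pose w (t : R) : R := h (t / 2).
have wE : EI (fun s => w (2 * s + 0)) (1 / 2) = EI h (1 / 2).
  by apply: EI_eq => t _; rewrite /w; congr h; field.
have cw : cont_after (2 * (1 / 2) + 0) w.
  move=> t; have -> : 2 * (1 / 2) + 0 = 1 :> R by field.
  move=> t1; have c2 : {for t, continuous (fun t : R => t / 2)}.
    by apply: continuousM; [exact: cvg_id|exact: cvg_cst].
  have t20 : 0 < t / 2 by rewrite divr_gt0// (lt_trans ltr01 t1).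
  exact: (continuous_comp c2 (ch _ t20)).
have wh : EI w 1 = (2%:E * EI h (1 / 2))%E.
  rewrite -wE -EI_affine//; last by move=> t _; exact: h0.
  by congr (EI w _); field.
have half : (EI h (1 / 2) < +oo)%E.
  by apply: le_lt_trans hfin; apply: EI_sub => [|//|t _]; [lra|exact: h0].
rewrite -/w wh; apply: lte_mul_pinfty; [by rewrite lee_fin|by []|exact: half].
Qed.

(** By convexity the right side is above its tangent at 2, where both sides equal 2; that tangent
    has slope [ln 2 <= 1]. *)
Lemma two_power_ge (y : R) : y <= 2 -> y <= 2 `^ (y / 2).
Proof.
move=> y2; have -> : 2 `^ (y / 2) = 2 * expR ((y - 2) / 2 * ln 2) :> R.
  have -> : (2 : R) `^ (y / 2) = 2 `^ (1 + (y - 2) / 2) by congr (_ `^ _); field.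
  by rewrite powRD ?pnatr_eq0 ?implybT// powRr1// /powR pnatr_eq0.
have l2 : ln 2 <= 1 :> R.
  have -> : (2 : R) = 1 + 1 by ring.
  by apply: le_ln1Dx; lra.
have H := expR_ge1Dx ((y - 2) / 2 * ln 2).
have : (y - 2) / 2 * ln 2 >= (y - 2) / 2 :> R.
  by nra.
lra.
Qed.

(** It lets a single constant serve both terms of the profile for [q < 2]. If the base is at most 1,
    compare exponents, as [1 / (2 - q) >= 1 / 2]. If it exceeds 1 then [n = 1], and the claim is a
    power of the preceding inequality. *)
Lemma profile_const_le (n : nat) (q : R) : (0 < n)%N -> 0 < q -> q < 2 ->
  ((2 - q) / n%:R) `^ (1 / (2 - q)) <= Num.sqrt (2 / n%:R).
Proof.
move=> n0 q0 q2; have n1 : 1 <= n%:R :> R by rewrite ler1n.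
have n_gt0 : 0 < n%:R :> R by rewrite ltr0n.
have y0 : 0 < 2 - q by rewrite subr_gt0.
set x := (2 - q) / n%:R; have x0 : 0 < x by rewrite divr_gt0.
have [x1|x1] := leP x 1.
  apply: (@le_trans _ _ (x `^ (1 / 2))).
    apply: ger_powR; first by rewrite x0.
    by rewrite !div1r lef_pV2 ?posrE//; lra.
  rewrite powR_half ?(ltW x0)//; apply: ler_wsqrtr.
  by rewrite ler_pM2r ?invr_gt0//; lra.
have n1E : n = 1%N.
  apply/eqP; rewrite eqn_leq n0 andbT leqNgt; apply/negP => n2.
  move: x1; rewrite ltr_pdivlMr// mul1r => x1.
  have : (2 : R) <= n%:R by rewrite ler_nat.
  by lra.
rewrite /x n1E !divr1.
have : (2 - q) `^ (1 / (2 - q)) <= (2 `^ ((2 - q) / 2)) `^ (1 / (2 - q)).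
  apply: ge0_ler_powR; rewrite ?nnegrE ?powR_ge0 ?(ltW y0)//.
    by rewrite divr_ge0// ltW.
  by apply: two_power_ge; lra.
rewrite -powRrM; have -> : (2 - q) / 2 * (1 / (2 - q)) = 1 / 2.
  by field; rewrite lt0r_neq0.
by rewrite powR_half.
Qed.

(** For a negative limit of [g], [r] is the share of the power term in the integrand; the summands
    measure the second derivative and the gradient term in units of [f / n]. For [q <= 1] Young's
    inequality suffices; for [q > 1] the base is at most 1, and the sum is at most [q / 2]. *)
Lemma quadratic_power_le (q r : R) : 0 < q -> q <= 2 -> 0 <= r -> r <= 1 ->
  q / 4 * (1 - r) ^+ 2 + (q * r / 2) `^ q <= 1.
Proof.
move=> q0 q2 r0 r1; set X := q * r / 2.
have X0 : 0 <= X by rewrite /X; nra.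
have X1 : X <= 1 by rewrite /X; nra.
have [q1|q1] := leP q 1.
  have := young_power X0 q0 q1 => H.
  have h1 : q * X <= q / 2 by rewrite /X; nra.
  have h2 : q / 4 * (1 - r) ^+ 2 <= q / 4.
    by rewrite ler_piMr//; [lra|rewrite expr2; nra].
  lra.
have HX : X `^ q <= X.
  have [->|Xn0] := eqVneq X 0; first by rewrite powR0// gt_eqF.
  by apply: ge1r_powR; [rewrite lt_def Xn0 X0 X1|exact: ltW].
have h2 : q / 4 * (1 - r) ^+ 2 <= q / 2 * (1 - r).
  have s0 : 0 <= (1 - r) by lra.
  have s1 : (1 - r) ^+ 2 <= 1 - r by rewrite expr2; nra.
  nra.
rewrite /X in HX *; lra.
Qed.

(** To the right of [t] use the function attaining the maximum at [s], to the left the one attaining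
    it at [t]. *)
Lemma slope_max (P1 P2 : R -> R) (t d e : R) :
  (\forall s \near t, (P1 s - P1 t) * (s - t) <= (2 * d + e) * (s - t) ^+ 2) ->
  (\forall s \near t, (P2 s - P2 t) * (s - t) <= (2 * d + e) * (s - t) ^+ 2) ->
  \forall s \near t, (Num.max (P1 s) (P2 s) - Num.max (P1 t) (P2 t)) * (s - t) <=
    (2 * d + e) * (s - t) ^+ 2.
Proof.
move=> H1 H2; apply: filterS2 H1 H2 => s h1 h2.
have [st|ts] := leP t s.
  have st0 : 0 <= s - t by rewrite subr_ge0.
  have [m12|m12] := leP (P1 s) (P2 s).
    apply: le_trans h2; rewrite ler_wpM2r// lerD2l lerN2 le_max lexx orbT//.
  by apply: le_trans h1; rewrite ler_wpM2r// lerD2l lerN2 le_max lexx.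
have st0 : s - t <= 0 by rewrite subr_le0 ltW.
have [m12|m12] := leP (P1 t) (P2 t).
  by apply: le_trans h2; rewrite ler_wnM2r// lerD2r le_max lexx orbT.
by apply: le_trans h1; rewrite ler_wnM2r// lerD2r le_max lexx.
Qed.

Lemma powR_gt_of (x A r : R) : 0 < r -> 0 <= x ->
  (Num.max A 0) `^ (1 / r) < x -> A < x `^ r.
Proof.
move=> r0 x0 H; have A0 : 0 <= Num.max A 0 by rewrite le_max lexx orbT.
have := gt0_ltr_powR r0 (powR_ge0 _ _) x0 H.
rewrite -powRrM div1r mulVf ?gt_eqF// powRr1//.
by apply: le_lt_trans; rewrite le_max lexx.
Qed.

End PowerInequalities.

Section Reciprocal.
Variable R : realType.

Lemma powR_invl (x r : R) : 0 <= x -> (x^-1) `^ r = (x `^ r)^-1.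
Proof. by move=> x0; rewrite -powR_inv1// -powRrM mulN1r powRN. Qed.

Lemma cont_inv (x : R -> R) (t : R) : {for t, continuous x} -> x t != 0 ->
  {for t, continuous (fun s => 1 / x s)}.
Proof.
move=> cx x0; apply: (@continuousM _ _ (cst 1) (fun s => (x s)^-1)).
  exact: cvg_cst.
exact: continuousV.
Qed.

End Reciprocal.

(** * Barriers for the equation *)

Section Cases.
Variables (R : realType) (n : nat) (F : 'rV[R]_n -> 'M[R]_n -> R) (f g : R -> R).
Variables (q : R) (O : set 'rV[R]_n) (u : 'rV[R]_n -> R).
Hypothesis n0 : (0 < n)%N.
Hypothesis cf : continuous f.
Hypothesis cg : continuous g.
Hypothesis f_incr : {homo f : x y / x < y}.
Hypothesis g_incr : {homo g : x y / x <= y}.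
Hypothesis f_gt0 : forall t, 0 < f t.
Hypothesis F0 : forall x, F x 0 = 0.
Hypothesis F_ell : forall x (X Y : 'M[R]_n), symmetric_mx X -> symmetric_mx Y ->
  psd_mx Y -> 0 <= F x (X + Y) - F x X /\ F x (X + Y) - F x X <= \tr Y.
Hypothesis oO : open O.
Hypothesis bO : boundary O !=set0.
Hypothesis q0 : 0 < q.
Hypothesis q2 : q <= 2.
Hypothesis usub : visc_sub F f g q O u.

Let n_gt0 : 0 < n%:R :> R. Proof. by rewrite ltr0n. Qed.

Let f_le : {homo f : x y / x <= y}.
Proof. by move=> x y; rewrite le_eqVlt => /predU1P[->//|/f_incr/ltW]. Qed.

(** * Profiles from a linear equation: [q = 2], or [g] tending to 0 *)

Section LinearCase.
Variables (m0 G0 Ps : R -> R) (c C : R).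
Hypothesis C0 : 0 < C.
Hypothesis cm_incr : {homo (fun t => c * m0 t) : x y / x <= y}.
Hypothesis dG0 : forall t : R, is_derive t 1 G0 (m0 t).
Hypothesis RIm : forall a b : R, a <= b -> RI m0 a b = G0 b - G0 a.
Hypothesis dPs : forall t : R, is_derive t 1 Ps (expR (- (c * G0 t)) * f t).
Hypothesis RIPs : forall a b : R, a <= b ->
  RI (fun t => expR (- (c * G0 t)) * f t) a b = Ps b - Ps a.
Notation Y := (lin_sol (fun t => c * G0 t) Ps).
Notation h := (lin_h (fun t => c * G0 t) Ps).

Let dG (t : R) : is_derive t 1 (fun t => c * G0 t) (c * m0 t).
Proof. by apply: der_eq (derM (der_cst c t) (dG0 t)) _; ring. Qed.

(** With [P = C ^- 2 * Y] the function [1 / sqrt P] is exactly [C] times the integrand of [Rf]. Left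
    to each case are a majorant at infinity, the divergence of [Y], and the choice of [M] and
    [K]. *)
Lemma linear_case (l : \bar R) (Rf : R -> \bar R) :
  (forall a, Rf a = (C%:E * EI (fun t => 1 / (RI (fun s =>
     expR (c * RI m0 s t) * f s) a t) `^ (1/2))%R a)%E) ->
  (forall a, exists2 b, b <= a & exists T w, [/\ b < T, cont_after T w,
     (EI w T < +oo)%E & forall t, T < t -> h b t <= w t]) ->
  (forall s, 0 < s -> forall A, exists N : nat, forall m : nat, (N <= m)%N ->
     A < Y m%:R (s + m%:R)) ->
  (forall a, (l < a%:E)%E -> exists M K,
     is_profile n f g q C h a (fun t => C ^- 2 * Y a t) M K) ->
  forall x, O x -> (l < (u x)%:E)%E -> ((u x)%:E <= Rinv Rf (dist_bd O x))%E.
Proof.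
move=> RfE tail lim prof.
have cI : continuous (fun t => expR (- (c * G0 t)) * f t).
  apply: contM; last exact: cf.
  move=> t; apply: (@continuous_comp _ _ _ (fun t => - (c * G0 t)) expR); last exact: continuous_expR.
  apply: continuousN; exact: is_derive_cont (dG t).
have ge0 a t : a < t -> 0 <= h a t by move=> _; exact: lin_h_ge0.
have hc := lin_h_cont f_gt0 dG dPs.
apply: (@profile_bound _ _ F f g q O u n0 f_incr g_incr F0 F_ell oO bO q0 usub C h) => //.
- move=> a; rewrite RfE; congr (_ * _)%E; apply: EI_eq => t at0.
  rewrite (RI_lin_sol RIm RIPs cI (ltW at0)) /lin_h powR_half//.
  exact: lin_sol_ge0 f_gt0 dPs _ _ (ltW at0).
- by move=> a b s; exact: (lin_h_dec f_incr f_gt0 cm_incr dG dPs).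
- by move=> s; exact: (lin_h_conta f_gt0 dG dPs).
- move=> a; have [b ba [T [w [bT cw wfin hw]]]] := tail a; exists b => //.
  have [k k0 Hk] := lin_h_local f_incr f_gt0 cm_incr dG dPs bT.
  by apply: (@EI_fin_sqrt _ b T k (h b) w) => // t; exact: ge0.
- move=> s s0; apply: (inv_sqrt_cvg0 _ _ (lim s s0)) => m; first exact: lin_h_ge0.
  by rewrite /lin_h.
- move=> a la; have [M [K H]] := prof a la; exists (fun t => C ^- 2 * Y a t), M, K.
  exact: H.
Qed.

End LinearCase.

(** Asking that [M = K] turns the supersolution condition into the linear equation
    [P' = 2 / n * (f + g * P)], whose solution vanishing at [a] is [c * Y]. This explains the
    exponential kernel and the constant, as [C ^- 2 = c]. *)
Lemma case_q2 : q = 2 -> (exists t, 0 < g t) ->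
  f t @[t --> +oo] --> +oo \/ (forall A, \forall t \near +oo, A < g t) ->
  forall x, O x -> (t0_of g < (u x)%:E)%E ->
  ((u x)%:E <= Rinv (Rfun_i n q f g) (dist_bd O x))%E.
Proof.
move=> qE [t1 gt1] fg_lim; pose m0 := pos_part g; pose c : R := 2 / n%:R.
have c0 : 0 < c by rewrite divr_gt0.
have m0_homo := pos_part_homo g_incr.
have [G0 [dG0 RIm]] := RI_primitive (pos_part_cont cg).
have cG0 t := is_derive_cont (dG0 t).
have [Ps [dPs RIPs]] : exists H : R -> R,
   (forall t : R, is_derive t 1 H (expR (- (c * G0 t)) * f t)) /\
   forall a b : R, a <= b -> RI (fun t => expR (- (c * G0 t)) * f t) a b = H b - H a.
  apply: RI_primitive; apply: contM => // t.
  apply: (@continuous_comp _ _ _ (fun t => - (c * G0 t)) expR); last exact: continuous_expR.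
  apply: continuousN; apply: continuousM; [exact: cvg_cst|exact: cG0].
have cm_incr : {homo (fun t => c * m0 t) : x y / x <= y}.
  by move=> x y xy; rewrite ler_pM2l// m0_homo.
have cm_ge0 t : 0 <= c * m0 t by rewrite mulr_ge0 ?(ltW c0)// pos_part_ge0.
have dG (t : R) : is_derive t 1 (fun t => c * G0 t) (c * m0 t).
  by apply: der_eq (derM (der_cst c t) (dG0 t)) _; rewrite mul0r add0r.
pose C : R := Num.sqrt (n%:R / 2).
have C0 : 0 < C by rewrite sqrtr_gt0 divr_gt0.
have C2 : C ^- 2 = c.
  by rewrite sqr_sqrtr ?divr_ge0// ?ltW// /c; field; rewrite lt0r_neq0.
apply: (@linear_case m0 G0 Ps c C C0 cm_incr dG0 RIm dPs RIPs).
- by move=> a; rewrite /Rfun_i qE ltxx.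
(* The integral is started before a point [t1] with [g t1 > 0]; beyond [t1] the solution grows
   exponentially at rate at least [v], so the integrand decays at rate [v / 2]. *)
- move=> a; pose b := Num.min a (t1 - 1).
  have bt1 : b < t1 by rewrite gt_min gtrBl ltr01 orbT.
  exists b; first by rewrite ge_min lexx.
  pose v := c * m0 t1.
  have v0 : 0 < v by rewrite mulr_gt0// /m0 pos_partE// ltW.
  pose y1 := lin_sol (fun t => c * G0 t) Ps b t1.
  have y10 : 0 < y1 by exact: lin_sol_gt0 f_gt0 dPs _ _ bt1.
  pose k := 1 / Num.sqrt y1.
  have k0 : 0 < k by rewrite divr_gt0// sqrtr_gt0.
  pose w (t : R) := k * expR (- (v / 2) * (t - t1)).
  pose W (t : R) := - (2 / v * k) * expR (- (v / 2) * (t - t1)).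
  have dW (t : R) : is_derive t 1 W (w t).
    have D := derM (der_cst (- (2 / v * k)) t) (der_expR (derM (der_cst (- (v / 2)) t)
      (derB (der_id t) (der_cst t1 t)))).
    by apply: der_eq D _; rewrite /w; field; rewrite lt0r_neq0.
  have cw t : {for t, continuous w}.
    apply: continuousM; first exact: cvg_cst.
    apply: (@continuous_comp _ _ _ (fun t => - (v / 2) * (t - t1)) expR); last exact: continuous_expR.
    apply: continuousM; first exact: cvg_cst.
    by apply: continuousB; [exact: cvg_id|exact: cvg_cst].
  exists t1, w; split => //.
  + apply: (@EI_fin_primitive _ t1 w W (2 / v * k)) => //.
      by move=> t _; rewrite mulr_ge0 ?(ltW k0)// ltW// expR_gt0.
    move=> t tt; rewrite normrM normrN (ger0_norm (ltW (expR_gt0 _))).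
    rewrite ger0_norm; last by rewrite mulr_ge0 ?(ltW k0)// divr_ge0// ltW.
    rewrite ler_piMr ?mulr_ge0 ?(ltW k0) ?invr_ge0 ?(ltW v0)//.
    rewrite -expR0 ler_expR mulNr oppr_le0 mulr_ge0 ?divr_ge0 ?(ltW v0)//.
    by rewrite subr_ge0 ltW.
  + move=> t t1t; have H := lin_sol_growth f_gt0 cm_incr dG dPs (lexx v) (ltW bt1) (ltW t1t).
    have e0 := expR_gt0 (v / 2 * (t - t1)).
    have -> : w t = 1 / (Num.sqrt y1 * expR (v / 2 * (t - t1))).
      by rewrite /w /k mulNr expRN; field; rewrite !lt0r_neq0// sqrtr_gt0.
    rewrite /lin_h !div1r lef_pV2 ?posrE ?mulr_gt0 ?sqrtr_gt0//; last first.
      exact: lin_sol_gt0 f_gt0 dPs _ _ (lt_trans bt1 t1t).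
    have P0 : 0 <= Num.sqrt y1 * expR (v / 2 * (t - t1)).
      by rewrite mulr_ge0 ?sqrtr_ge0// ltW.
    rewrite -(ger0_norm P0) -sqrtr_sqr; apply: ler_wsqrtr; apply: le_trans H.
    rewrite exprMn sqr_sqrtr ?(ltW y10)// expr2 -expRD.
    by rewrite le_eqVlt; apply/orP; left; apply/eqP; congr (_ * expR _); field.
(* The linear lower bound on [Y] carries the factor [f], the quadratic one the factor [g]. *)
- move=> s s0 A; case: fg_lim => [flim|glim].
    have [N HN] := cvg_pinfty_nat (A / s) flim; exists N => m /HN.
    rewrite ltr_pdivrMr// => H; apply: lt_le_trans H _.
    have am : m%:R <= s + m%:R by rewrite lerDr ltW.
    have := lin_sol_lower0 f_incr f_gt0 cm_incr dG dPs (cm_ge0 m%:R) am.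
    by rewrite addrK.
  pose d := f 0 * c * s ^+ 2 / 2.
  have d0 : 0 < d by rewrite divr_gt0 // mulr_gt0 ?exprn_gt0 // mulr_gt0 ?f_gt0.
  have [N HN] := near_pinfty_nat (glim (A / d)); exists N => m /HN.
  rewrite ltr_pdivrMr// => H.
  have am : m%:R <= s + m%:R by rewrite lerDr ltW.
  have := lin_sol_lower2 f_incr f_gt0 cm_incr dG dPs (cm_ge0 m%:R) am.
  rewrite addrK; apply: lt_le_trans; apply: lt_le_trans H _.
  have gm : g m%:R <= m0 m%:R by rewrite /m0 /pos_part le_max lexx.
  have fm : f 0 <= f m%:R by apply: f_le; exact: ler0n.
  apply: (@le_trans _ _ (m0 m%:R * d)); first by rewrite ler_pM2r.
  have -> : m0 m%:R * d = f 0 * (c * m0 m%:R * s ^+ 2 / 2) by rewrite /d; field.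
  have -> : f m%:R * (c * m0 m%:R) * s ^+ 2 / 2 =
     f m%:R * (c * m0 m%:R * s ^+ 2 / 2) by field.
  by rewrite ler_wpM2r// divr_ge0// mulr_ge0// exprn_ge0// ltW.
- move=> a /(t0_lt_ge0 g_incr) ga.
  have gpos t : a <= t -> m0 t = g t.
    by move=> at0; rewrite /m0 pos_partE// (le_trans ga)// g_incr.
  pose Y := lin_sol (fun t => c * G0 t) Ps a.
  have Y0 t : a < t -> 0 < Y t by move=> at0; exact: lin_sol_gt0 f_gt0 dPs _ _ at0.
  have cY : continuous Y by move=> t; exact: (lin_sol_cont dG dPs).
  pose K t := (f t + g t * (C ^- 2 * Y t)) / n%:R.
  have K0 t : a < t -> 0 <= K t.
    move=> at0; have gt0 : 0 <= g t by rewrite (le_trans ga)// g_incr// ltW.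
    have cY0 : 0 <= C ^- 2 * Y t by rewrite C2 mulr_ge0 ?(ltW c0)// ltW// Y0.
    by rewrite divr_ge0// addr_ge0 ?(ltW (f_gt0 _))// mulr_ge0.
  exists K, K; split.
  + split => [t at0|t at0]; first by rewrite C2 mulr_gt0// Y0.
    by apply: continuousM; [exact: cvg_cst|exact: cY].
  + split => // t at0; rewrite inv_sqrt_scale//; exact: Y0.
  + move=> t e at0 e0; apply: (@slope_of_derive _ (fun t => C ^- 2 * Y t)) => //.
    have D := derM (der_cst (C ^- 2) t) (lin_sol_derive dG dPs a t).
    apply: der_eq D _; rewrite /K C2 gpos ?(ltW at0)// -/(Y t) /c.
    by field; rewrite lt0r_neq0.
  + move=> s t as0 st.
    have := lin_sol_upper_pos f_incr f_gt0 cm_incr dG dPs (cm_ge0 a) as0 st.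
    rewrite gpos ?(le_trans (ltW as0))// -/(Y t) => H.
    have := ler_wpM2l (ltW c0) H; rewrite C2; move/le_trans; apply.
    rewrite le_eqVlt; apply/orP; left; apply/eqP; rewrite /K C2 /c.
    by field; rewrite lt0r_neq0.
  + split=> [t at0|e fe].
      rewrite qE powR_mulrn ?sqrtr_ge0// sqr_sqrtr; last first.
        by rewrite C2 mulr_ge0 ?(ltW c0)// ltW// Y0.
      have -> : K t + (n%:R - 1) * K t = n%:R * K t by ring.
      by rewrite -/(Y t) /K mulrC mulfVK ?lt0r_neq0.
    have [] := @cont_right_lt _ (fun t => f t + g t * (C ^- 2 * Y t)) a e.
    * apply: continuousD; first exact: cf.
      apply: continuousM; first exact: cg.
      by apply: continuousM; [exact: cvg_cst|exact: cY].
    * by rewrite /Y lin_sol_id !mulr0 addr0.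
    move=> t at0 H; exists t => //; rewrite /K mulrC mulfVK//.
    exact: lt0r_neq0.
Qed.

(** With [k = kap * P], the gradient term equals [- f] times the power [q / 2] of [k]. Young's
    inequality bounds that power by [q / 2 * k + (1 - q / 2)], so a linear equation for [P] with
    coefficient [- 2 * kap * f] is enough, provided [n * C ^- 2 <= q]. *)
Lemma case_zero_limit : g t @[t --> +oo] --> (0 : R) -> f t @[t --> +oo] --> +oo ->
  (EI (fun t => 1 / (RI (fun s => expR (- 2 * RI (fun r =>
     (neg_part g r / f r) `^ (2 / q) * f r) s t) * f s) 0 t) `^ (1/2))%R 0 < +oo)%E ->
  forall x, O x -> ((u x)%:E <= Rinv (Rfun_ii n q f g) (dist_bd O x))%E.
Proof.
move=> glim flim hyp.
have g_le0 t : g t <= 0 by exact: homo_cvg_le glim.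
pose kap (r : R) := (neg_part g r / f r) `^ (2 / q).
pose m0 r := kap r * f r; pose c : R := - 2.
have ratio_ge0 r : 0 <= neg_part g r / f r by rewrite divr_ge0 ?neg_part_ge0// ltW.
have kap_ge0 r : 0 <= kap r by exact: powR_ge0.
have e0 : 0 < 2 / q by rewrite divr_gt0.
have e1 : 1 <= 2 / q by rewrite ler_pdivlMr// mul1r.
have ratio_homo : {homo (fun r => neg_part g r / f r) : x y /~ x <= y}.
  move=> x y xy; apply: ler_pM; rewrite ?neg_part_ge0 ?invr_ge0 ?(ltW (f_gt0 _))//.
    exact: neg_part_homo.
  by rewrite lef_pV2 ?posrE// f_le.
have kap_homo : {homo kap : x y /~ x <= y}.
  move=> x y xy; apply: ge0_ler_powR; rewrite ?nnegrE ?(ltW e0)//.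
  exact: ratio_homo.
(* In [kap * f] the second factor increases; this form, with [2 / q - 1 >= 0], is a product of two
   nonincreasing factors. *)
have m0E r : m0 r = neg_part g r * (neg_part g r / f r) `^ (2 / q - 1).
  rewrite /m0 /kap -[in LHS](mulr_powRB1 (ratio_ge0 r) e0); field.
  by rewrite lt0r_neq0.
have m0_homo : {homo m0 : x y /~ x <= y}.
  move=> x y xy; rewrite !m0E; apply: ler_pM; rewrite ?neg_part_ge0 ?powR_ge0//.
    exact: neg_part_homo.
  apply: ge0_ler_powR; rewrite ?nnegrE ?subr_ge0//.
  exact: ratio_homo.
have cm0 : continuous m0.
  apply: contM => // r; apply: (@cont_powR _ (fun r => neg_part g r / f r)) => //.
  apply: continuousM; first exact: neg_part_cont.
  by apply: continuousV; [rewrite lt0r_neq0|exact: cf].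
have [G0 [dG0 RIm]] := RI_primitive cm0.
have cG0 t := is_derive_cont (dG0 t).
have cI : continuous (fun t => expR (- (c * G0 t)) * f t).
  apply: contM => // t.
  apply: (@continuous_comp _ _ _ (fun t => - (c * G0 t)) expR); last exact: continuous_expR.
  apply: continuousN; apply: continuousM; [exact: cvg_cst|exact: cG0].
have [Ps [dPs RIPs]] := RI_primitive cI.
have c_lt0 : c < 0 by rewrite /c; lra.
have cm_incr : {homo (fun t => c * m0 t) : x y / x <= y}.
  by move=> x y xy; rewrite ler_nM2l// m0_homo.
have m0_ge0 t : 0 <= m0 t by rewrite mulr_ge0// ltW.
have cm_le0 t : c * m0 t <= 0 by rewrite nmulr_rle0.
have dG (t : R) : is_derive t 1 (fun t => c * G0 t) (c * m0 t).
  by apply: der_eq (derM (der_cst c t) (dG0 t)) _; rewrite mul0r add0r.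
pose C : R := n%:R `^ (1 / q) / Num.sqrt q.
have np0 : 0 < n%:R `^ (1 / q) :> R by exact: powR_gt0.
have C0 : 0 < C by rewrite divr_gt0// sqrtr_gt0.
have C2 : C ^- 2 = q / (n%:R `^ (1 / q)) ^+ 2.
  by rewrite expr_div_n sqr_sqrtr ?(ltW q0)// invf_div.
(* This reduces to [n] being at most its power [2 / q], an exponent at least 1. *)
have nC : n%:R * C ^- 2 <= q.
  rewrite C2 mulrA ler_pdivrMr ?exprn_gt0// mulrC ler_pM2l//.
  rewrite -powR_mulrn ?(ltW np0)// -powRrM mulrAC mul1r.
  by apply: le1r_powR => //; rewrite ler1n.
have C2_ge0 : 0 <= C ^- 2 by rewrite invr_ge0 exprn_ge0// ltW.
have base x : O x -> (-oo < (u x)%:E)%E by rewrite ltNyr.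
suff H : forall x, O x -> (-oo < (u x)%:E)%E ->
    ((u x)%:E <= Rinv (Rfun_ii n q f g) (dist_bd O x))%E.
  by move=> x Ox; apply: H => //; exact: base.
apply: (@linear_case m0 G0 Ps c C C0 cm_incr dG0 RIm dPs RIPs).
- by [].
- move=> a; pose b := Num.min a 0.
  have b0 : b <= 0 by rewrite ge_min lexx orbT.
  exists b; first by rewrite ge_min lexx.
  have hc0 := lin_h_cont f_gt0 dG dPs (a := 0).
  have h_ge0 t : 0 < t -> 0 <= lin_h (fun t => c * G0 t) Ps 0 t by move=> _; exact: lin_h_ge0.
  exists 1, (lin_h (fun t => c * G0 t) Ps 0); split.
  + exact: le_lt_trans b0 _.
  + by move=> t t1; apply: hc0; exact: lt_trans t1.
  + apply: (@le_lt_trans _ _ (EI (lin_h (fun t => c * G0 t) Ps 0) 0)).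
      exact: EI_sub.
    apply: le_lt_trans hyp; rewrite le_eqVlt; apply/orP; left; apply/eqP.
    apply: EI_eq => t t0; rewrite (RI_lin_sol RIm RIPs cI (ltW t0)).
    by rewrite /lin_h powR_half// (lin_sol_ge0 f_gt0 dPs (ltW t0)).
  + move=> t t1; have t0 := lt_trans ltr01 t1.
    have Y0 := lin_sol_gt0 f_gt0 dPs t0 (G := fun t => c * G0 t).
    have Yb : lin_sol (fun t => c * G0 t) Ps 0 t <= lin_sol (fun t => c * G0 t) Ps b t.
      by apply: (lin_sol_base f_gt0 dPs).
    rewrite /lin_h !div1r lef_pV2 ?posrE ?sqrtr_gt0 ?(lt_le_trans Y0)//.
    exact: ler_wsqrtr.
- move=> s s0 A; pose v := c * m0 0.
  have d0 : 0 < expR (v * s) * s by rewrite mulr_gt0 ?expR_gt0.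
  have [N HN] := cvg_pinfty_nat (A / (expR (v * s) * s)) flim; exists N => m /HN.
  rewrite ltr_pdivrMr// => H; apply: lt_le_trans H _.
  have am : m%:R <= s + m%:R by rewrite lerDr ltW.
  have vm : v <= c * m0 m%:R by apply: cm_incr; exact: ler0n.
  have := lin_sol_lower f_incr f_gt0 cm_incr dG dPs (cm_le0 0) vm am.
  rewrite addrK; apply: le_trans.
  by rewrite le_eqVlt; apply/orP; left; apply/eqP; ring.
- move=> a _.
  pose Y := lin_sol (fun t => c * G0 t) Ps a.
  have Y0 t : a < t -> 0 < Y t by move=> at0; exact: lin_sol_gt0 f_gt0 dPs _ _ at0.
  have cY : continuous Y by move=> t; exact: (lin_sol_cont dG dPs).
  (* This is what makes [M], half the derivative of [P], nonnegative. *)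
  have half t : a < t -> kap t * Y t <= 1 / 2.
    move=> at0; exact: (lin_sol_half f_gt0 dG dPs kap_homo (fun x => erefl) (ltW at0)).
  pose M t := C ^- 2 * f t * (1 / 2 - kap t * Y t).
  pose K t := C ^- 2 * f t / 2.
  exists M, K; split.
  + split => [t at0|t at0]; first by rewrite mulr_gt0 ?Y0// invr_gt0 exprn_gt0.
    by apply: continuousM; [exact: cvg_cst|exact: cY].
  + split => [t at0|t at0]; first by rewrite inv_sqrt_scale//; exact: Y0.
    by rewrite !mulr_ge0 ?(ltW (f_gt0 _))// subr_ge0 half.
  + move=> t e at0 ee0; apply: (@slope_of_derive _ (fun t => C ^- 2 * Y t)) => //.
    have D := derM (der_cst (C ^- 2) t) (lin_sol_derive dG dPs a t).
    by apply: der_eq D _; rewrite /M /m0 /c -/(Y t); field; rewrite lt0r_neq0.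
  + move=> s t as0 st.
    have H := lin_sol_upper_neg f_incr f_gt0 dG dPs cm_le0 as0 st.
    apply: le_trans (ler_wpM2l C2_ge0 H) _.
    by rewrite le_eqVlt; apply/orP; left; apply/eqP; rewrite /K; field; rewrite lt0r_neq0.
  + split=> [t at0|e fe]; last first.
      have [t at0 ft] := cont_right_lt (@cf a) fe; exists t => //.
      apply: le_trans ft; rewrite /K.
      have -> : n%:R * (C ^- 2 * f t / 2) = (n%:R * C ^- 2) / 2 * f t by field; rewrite lt0r_neq0.
      rewrite ler_piMl ?(ltW (f_gt0 _))//.
      by have := nC; have := q2; lra.
    pose k := kap t * (C ^- 2 * Y t).
    have P0 : 0 <= C ^- 2 * Y t by rewrite mulr_ge0// ltW// Y0.
    have k0 : 0 <= k by rewrite mulr_ge0.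
    have gk : g t * Num.sqrt (C ^- 2 * Y t) `^ q = - (f t * k `^ (q / 2)).
      rewrite /k powRM// /kap -powRrM.
      have -> : 2 / q * (q / 2) = 1 by field; rewrite lt0r_neq0.
      rewrite powRr1// -powR12_sqrt// -powRrM.
      have -> : 2^-1 * q = q / 2 by rewrite mulrC.
      by rewrite neg_partE//; field; rewrite lt0r_neq0.
    rewrite gk.
    have qh : 0 < q / 2 by rewrite divr_gt0.
    have q1 : q / 2 <= 1 by rewrite ler_pdivrMr// mul1r.
    have yp := young_power k0 qh q1.
    have -> : M t + (n%:R - 1) * K t = f t * (n%:R * C ^- 2 / 2 - k).
      by rewrite /M /K /k; field; rewrite lt0r_neq0.
    rewrite -[X in _ <= X - _]mulr1 -mulrBr ler_pM2l//.
    have qk : 0 <= k * (1 - q / 2) by rewrite mulr_ge0// subr_ge0.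
    have := nC; lra.
Qed.

(** * Eventually positive gradient term with [q < 2] *)

Section LowerGradient.
Hypothesis q_lt2 : q < 2.
Variables (Phi Gam : R -> R).
Hypothesis dPhi : forall t : R, is_derive t 1 Phi (f t).
Hypothesis dGam : forall t : R, is_derive t 1 Gam (pos_part g t).
Hypothesis RIf : forall a b : R, a <= b -> RI f a b = Phi b - Phi a.
Hypothesis RIg : forall a b : R, a <= b -> RI (pos_part g) a b = Gam b - Gam a.

Let al : R := 1 / (2 - q).
Notation m0 := (pos_part g).
Let A (a t : R) : R := Phi t - Phi a.
(* For t < a the truncation keeps the base of the real power nonnegative. *)
Let B (a t : R) : R := Num.max (Gam t - Gam a) 0.
Let h (a t : R) : R := 1 / (Num.sqrt (A a t) + B a t `^ al).

Let y0 : 0 < 2 - q. Proof. by rewrite subr_gt0. Qed.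
Let al0 : 0 < al. Proof. by rewrite divr_gt0. Qed.
Let m0_homo : {homo m0 : x y / x <= y}. Proof. exact: pos_part_homo. Qed.

Let A_ge a t : a <= t -> f a * (t - a) <= A a t.
Proof.
by move=> at0; apply: (primitive_ge dPhi) => // c /andP[ac _]; rewrite f_le// ltW.
Qed.

Let A_le a t : a <= t -> A a t <= f t * (t - a).
Proof.
by move=> at0; apply: (primitive_le dPhi) => // c /andP[_ ct]; rewrite f_le// ltW.
Qed.

Let A_gt0 a t : a < t -> 0 < A a t.
Proof.
move=> at0; apply: lt_le_trans (A_ge (ltW at0)).
by rewrite mulr_gt0// subr_gt0.
Qed.

Let Gam_homo : {homo Gam : x y / x <= y}.
Proof.
move=> x y xy; rewrite -subr_ge0; have := @primitive_ge _ _ _ dGam x y 0 xy.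
by rewrite mul0r; apply => c _; exact: pos_part_ge0.
Qed.

Let B_ge0 a t : 0 <= B a t. Proof. by rewrite /B le_max lexx orbT. Qed.

Let BE a t : a <= t -> B a t = Gam t - Gam a.
Proof. by move=> at0; rewrite /B max_l// subr_ge0 Gam_homo. Qed.

Let B_ge a t : a <= t -> m0 a * (t - a) <= B a t.
Proof.
move=> at0; rewrite BE//; apply: (primitive_ge dGam) => // c /andP[ac _].
by rewrite m0_homo// ltW.
Qed.

Let B_le a t : a <= t -> B a t <= m0 t * (t - a).
Proof.
move=> at0; rewrite BE//; apply: (primitive_le dGam) => // c /andP[_ ct].
by rewrite m0_homo// ltW.
Qed.

Let B_homo a s t : a <= s -> s <= t -> B a s <= B a t.
Proof.
by move=> as0 st; rewrite !BE// ?(le_trans as0)// lerD2r Gam_homo.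
Qed.

Let A_base a b t : b <= a -> a <= t -> A a t <= A b t.
Proof.
move=> ba at0; rewrite /A lerD2l lerN2 -subr_ge0.
by apply: le_trans (A_ge ba); rewrite mulr_ge0 ?subr_ge0// ltW.
Qed.

Let B_base a b t : b <= a -> a <= t -> B a t <= B b t.
Proof.
by move=> ba at0; rewrite !BE// ?(le_trans ba)// lerD2l lerN2 Gam_homo.
Qed.

Let den_gt0 a t : a < t -> 0 < Num.sqrt (A a t) + B a t `^ al.
Proof. by move=> at0; rewrite ltr_pwDl ?powR_ge0// sqrtr_gt0 A_gt0. Qed.

Let cA a : continuous (A a).
Proof.
move=> t; apply: (@continuousB _ _ _ Phi (cst (Phi a))).
  exact: is_derive_cont (dPhi t).
exact: cvg_cst.
Qed.

Let cB a : continuous (B a).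
Proof.
apply: (@pos_part_cont _ (fun t => Gam t - Gam a)) => t.
apply: (@continuousB _ _ _ Gam (cst (Gam a))); last exact: cvg_cst.
exact: is_derive_cont (dGam t).
Qed.

Let inv_den_cont (x y : R -> R) t : {for t, continuous x} -> {for t, continuous y} ->
  (forall s, 0 <= y s) -> 0 < Num.sqrt (x t) + y t `^ al ->
  {for t, continuous (fun s => 1 / (Num.sqrt (x s) + y s `^ al))}.
Proof.
move=> cx cy y_ge0 d0; apply: continuousM; first exact: cvg_cst.
apply: (@continuousV _ _ (fun s => Num.sqrt (x s) + y s `^ al)).
  exact: lt0r_neq0.
apply: (@continuousD _ _ _ (fun s => Num.sqrt (x s)) (fun s => y s `^ al)).
  by apply: (@continuous_comp _ _ _ x Num.sqrt) => //; exact: sqrt_continuous.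
exact: cont_powR.
Qed.

Let h_ge0 a t : 0 <= h a t.
Proof. by rewrite divr_ge0// addr_ge0 ?sqrtr_ge0 ?powR_ge0. Qed.

Let h_cont a : cont_after a (h a).
Proof.
move=> t at0; apply: inv_den_cont; [exact: cA|exact: cB|exact: B_ge0|exact: den_gt0].
Qed.

Let h_conta s : 0 < s -> continuous (fun a => h a (s + a)).
Proof.
move=> s0 a; apply: (@inv_den_cont (fun a => A a (s + a)) (fun a => B a (s + a))).
- exact: (primitive_shift_cont dPhi).
- apply: (@pos_part_cont _ (fun a => Gam (s + a) - Gam a)).
  exact: (primitive_shift_cont dGam).
- by move=> b; exact: B_ge0.
- by apply: den_gt0; rewrite ltrDr.
Qed.

Let h_dec a b s : a < b -> 0 < s -> h b (s + b) < h a (s + a).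
Proof.
move=> ab s0; have sa c : c < s + c by rewrite ltrDr.
rewrite /h !div1r ltf_pV2 ?posrE ?(den_gt0 (sa _))//; apply: ltr_leD.
  by rewrite ltr_sqrt ?(A_gt0 (sa _))//; exact: (primitive_shift_lt dPhi).
apply: ge0_ler_powR; rewrite ?nnegrE ?B_ge0 ?(ltW al0)//.
rewrite !BE ?(ltW (sa _))//.
by apply: (primitive_shift_le dGam) => //; exact: ltW.
Qed.

Let h_lim : f t @[t --> +oo] --> +oo \/ (forall A, \forall t \near +oo, A < g t) ->
  forall s, 0 < s -> h m%:R (s + m%:R) @[m --> \oo] --> (0 : R).
Proof.
move=> fg s s0; have sa (c : R) : c < s + c by rewrite ltrDr.
case: fg => [flim|glim].
  apply: (@inv_sqrt_cvg0 _ (fun m => A m%:R (s + m%:R))) => [m|m A0|X].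
  - exact: h_ge0.
  - by rewrite /h !div1r lef_pV2 ?posrE ?sqrtr_gt0 ?(den_gt0 (sa _))// lerDl powR_ge0.
  - have [N HN] := cvg_pinfty_nat (X / s) flim; exists N => m /HN.
    rewrite ltr_pdivrMr// => H; apply: lt_le_trans H _.
    by have := A_ge (ltW (sa m%:R)); rewrite addrK.
apply: (@inv_cvg0 _ (fun m => B m%:R (s + m%:R) `^ al)) => [m|m B0|X].
- exact: h_ge0.
- by rewrite /h !div1r lef_pV2 ?posrE ?(den_gt0 (sa _))// lerDr sqrtr_ge0.
- have [N HN] := near_pinfty_nat (glim (Num.max X 0 `^ (1 / al) / s)).
  exists N => m /HN; rewrite ltr_pdivrMr// => H; apply: powR_gt_of => //.
  apply: lt_le_trans H _; have := B_ge (ltW (sa m%:R)); rewrite addrK.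
  by apply: le_trans; rewrite ler_pM2r// /pos_part le_max lexx.
Qed.

Let h_fin_of b T w : b < T -> cont_after T w -> (EI w T < +oo)%E ->
  (forall t, T < t -> h b t <= w t) -> (EI (h b) b < +oo)%E.
Proof.
move=> bT cw wfin hw.
apply: (@EI_fin_sqrt _ b T (1 / Num.sqrt (f b)) (h b) w) => //.
move=> t bt tT; have tb : 0 < t - b by rewrite subr_gt0.
  have fb0 := ltW (f_gt0 b).
  rewrite /h !div1r -invfM -sqrtrM// lef_pV2 ?posrE ?den_gt0 ?sqrtr_gt0 ?mulr_gt0//.
  apply: (@le_trans _ _ (Num.sqrt (A b t))); last by rewrite lerDl powR_ge0.
  by apply: ler_wsqrtr; exact/A_ge/ltW.
Qed.

(** For [q > 1] the exponent [al] exceeds 1, and a point where [g] is positive makes [B] grow at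
    least linearly. The comparison starts at [t1 + 1] to avoid the singularity of the power at
    [t1]. *)
Let h_fin_super : 1 < q -> (exists t, 0 < g t) ->
  forall a, exists2 b, b <= a & (EI (h b) b < +oo)%E.
Proof.
move=> q1 [t1 gt1] a; pose b := Num.min a t1.
have bt1 : b <= t1 by rewrite ge_min lexx orbT.
exists b; first by rewrite ge_min lexx.
pose v := m0 t1; have v0 : 0 < v by rewrite /v pos_partE// ltW.
have al1 : 1 < al by rewrite /al ltr_pdivlMr// mul1r; lra.
have al1' : 1 - al < 0 by rewrite subr_lt0.
pose k := v `^ (- al); have k0 : 0 <= k by exact: powR_ge0.
pose w (t : R) : R := k * (t - t1) `^ (- al).
pose W (t : R) := k / (1 - al) * (t - t1) `^ (1 - al).
have dW (t : R) : t1 + 1 < t -> is_derive t 1 W (w t).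
  move=> tt; have tt0 : 0 < t - t1 by lra.
  have D := derM (der_cst (k / (1 - al)) t) (der_comp
    (derB (der_id t) (der_cst t1 t)) (is_derive_powR (1 - al) tt0)).
  apply: der_eq D _; rewrite /w.
  have -> : 1 - al - 1 = - al by ring.
  by field; rewrite ltr0_neq0.
have cw : cont_after (t1 + 1) w.
  move=> t tt; have tt0 : 0 < t - t1 by lra.
  apply: continuousM; first exact: cvg_cst.
  exact: is_derive_cont (der_comp (derB (der_id t) (der_cst t1 t))
     (is_derive_powR (- al) tt0)).
apply: (@h_fin_of b (t1 + 1) w) => //.
- by apply: le_lt_trans bt1 _; rewrite ltrDl.
- apply: (@EI_fin_primitive _ (t1 + 1) w W (k / (al - 1))) => //.
    by move=> t _; rewrite mulr_ge0// powR_ge0.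
  move=> t tt; have tt0 : 1 <= t - t1 by lra.
  have x0 : 0 <= (t - t1) `^ (1 - al) by exact: powR_ge0.
  have x1 : (t - t1) `^ (1 - al) <= 1.
    by rewrite -[leRHS](powRr0 (t - t1)); apply: ler_powR => //; exact: ltW.
  have E : W t = - (k / (al - 1) * (t - t1) `^ (1 - al)).
    by rewrite /W -opprB invrN; ring.
  have ka : 0 <= k / (al - 1) by rewrite divr_ge0// subr_ge0 ltW.
  have Wn := mulr_ge0 ka x0.
  by rewrite E normrN (ger0_norm Wn); exact: ler_piMr.
- move=> t tt; have t1t : t1 <= t by lra.
  have tt0 : 0 < t - t1 by lra.
  have bt : b < t by apply: le_lt_trans bt1 _; lra.
  have Bv : v * (t - t1) <= B b t by apply: le_trans (B_base bt1 t1t); exact: B_ge.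
  have vt0 : 0 < v * (t - t1) by rewrite mulr_gt0.
  rewrite /w /k -powRM ?(ltW v0) ?(ltW tt0)// powRN /h div1r.
  rewrite lef_pV2 ?posrE ?den_gt0 ?powR_gt0//.
  apply: (@le_trans _ _ (B b t `^ al)); last by rewrite lerDr sqrtr_ge0.
  by apply: ge0_ler_powR; rewrite ?nnegrE ?(ltW al0) ?(ltW vt0).
Qed.

Let h_fin_sub :
  (EI (fun t => 1 / ((t * f t) `^ (1/2) + (t * m0 t) `^ al))%R 0 < +oo)%E ->
  forall a, exists2 b, b <= a & (EI (h b) b < +oo)%E.
Proof.
move=> hyp a; pose b := Num.min a 0.
have b0 : b <= 0 by rewrite ge_min lexx orbT.
exists b; first by rewrite ge_min lexx.
pose w0 (t : R) : R := 1 / (Num.sqrt (t * f t) + Num.max (t * m0 t) 0 `^ al).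
have tm0 (t : R) : 0 < t -> Num.max (t * m0 t) 0 = t * m0 t.
  by move=> t0; rewrite max_l// mulr_ge0 ?(ltW t0) ?pos_part_ge0.
have w0_ge0 t : 0 <= w0 t.
  by rewrite divr_ge0// addr_ge0 ?sqrtr_ge0 ?powR_ge0.
have cw0 : cont_after 0 w0.
  move=> t t0; apply: (@inv_den_cont (fun t => t * f t) (fun t => Num.max (t * m0 t) 0)).
  - by apply: continuousM; [exact: cvg_id|exact: cf].
  - apply: (@pos_part_cont _ (fun t => t * m0 t)).
    by apply: contM; [move=> x; exact: cvg_id|exact: pos_part_cont].
  - by move=> s; rewrite le_max lexx orbT.
  - by rewrite ltr_pwDl ?powR_ge0// sqrtr_gt0 mulr_gt0.
have w0fin : (EI w0 0 < +oo)%E.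
  apply: le_lt_trans hyp; rewrite le_eqVlt; apply/orP; left; apply/eqP.
  apply: EI_eq => t t0; rewrite /w0 tm0// powR_half//.
  by rewrite mulr_ge0 ?(ltW t0)// ltW.
pose w (t : R) : R := w0 (t / 2).
have cw : cont_after 1 w.
  move=> t t1; have c2 : {for t, continuous (fun t : R => t / 2)}.
    by apply: continuousM; [exact: cvg_id|exact: cvg_cst].
  have t20 : 0 < t / 2 by rewrite divr_gt0// (lt_trans ltr01 t1).
  exact: (continuous_comp c2 (cw0 _ t20)).
have b1 : b < 1 by exact: le_lt_trans b0 ltr01.
apply: (h_fin_of b1 cw).
- exact: EI_fin_half.
- move=> t t1; have t0 := lt_trans ltr01 t1; have t20 : 0 < t / 2 by rewrite divr_gt0.
  have bt2 : b <= t / 2 by rewrite (le_trans b0)// ltW.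
  have t2t : t / 2 <= t by lra.
  have tE : t - t / 2 = t / 2 by field.
  have bt := le_lt_trans b0 t0.
  have A1 : t / 2 * f (t / 2) <= A b t.
    by apply: le_trans (A_base bt2 t2t); have := A_ge t2t; rewrite tE mulrC.
  have B1 : t / 2 * m0 (t / 2) <= B b t.
    by apply: le_trans (B_base bt2 t2t); have := B_ge t2t; rewrite tE mulrC.
  have m1 : 0 <= t / 2 * m0 (t / 2) by rewrite mulr_ge0 ?(ltW t20) ?pos_part_ge0.
  have den2 : 0 < Num.sqrt (t / 2 * f (t / 2)) + (t / 2 * m0 (t / 2)) `^ al.
    by rewrite ltr_pwDl ?powR_ge0// sqrtr_gt0 mulr_gt0.
  rewrite /w /w0 tm0// /h !div1r lef_pV2 ?posrE ?den_gt0//; apply: lerD.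
    exact: ler_wsqrtr.
  by apply: ge0_ler_powR; rewrite ?nnegrE ?(ltW al0).
Qed.

Let C : R := 2 * (n%:R / (2 - q)) `^ al.

(** [K] is chosen so that [n * K] is the whole right side, and [M = K]. [P1] and [P2] solve the
    equation with only [f], respectively only [g], kept; each has half-derivative at most [K] along
    the maximum [P], because both terms are nonnegative beyond [a]. *)
Let profile a : 0 <= g a -> exists P M K, is_profile n f g q C h a P M K.
Proof.
move=> ga; pose ka : R := ((2 - q) / n%:R) `^ al.
have yn0 : 0 < (2 - q) / n%:R by rewrite divr_gt0.
have ka0 : 0 < ka by exact: powR_gt0.
have CE : C = 2 / ka.
  rewrite /C; congr (_ * _); rewrite /ka -powRN.
  have -> : (2 - q) / n%:R = (n%:R / (2 - q)) `^ (-1).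
    by rewrite powR_inv1 ?divr_ge0 ?(ltW y0)// invf_div.
  by rewrite -powRrM; congr (_ `^ _); ring.
pose P1 (t : R) : R := 2 / n%:R * A a t.
pose X (t : R) : R := (2 - q) / n%:R * B a t.
(* With [p = sqrt P], the equation [p * p' = g / n] times the power [q] of [p] integrates to: the
   power [2 - q] of [p] equals [X]. Hence the exponent [al]. *)
pose P2 (t : R) : R := (X t `^ al) ^+ 2.
pose P (t : R) : R := Num.max (P1 t) (P2 t).
have X0 t : 0 <= X t by rewrite mulr_ge0 ?(ltW yn0)// B_ge0.
have cn0 : 0 < 2 / n%:R :> R by rewrite divr_gt0.
have P1_gt0 t : a < t -> 0 < P1 t by move=> at0; rewrite mulr_gt0// A_gt0.
have P_gt0 t : a < t -> 0 < P t by move=> at0; rewrite lt_max P1_gt0.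
have cP1 : continuous P1 by apply: contM; [exact: contC|exact: cA].
have cX : continuous X by apply: contM; [exact: contC|exact: cB].
have cP2 : continuous P2.
  move=> t; apply: (@continuous_comp _ _ _ (fun t => X t `^ al) (fun x => x ^+ 2)).
    by apply: cont_powR => //; exact: cX.
  exact: exprn_continuous.
have cP : continuous P by move=> t; apply: continuous_max; [exact: cP1|exact: cP2].
have gpos t : a <= t -> m0 t = g t.
  by move=> at0; rewrite pos_partE// (le_trans ga)// g_incr.
pose p (t : R) : R := Num.sqrt (P t).
have p_ge0 t : 0 <= p t by exact: sqrtr_ge0.
have Xp t : X t `^ al <= p t.
  rewrite /p -[leLHS]ger0_norm ?powR_ge0// -sqrtr_sqr; apply: ler_wsqrtr.
  by rewrite /P le_max lexx orbT.
have gt_ge0 t : a <= t -> 0 <= g t by move=> at0; rewrite (le_trans ga)// g_incr.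
pose K (t : R) : R := (f t + g t * p t `^ q) / n%:R.
have gp0 t : a <= t -> 0 <= g t * p t `^ q.
  by move=> at0; rewrite mulr_ge0 ?gt_ge0// powR_ge0.
have K_f t : a <= t -> f t / n%:R <= K t.
  by move=> at0; rewrite ler_pM2r ?invr_gt0// lerDl gp0.
have K_g t : a <= t -> g t * (X t `^ al) `^ q / n%:R <= K t.
  move=> at0; rewrite ler_pM2r ?invr_gt0// ler_wpDl ?(ltW (f_gt0 _))//.
  rewrite ler_wpM2l ?gt_ge0//; apply: ge0_ler_powR; rewrite ?nnegrE ?powR_ge0 ?(ltW q0)//.
(* From [2 * al = 1 + al * q]. The factor [X] supplies the linear growth in [s - a]; the other is
   bounded by the power [q] of [p]. *)
have X2 t : P2 t = X t * (X t `^ al) `^ q.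
  rewrite /P2; have := X0 t; rewrite le_eqVlt => /predU1P[<-|Xt0].
    by rewrite powR0 ?gt_eqF// expr0n mul0r.
  rewrite -powR_mulrn ?powR_ge0// -!powRrM -[X in _ = X * _]powRr1 ?X0//.
  rewrite -powRD; last by rewrite (gt_eqF Xt0) implybT.
  by congr (_ `^ _); rewrite /al; field; rewrite lt0r_neq0.
exists P, K, K; split.
- by split => // t _; exact: cP.
- split=> [t at0|t at0]; last first.
    by rewrite divr_ge0// addr_ge0 ?(ltW (f_gt0 _)) ?gp0// ltW.
  have pt : 0 < p t by rewrite sqrtr_gt0 P_gt0.
  have den := den_gt0 at0.
  have H1 : ka * Num.sqrt (A a t) <= p t.
    apply: (@le_trans _ _ (Num.sqrt (P1 t))); last first.
      by apply: ler_wsqrtr; rewrite /P le_max lexx.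
    rewrite /P1 sqrtrM ?(ltW cn0)// ler_wpM2r ?sqrtr_ge0//.
    exact: profile_const_le.
  have H2 : ka * B a t `^ al <= p t.
    by rewrite /ka -powRM ?(ltW yn0) ?B_ge0//; exact: Xp.
  (* [sqrt P] dominates [ka] times each term of the denominator of [h], hence [ka] times half their
     sum: this is the factor 2 in [C]. *)
  rewrite CE /h -/(p t) div1r.
  have -> : 2 / ka * (1 / (Num.sqrt (A a t) + B a t `^ al)) =
      (ka * (Num.sqrt (A a t) + B a t `^ al) / 2)^-1.
    by field; rewrite !lt0r_neq0.
  rewrite lef_pV2 ?posrE ?divr_gt0 ?mulr_gt0//.
  by rewrite mulrDr; lra.
- move=> t e at0 e0; have at1 := ltW at0.
  have dA : is_derive t 1 (A a) (f t).
    by apply: der_eq (derB (dPhi t) (der_cst (Phi a) t)) _; rewrite subr0.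
  have s1 : \forall s \near t, (P1 s - P1 t) * (s - t) <= (2 * K t + e) * (s - t) ^+ 2.
    have D : is_derive t 1 P1 (2 * (f t / n%:R)).
      by apply: der_eq (derM (der_cst (2 / n%:R) t) dA) _; field; rewrite lt0r_neq0.
    apply: filterS (slope_of_derive D e0) => s /le_trans; apply.
    by rewrite ler_wpM2r ?sqr_ge0// lerD2r ler_pM2l// K_f.
  have := X0 t; rewrite le_eqVlt => /predU1P[Xt|Xt].
    have P2t : P2 t = 0 by rewrite /P2 -Xt powR0 ?gt_eqF// expr0n.
    have N1 : \forall s \near t, P2 s < P1 s.
      have c12 : {for t, continuous (fun s => P1 s - P2 s)}.
        by apply: continuousB; [exact: cP1|exact: cP2].
      have pos : 0 < P1 t - P2 t by rewrite P2t subr0 P1_gt0.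
      by apply: filterS (cvgr_gt _ c12 _ pos) => s; rewrite subr_gt0.
    have PE : P t = P1 t by rewrite /P max_l// P2t ltW// P1_gt0.
    apply: filterS2 N1 s1 => s /ltW ps; rewrite PE.
    by rewrite {1}/P max_l.
  apply: (slope_max s1).
  have Bt : 0 < B a t by move: Xt; rewrite pmulr_rgt0.
  have dB : is_derive t 1 (B a) (m0 t).
    have D : is_derive t 1 (fun s => Gam s - Gam a) (m0 t).
      by apply: der_eq (derB (dGam t) (der_cst (Gam a) t)) _; rewrite subr0.
    apply: near_eq_is_derive D.
    have : \forall s \near t, a < s by exact: (lt_nbhsr at0).
    by apply: filterS => s /ltW as0; rewrite BE.
  have dX : is_derive t 1 X ((2 - q) / n%:R * m0 t).
    by apply: der_eq (derM (der_cst ((2 - q) / n%:R) t) dB) _; ring.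
  have dXa := der_comp dX (is_derive_powR al Xt).
  have D : is_derive t 1 P2 (2 * (g t * (X t `^ al) `^ q / n%:R)).
    apply: der_eq (derM dXa dXa) _.
    rewrite gpos// -powRrM.
    have -> : X t `^ (al * q) = X t `^ al * X t `^ (al - 1).
      rewrite -powRD; last by rewrite (gt_eqF Xt) implybT.
      by congr (_ `^ _); rewrite /al; field; rewrite lt0r_neq0.
    transitivity (2 * (al * (2 - q)) * (g t * (X t `^ al * X t `^ (al - 1))) / n%:R).
      by field; rewrite lt0r_neq0.
    have alE : al * (2 - q) = 1 by rewrite /al div1r mulVf// lt0r_neq0.
    by rewrite alE; ring.
  apply: filterS (slope_of_derive D e0) => s /le_trans; apply.
  by rewrite ler_wpM2r ?sqr_ge0// lerD2r ler_pM2l// K_g.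
- move=> s t as0 st; have at1 := le_trans (ltW as0) st.
  have sa : 0 <= s - a by rewrite subr_ge0 ltW.
  rewrite /P ge_max; apply/andP; split.
    apply: (@le_trans _ _ (2 * (f t / n%:R) * (s - a))); last first.
      by rewrite ler_wpM2r// ler_pM2l// K_f.
    apply: (@le_trans _ _ (2 / n%:R * (f t * (s - a)))); last first.
      by rewrite le_eqVlt; apply/orP; left; apply/eqP; field; rewrite lt0r_neq0.
    rewrite /P1 ler_pM2l//; apply: le_trans (A_le (ltW as0)) _.
    by rewrite ler_wpM2r// f_le.
  apply: (@le_trans _ _ (2 * (g t * (X t `^ al) `^ q / n%:R) * (s - a))); last first.
    by rewrite ler_wpM2r// ler_pM2l// K_g.
  rewrite X2.
  apply: (@le_trans _ _ (2 / n%:R * (g t * (s - a)) * (X t `^ al) `^ q)); last first.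
    by rewrite le_eqVlt; apply/orP; left; apply/eqP; field; rewrite lt0r_neq0.
  have E1 : X s <= 2 / n%:R * (g t * (s - a)).
    apply: ler_pM => //; first exact: ltW.
      by rewrite ler_pM2r ?invr_gt0// gerBl ltW.
    apply: le_trans (B_le (ltW as0)) _; rewrite ler_wpM2r//.
    by rewrite -gpos// m0_homo.
  have XX : X s <= X t by rewrite ler_pM2l//; apply: B_homo => //; exact: ltW.
  have E2 : (X s `^ al) `^ q <= (X t `^ al) `^ q.
    have q0' := ltW q0; have al0' := ltW al0.
    apply: ge0_ler_powR => //; rewrite ?nnegrE ?powR_ge0//.
    by apply: ge0_ler_powR => //; rewrite nnegrE.
  exact: (ler_pM (X0 s) (powR_ge0 _ _) E1 E2).
- split=> [t at0|e fe].
    by rewrite -/(p t) le_eqVlt; apply/orP; left; apply/eqP; rewrite /K; field; rewrite lt0r_neq0.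
  have [] := @cont_right_lt _ (fun t => f t + g t * p t `^ q) a e.
  + apply: continuousD; first exact: cf.
    apply: continuousM; first exact: cg.
    apply: cont_powR => //.
    by apply: (@continuous_comp _ _ _ P Num.sqrt); [exact: cP|exact: sqrt_continuous].
  + have -> : p a = 0.
      rewrite /p /P /P1 /P2 /X /A /B !subrr mulr0 maxxx mulr0 powR0 ?gt_eqF//.
      by rewrite expr0n maxxx sqrtr0.
    by rewrite powR0 ?gt_eqF// mulr0 addr0.
  + move=> t at0 H; exists t => //; rewrite /K mulrC mulfVK//.
    exact: lt0r_neq0.
Qed.

Lemma lower_gradient : (exists t, 0 < g t) ->
  f t @[t --> +oo] --> +oo \/ (forall A, \forall t \near +oo, A < g t) ->
  (1 < q \/ (EI (fun t => 1 / ((t * f t) `^ (1/2) + (t * m0 t) `^ al))%R 0 < +oo)%E) ->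
  forall x, O x -> (t0_of g < (u x)%:E)%E ->
  ((u x)%:E <= Rinv (Rfun_i n q f g) (dist_bd O x))%E.
Proof.
move=> g_pos fg fin.
have C0 : 0 < C by rewrite mulr_gt0// powR_gt0// divr_gt0.
have fin' : forall a, exists2 b, b <= a & (EI (h b) b < +oo)%E.
  by case: fin => [q1|fin]; [exact: h_fin_super|exact: h_fin_sub].
have prof a : (t0_of g < a%:E)%E -> exists P M K, is_profile n f g q C h a P M K.
  by move=> /(t0_lt_ge0 g_incr); exact: profile.
apply: (@profile_bound _ _ F f g q O u n0 f_incr g_incr F0 F_ell oO bO q0 usub C h
  (Rfun_i n q f g) (t0_of g) C0 _ (fun a t _ => h_ge0 a t) h_cont h_dec h_conta
  fin' (h_lim fg) prof).
move=> a; rewrite /Rfun_i q_lt2; congr (_ * _)%E; apply: EI_eq => t at0.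
have at1 := ltW at0; have A0 := ltW (A_gt0 at0).
by rewrite (RIf at1) (RIg at1) -/(A a t) -(BE at1) (powR_half A0).
Qed.

End LowerGradient.

(** * Gradient term with negative limit *)

Section NegativeLimit.
Variables (Phi Gam : R -> R) (L : R).
Hypothesis L_lt0 : L < 0.
Hypothesis glim : g t @[t --> +oo] --> L.
Hypothesis flim : f t @[t --> +oo] --> +oo.
Hypothesis dPhi : forall t : R, is_derive t 1 Phi (f t).
Hypothesis dGam : forall t : R, is_derive t 1 Gam (neg_part g t).
Hypothesis RIf : forall a b : R, a <= b -> RI f a b = Phi b - Phi a.
Hypothesis RIg : forall a b : R, a <= b -> RI (neg_part g) a b = Gam b - Gam a.

Notation nu := (neg_part g).
Let e : R := 1 / q.
Let A (a t : R) : R := Phi t - Phi a.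
Let D (a t : R) : R := Gam t - Gam a.
Let h (a t : R) : R := 1 / Num.sqrt (A a t) + (D a t / A a t) `^ e.

Let e0 : 0 < e. Proof. by rewrite divr_gt0. Qed.
Let nuE t : nu t = - g t.
Proof. by rewrite neg_partE// (le_trans (homo_cvg_le t g_incr glim))// ltW. Qed.
Let nu_gt0 t : 0 < nu t.
Proof. by rewrite nuE oppr_gt0; apply: le_lt_trans L_lt0; exact: homo_cvg_le. Qed.
Let nu_homo : {homo nu : x y /~ x <= y}. Proof. exact: neg_part_homo. Qed.

Let A_ge a t : a <= t -> f a * (t - a) <= A a t.
Proof.
by move=> at0; apply: (primitive_ge dPhi) => // c /andP[ac _]; rewrite f_le// ltW.
Qed.

Let A_le a t : a <= t -> A a t <= f t * (t - a).
Proof.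
by move=> at0; apply: (primitive_le dPhi) => // c /andP[_ ct]; rewrite f_le// ltW.
Qed.

Let A_gt0 a t : a < t -> 0 < A a t.
Proof.
move=> at0; apply: lt_le_trans (A_ge (ltW at0)).
by rewrite mulr_gt0// subr_gt0.
Qed.

Let D_ge a t : a <= t -> nu t * (t - a) <= D a t.
Proof.
by move=> at0; apply: (primitive_ge dGam) => // c /andP[_ ct]; rewrite nu_homo// ltW.
Qed.

Let D_le a t : a <= t -> D a t <= nu a * (t - a).
Proof.
by move=> at0; apply: (primitive_le dGam) => // c /andP[ac _]; rewrite nu_homo// ltW.
Qed.

Let D_gt0 a t : a < t -> 0 < D a t.
Proof.
move=> at0; apply: lt_le_trans (D_ge (ltW at0)).
by rewrite mulr_gt0// subr_gt0.
Qed.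

Let A_base a b t : b <= a -> a <= t -> A a t <= A b t.
Proof.
move=> ba at0; rewrite /A lerD2l lerN2 -subr_ge0.
by apply: le_trans (A_ge ba); rewrite mulr_ge0 ?subr_ge0// ltW.
Qed.

(* Both increments change sign together, so the base of the real power is nonnegative for all t. *)
Let ratio_ge0 a t : 0 <= D a t / A a t.
Proof.
have [at0|ta|->] := ltgtP a t; last by rewrite /D subrr mul0r.
  by rewrite divr_ge0// ltW// ?A_gt0 ?D_gt0.
by rewrite -divrNN divr_ge0// opprB ltW//; [exact: D_gt0|exact: A_gt0].
Qed.

Let cA a : continuous (A a).
Proof.
move=> t; apply: (@continuousB _ _ _ Phi (cst (Phi a))).
  exact: is_derive_cont (dPhi t).
exact: cvg_cst.
Qed.

Let cD a : continuous (D a).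
Proof.
move=> t; apply: (@continuousB _ _ _ Gam (cst (Gam a))).
  exact: is_derive_cont (dGam t).
exact: cvg_cst.
Qed.

Let profile_term_cont (x y : R -> R) (t : R) :
  {for t, continuous x} -> {for t, continuous y} ->
  0 < x t -> (forall s, 0 <= y s / x s) ->
  {for t, continuous (fun s => 1 / Num.sqrt (x s) + (y s / x s) `^ e)}.
Proof.
move=> cx cy x0 yx0.
apply: (@continuousD _ _ _ (fun s => 1 / Num.sqrt (x s)) (fun s => (y s / x s) `^ e)).
  apply: continuousM; first exact: cvg_cst.
  apply: (@continuousV _ _ (fun s => Num.sqrt (x s))).
    by rewrite lt0r_neq0// sqrtr_gt0.
  by apply: (@continuous_comp _ _ _ x Num.sqrt) => //; exact: sqrt_continuous.
apply: cont_powR => //; apply: continuousM => //.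
by apply: (@continuousV _ _ x) => //; exact: lt0r_neq0.
Qed.

Let h_ge0 a t : 0 <= h a t.
Proof. by rewrite addr_ge0 ?powR_ge0// divr_ge0 ?sqrtr_ge0. Qed.

Let h_cont a : cont_after a (h a).
Proof.
move=> t at0; apply: profile_term_cont; [exact: cA|exact: cD|exact: A_gt0|].
exact: ratio_ge0.
Qed.

Let h_conta s : 0 < s -> continuous (fun a => h a (s + a)).
Proof.
move=> s0 a.
apply: (@profile_term_cont (fun a => A a (s + a)) (fun a => D a (s + a))).
- exact: (primitive_shift_cont dPhi).
- exact: (primitive_shift_cont dGam).
- by apply: A_gt0; rewrite ltrDr.
- by move=> b; exact: ratio_ge0.
Qed.

Let h_dec a b s : a < b -> 0 < s -> h b (s + b) < h a (s + a).
Proof.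
move=> ab s0; have sa (c : R) : c < s + c by rewrite ltrDr.
have A_lt := primitive_shift_lt dPhi f_incr ab s0.
have Aa := A_gt0 (sa a); have Ab := A_gt0 (sa b).
have D_shift : D b (s + b) <= D a (s + a).
  have dN (t : R) : is_derive t 1 (fun t => - Gam t) (- nu t).
    have G := derB (der_cst 0 t) (dGam t).
    have -> : (fun t => - Gam t) = (fun t => 0 - Gam t) by apply/funext => x; rewrite sub0r.
    by apply: der_eq G _; rewrite sub0r.
  have Nh : {homo (fun t => - nu t) : x y / x <= y}.
    by move=> x y xy; rewrite lerN2 nu_homo.
  have := primitive_shift_le dN Nh (ltW ab) (ltW s0); rewrite /D; lra.
rewrite /h; apply: ltr_leD.
  by rewrite !div1r ltf_pV2 ?posrE ?sqrtr_gt0// ltr_sqrt.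
apply: ge0_ler_powR; rewrite ?nnegrE ?ratio_ge0 ?(ltW e0)//.
apply: ler_pM; rewrite ?invr_ge0 ?(ltW Ab) ?(ltW (D_gt0 (sa b)))//.
by rewrite lef_pV2 ?posrE// ltW.
Qed.

Let h_lim s : 0 < s -> h m%:R (s + m%:R) @[m --> \oo] --> (0 : R).
Proof.
move=> s0; have sa (c : R) : c < s + c by rewrite ltrDr.
rewrite -[X in _ --> X]addr0.
apply: (@cvgD _ _ _ _ _ (fun m : nat => 1 / Num.sqrt (A m%:R (s + m%:R)))
  (fun m : nat => (D m%:R (s + m%:R) / A m%:R (s + m%:R)) `^ e)).
  apply: (@inv_sqrt_cvg0 _ (fun m => A m%:R (s + m%:R))) => [m|m _ //|X].
    by rewrite divr_ge0 ?sqrtr_ge0.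
  have [N HN] := cvg_pinfty_nat (X / s) flim; exists N => m /HN.
  rewrite ltr_pdivrMr// => H; apply: lt_le_trans H _.
  by have := A_ge (ltW (sa m%:R)); rewrite addrK.
apply: (@inv_cvg0 _ (fun m => (f m%:R / nu 0) `^ e)) => [m|m fm0|X].
- exact: powR_ge0.
- have fn0 : 0 < f m%:R / nu 0 by rewrite divr_gt0 ?f_gt0 ?nu_gt0.
  rewrite div1r -powR_invl ?(ltW fn0)//.
  apply: ge0_ler_powR; rewrite ?nnegrE ?ratio_ge0 ?(ltW e0) ?invr_ge0 ?(ltW fn0)//.
  rewrite ler_pdivrMr ?A_gt0// invf_div.
  have H1 := D_le (ltW (sa m%:R)); have H2 := A_ge (ltW (sa m%:R)).
  rewrite addrK in H1 H2.
  apply: (@le_trans _ _ (nu 0 * s)).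
    by apply: le_trans H1 _; rewrite ler_pM2r// nu_homo.
  apply: (@le_trans _ _ (nu 0 / f m%:R * (f m%:R * s))).
    by rewrite mulrA divfK// lt0r_neq0.
  by rewrite ler_wpM2l// divr_ge0 ?(ltW (nu_gt0 _)) ?(ltW (f_gt0 _)).
- have [N HN] := cvg_pinfty_nat (Num.max X 0 `^ (1 / e) * nu 0) flim.
  exists N => m /HN; rewrite -ltr_pdivlMr ?nu_gt0// => H; apply: powR_gt_of => //.
  by rewrite divr_ge0 ?(ltW (nu_gt0 _)) ?(ltW (f_gt0 _)).
Qed.

(** Near the base point [D / A] is bounded by [nu b / f b], so only the inverse square root is
    singular; at infinity the hypothesis is applied at [t / 2]. *)
Let h_fin : (EI (fun t => 1 / (t * f t) `^ (1/2) + 1 / (f t) `^ (1 / q))%R 0 < +oo)%E ->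
  forall a, exists2 b, b <= a & (EI (h b) b < +oo)%E.
Proof.
move=> hyp a; pose b := Num.min a 0.
have b0 : b <= 0 by rewrite ge_min lexx orbT.
exists b; first by rewrite ge_min lexx.
pose w0 (t : R) : R := 1 / Num.sqrt (t * f t) + 1 / f t `^ e.
have w0_ge0 t : 0 <= w0 t.
  by rewrite addr_ge0// divr_ge0 ?sqrtr_ge0 ?powR_ge0.
have cw0 : cont_after 0 w0.
  move=> t t0; have c1 : {for t, continuous (fun t : R => 1 / Num.sqrt (t * f t))}.
    have cs : {for t, continuous (fun t : R => Num.sqrt (t * f t))}.
      have cp : {for t, continuous (fun t : R => t * f t)}.
        by apply: continuousM; [exact: cvg_id|exact: cf].
      exact: (continuous_comp cp (@sqrt_continuous _ _)).
    have sn0 : Num.sqrt (t * f t) != 0 by rewrite lt0r_neq0// sqrtr_gt0 mulr_gt0.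
    exact: cont_inv cs sn0.
  have c2 : {for t, continuous (fun t : R => 1 / f t `^ e)}.
    have cs : {for t, continuous (fun t : R => f t `^ e)}.
      by apply: cont_powR => // [s|]; [exact: ltW|exact: cf].
    have sn0 : f t `^ e != 0 by rewrite lt0r_neq0// powR_gt0.
    exact: cont_inv cs sn0.
  exact: (continuousD c1 c2).
have w0fin : (EI w0 0 < +oo)%E.
  apply: le_lt_trans hyp; rewrite le_eqVlt; apply/orP; left; apply/eqP.
  apply: EI_eq => t t0; rewrite /w0 powR_half//.
  by rewrite mulr_ge0 ?(ltW t0)// ltW.
(* For [t > 1] and [b <= 0], [D b t <= nu b * (1 - b) * t] and [A b t >= t / 2 * f (t / 2)]; the
   quotient of the two bounds is the base of this power divided by [f (t / 2)]. *)
pose v : R := (2 * (nu b * (1 - b))) `^ e; pose k : R := 1 + v.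
have v0 : 0 <= v by exact: powR_ge0.
pose w1 (t : R) : R := w0 (t / 2).
pose w (t : R) : R := k * w1 t.
have cw1 : cont_after 1 w1.
  move=> t t1; have c2 : {for t, continuous (fun t : R => t / 2)}.
    by apply: continuousM; [exact: cvg_id|exact: cvg_cst].
  have t20 : 0 < t / 2 by rewrite divr_gt0// (lt_trans ltr01 t1).
  exact: (continuous_comp c2 (cw0 _ t20)).
have w1fin : (EI w1 1 < +oo)%E by exact: EI_fin_half.
have b1 : b < 1 by exact: le_lt_trans b0 ltr01.
have tb (t : R) : b < t -> 0 < t - b by rewrite subr_gt0.
have rb t : b < t -> D b t / A b t <= nu b / f b.
  move=> bt; rewrite ler_pdivrMr ?A_gt0//.
  apply: le_trans (D_le (ltW bt)) _.
  apply: (@le_trans _ _ (nu b / f b * (f b * (t - b)))).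
    by rewrite mulrA divfK// lt0r_neq0.
  rewrite ler_wpM2l ?divr_ge0 ?(ltW (nu_gt0 _)) ?(ltW (f_gt0 _))//.
  exact: A_ge (ltW bt).
pose k1 : R := 1 / Num.sqrt (f b) + (nu b / f b) `^ e * Num.sqrt (1 - b).
apply: (@EI_fin_sqrt _ b 1 k1 (h b) w) => //.
- by rewrite addr_ge0 ?mulr_ge0 ?divr_ge0 ?sqrtr_ge0 ?powR_ge0.
- move=> t bt t1; have st : 0 < Num.sqrt (t - b) by rewrite sqrtr_gt0 tb.
  have sf : 0 < Num.sqrt (f b) by rewrite sqrtr_gt0.
  rewrite /h /k1 [X in _ <= X]mulrDl; apply: lerD.
    rewrite !div1r -invfM -sqrtrM ?(ltW (f_gt0 _))//.
    rewrite lef_pV2 ?posrE ?sqrtr_gt0 ?A_gt0 ?mulr_gt0 ?tb//.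
    by apply: ler_wsqrtr; exact: A_ge (ltW bt).
  rewrite ler_pdivlMr//; apply: ler_pM; rewrite ?powR_ge0 ?sqrtr_ge0//.
    apply: ge0_ler_powR; rewrite ?nnegrE ?ratio_ge0 ?(ltW e0)//; last exact: rb.
    by rewrite divr_ge0// ltW.
  by apply: ler_wsqrtr; rewrite lerD2r.
- by move=> t t1; apply: continuousM; [exact: cvg_cst|exact: cw1].
- apply: EI_scale_fin => //; first by rewrite addr_ge0.
  by move=> t _; exact: w0_ge0.
- move=> t t1; have t0 := lt_trans ltr01 t1; have t20 : 0 < t / 2 by rewrite divr_gt0.
  have bt2 : b <= t / 2 by rewrite (le_trans b0)// ltW.
  have t2t : t / 2 <= t by lra.
  have tE : t - t / 2 = t / 2 by field.
  have bt := le_lt_trans b0 t0.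
  have A1 : t / 2 * f (t / 2) <= A b t.
    by apply: le_trans (A_base bt2 t2t); have := A_ge t2t; rewrite tE mulrC.
  have tf0 : 0 < t / 2 * f (t / 2) by rewrite mulr_gt0.
  have x0 : 0 <= 1 / Num.sqrt (t / 2 * f (t / 2)) by rewrite divr_ge0 ?sqrtr_ge0.
  have y0 : 0 <= 1 / f (t / 2) `^ e by rewrite divr_ge0 ?powR_ge0.
  have H1 : 1 / Num.sqrt (A b t) <= 1 / Num.sqrt (t / 2 * f (t / 2)).
    rewrite !div1r lef_pV2 ?posrE ?sqrtr_gt0 ?A_gt0//.
    exact: ler_wsqrtr.
  have H2 : (D b t / A b t) `^ e <= v * (1 / f (t / 2) `^ e).
    have -> : 1 / f (t / 2) `^ e = ((f (t / 2))^-1) `^ e.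
      by rewrite div1r powR_invl// ltW.
    have f2 := f_gt0 (t / 2); have nb := nu_gt0 b.
    have c0 : 0 <= 2 * (nu b * (1 - b)).
      by rewrite mulr_ge0// mulr_ge0 ?(ltW nb)// subr_ge0 ltW.
    rewrite -powRM ?invr_ge0 ?(ltW f2)//.
    apply: ge0_ler_powR; rewrite ?nnegrE ?ratio_ge0 ?(ltW e0)//.
      by rewrite divr_ge0// ltW.
    rewrite ler_pdivrMr ?A_gt0//.
    apply: le_trans (D_le (ltW bt)) _.
    apply: (@le_trans _ _ (2 * (nu b * (1 - b)) / f (t / 2) * (t / 2 * f (t / 2)))).
      have -> : 2 * (nu b * (1 - b)) / f (t / 2) * (t / 2 * f (t / 2)) =
          nu b * ((1 - b) * t) by field; exact: lt0r_neq0.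
      by rewrite ler_pM2l//; nra.
    by rewrite ler_wpM2l// divr_ge0// ltW.
  rewrite /w /k /w1 /w0; apply: le_trans (lerD H1 H2) _.
  by have := mulr_ge0 v0 x0; lra.
Qed.

Let C : R := 2 * (n%:R `^ e) / q.

Let np0 : 0 < n%:R `^ e :> R. Proof. exact: powR_gt0. Qed.
Let C0 : 0 < C. Proof. by rewrite divr_gt0// mulr_gt0. Qed.
Let CV : C^-1 = q / 2 / n%:R `^ e.
Proof. by rewrite /C; field; rewrite !lt0r_neq0. Qed.

Let q4 : q ^+ 2 / 4 <= 1.
Proof.
rewrite ler_pdivrMr// mul1r; have -> : 4 = 2 ^+ 2 :> R by ring.
by rewrite ler_sqr ?nnegrE// ltW.
Qed.

Let C2_le : C ^- 2 <= q ^+ 2 / 4 / n%:R.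
Proof.
have -> : C ^- 2 = q ^+ 2 / 4 / (n%:R `^ e) ^+ 2.
  by rewrite -exprVn CV; field; rewrite lt0r_neq0.
have qp : 0 < q ^+ 2 / 4 by rewrite divr_gt0// exprn_gt0.
rewrite ler_pM2l// lef_pV2 ?posrE ?exprn_gt0//.
rewrite -powR_mulrn ?(ltW np0)// -powRrM /e mulrAC mul1r.
by apply: le1r_powR; rewrite ?ler1n// ler_pdivlMr// mul1r.
Qed.

Let Cq : C^-1 `^ q = (q / 2) `^ q / n%:R.
Proof.
have q20 : 0 <= q / 2 by rewrite divr_ge0// ltW.
rewrite CV powRM ?invr_ge0 ?(ltW np0)//; congr (_ * _).
rewrite powR_invl ?(ltW np0)// -powRrM /e div1r mulVf ?lt0r_neq0//.
by rewrite powRr1// ltW.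
Qed.

(** Here [1 / sqrt P] is [C * h a] itself. Every term of the supersolution inequality becomes a
    fraction of [f]: at most [1 - n^-1] for the tangential part, and [n^-1] times the two summands
    of [quadratic_power_le] for the second derivative and the gradient. *)
Let profile a : exists P M K, is_profile n f g q C h a P M K.
Proof.
pose p (t : R) : R := (C * h a t)^-1.
(* The logarithmic derivative of [D / A] is [(m - f) / A]. Monotonicity of [f] and [nu] gives
   [m <= f], so [h] decreases and [P] increases. *)
pose m (t : R) : R := nu t * A a t / D a t.
(* [sg] and [rh] are the shares of the two summands of [h], with sum 1. *)
pose sg (t : R) : R := 1 / Num.sqrt (A a t) / h a t.
pose rh (t : R) : R := (D a t / A a t) `^ e / h a t.
pose M (t : R) : R := C ^- 2 * sg t ^+ 2 * (sg t * f t / 2 + e * rh t * (f t - m t)).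
pose K (t : R) : R := C ^- 2 * (f t / 2).
have s_gt0 t : a < t -> 0 < 1 / Num.sqrt (A a t).
  by move=> at0; rewrite divr_gt0// sqrtr_gt0 A_gt0.
have h_gt0 t : a < t -> 0 < h a t.
  by move=> at0; rewrite ltr_pwDl ?powR_ge0// s_gt0.
have Ch t : a < t -> 0 < C * h a t by move=> at0; rewrite mulr_gt0// h_gt0.
have p_gt0 t : a < t -> 0 < p t by move=> at0; rewrite invr_gt0 Ch.
have sqP t : a < t -> Num.sqrt (p t * p t) = p t.
  by move=> at0; rewrite -expr2 sqrtr_sqr gtr0_norm// p_gt0.
have c2 : 0 < C ^- 2 by rewrite invr_gt0 exprn_gt0.
have sg_ge0 t : a < t -> 0 <= sg t by move=> at0; rewrite divr_ge0// ltW// s_gt0.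
have rh_ge0 t : a < t -> 0 <= rh t by move=> at0; rewrite divr_ge0 ?powR_ge0.
have sg_rh t : a < t -> sg t + rh t = 1.
  by move=> at0; rewrite -mulrDl -/(h a t) mulfV// lt0r_neq0// h_gt0.
have m_ge0 t : a < t -> 0 <= m t.
  by move=> at0; rewrite divr_ge0 ?mulr_ge0 ?(ltW (nu_gt0 _)) ?(ltW (A_gt0 _)) ?(ltW (D_gt0 _)).
have m_le t : a < t -> m t <= f t.
  move=> at0; rewrite ler_pdivrMr ?D_gt0//.
  apply: (@le_trans _ _ (nu t * (f t * (t - a)))).
    by rewrite ler_pM2l// A_le// ltW.
  by rewrite mulrCA ler_pM2l// D_ge// ltW.
have dh (t : R) : a < t -> is_derive t 1 (h a)
    (- ((1 / Num.sqrt (A a t)) ^+ 3 * f t / 2 + e * (D a t / A a t) `^ e *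
       (1 / Num.sqrt (A a t)) ^+ 2 * (f t - m t))).
  move=> at0; have A0 := A_gt0 at0; have D0 := D_gt0 at0.
  have dA : is_derive t 1 (A a) (f t).
    by apply: der_eq (derB (dPhi t) (der_cst (Phi a) t)) _; rewrite subr0.
  have dD : is_derive t 1 (D a) (nu t).
    by apply: der_eq (derB (dGam t) (der_cst (Gam a) t)) _; rewrite subr0.
  have S0 : 0 < Num.sqrt (A a t) by rewrite sqrtr_gt0.
  have x0 : 0 < D a t / A a t by rewrite divr_gt0.
  have ds := derM (der_cst 1 t) (derV (der_comp dA (is_derive1_sqrt A0)) (lt0r_neq0 S0)).
  have dr := der_comp (derM dD (derV dA (lt0r_neq0 A0))) (is_derive_powR e x0).
  apply: der_eq (derD ds dr) _.
  rewrite -(mulr_powRB1 (ltW x0) e0) /m; set y := _ `^ (e - 1).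
  have AE : A a t = Num.sqrt (A a t) ^+ 2 by rewrite sqr_sqrtr// ltW.
  move: S0 AE; set S := Num.sqrt (A a t) => S0 ->.
  by field; rewrite !lt0r_neq0.
have dP (t : R) : a < t -> is_derive t 1 (fun s => p s * p s) (2 * M t).
  move=> at0; have dp := derV (derM (der_cst C t) (dh t at0)) (lt0r_neq0 (Ch t at0)).
  apply: der_eq (derM dp dp) _; rewrite /M /sg /rh.
  by field; rewrite !lt0r_neq0// ?h_gt0// sqrtr_gt0 A_gt0.
exists (fun t => p t * p t), M, K; split.
- split => t at0; first by rewrite mulr_gt0// p_gt0.
  exact: is_derive_cont (dP t at0).
- split=> t at0; first by rewrite sqP// /p div1r invrK.
  have fm : 0 <= f t - m t by rewrite subr_ge0 m_le.
  apply: mulr_ge0; first by apply: mulr_ge0; [exact: ltW|exact: sqr_ge0].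
  apply: addr_ge0; last by apply: mulr_ge0 fm; apply: mulr_ge0; [exact: ltW|exact: rh_ge0].
  by apply: divr_ge0 => //; apply: mulr_ge0; [exact: sg_ge0|exact: ltW].
- by move=> t d at0; apply: slope_of_derive; exact: dP.
- move=> s t as0 st; have sa : 0 <= s - a by rewrite subr_ge0 ltW.
  have A0 := A_gt0 as0; have S0 : 0 < Num.sqrt (A a s) by rewrite sqrtr_gt0.
  have ps : p s <= C^-1 * Num.sqrt (A a s).
    rewrite /p invfM ler_pM2l ?invr_gt0// -[leRHS]invrK lef_pV2 ?posrE ?invr_gt0 ?h_gt0//.
    by rewrite /h div1r lerDl powR_ge0.
  have p0 := ltW (p_gt0 s as0).
  apply: le_trans (ler_pM p0 p0 ps ps) _.
  have -> : C^-1 * Num.sqrt (A a s) * (C^-1 * Num.sqrt (A a s)) =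
      C ^- 2 * Num.sqrt (A a s) ^+ 2 by field; rewrite lt0r_neq0.
  rewrite sqr_sqrtr ?(ltW A0)//.
  have -> : 2 * K t * (s - a) = C ^- 2 * (f t * (s - a)) by rewrite /K; field; rewrite lt0r_neq0.
  rewrite ler_pM2l//; apply: le_trans (A_le (ltW as0)) _.
  by rewrite ler_wpM2r// f_le.
split=> [t at0|d fd].
  rewrite sqP//; have A0 := A_gt0 at0; have D0 := D_gt0 at0.
  have [sg0 rh0 sr] := And3 (sg_ge0 t at0) (rh_ge0 t at0) (sg_rh t at0).
  have [mg0 mf ft] := And3 (m_ge0 t at0) (m_le t at0) (f_gt0 t).
  (* The power [q] undoes the exponent [e = 1 / q] in [rh], leaving [D / A], and
     [nu = m * (D / A)]. *)
  have Gp : g t * p t `^ q = - (m t * ((q * rh t / 2) `^ q / n%:R)).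
    have -> : g t = - nu t by rewrite nuE opprK.
    rewrite mulNr; congr (- _).
    have x0 := ratio_ge0 a t; have q20 : 0 <= q / 2 by rewrite divr_ge0// ltW.
    have -> : q * rh t / 2 = q / 2 * rh t by field.
    have hi0 : 0 <= (h a t)^-1 by rewrite invr_ge0 h_ge0.
    have Ci0 : 0 <= C^-1 by rewrite invr_ge0 ltW.
    have E1 : (q / 2 * rh t) `^ q = (q / 2) `^ q * rh t `^ q by exact: powRM.
    have E2 : p t `^ q = C^-1 `^ q * (h a t)^-1 `^ q by rewrite /p invfM powRM.
    have E3 : rh t `^ q = D a t / A a t * (h a t)^-1 `^ q.
      rewrite /rh powRM ?powR_ge0// -powRrM.
      have -> : e * q = 1 by rewrite /e div1r mulVf// lt0r_neq0.
      by rewrite powRr1.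
    rewrite E1 E2 E3 Cq /m.
    by field; rewrite !lt0r_neq0.
  have N0 : 0 < n%:R^-1 :> R by rewrite invr_gt0.
  have N1 : n%:R^-1 <= 1 :> R by rewrite invf_le1// ler1n.
  have Nn : n%:R * n%:R^-1 = 1 :> R by rewrite mulfV// lt0r_neq0.
  have r1 : rh t <= 1 by rewrite -sr lerDr.
  have sE : sg t = 1 - rh t by rewrite -sr addrK.
  have Qp := quadratic_power_le q0 q2 rh0 r1.
  have pw := powR_ge0 (q * rh t / 2) q.
  (* Since [q <= 2], both [1 / 2] and [e] are at most [1 / q]; the shares add up to 1, so the
     bracket is at most [f t / q]. *)
  have HM : M t <= n%:R^-1 * (q / 4 * sg t ^+ 2 * f t).
    have br : sg t * f t / 2 + e * rh t * (f t - m t) <= f t / q.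
      apply: (@le_trans _ _ (sg t * f t * e + e * rh t * f t)).
        apply: lerD.
          apply: ler_wpM2l; first by apply: mulr_ge0 => //; exact: ltW.
          by rewrite /e div1r lef_pV2 ?posrE.
        by apply: ler_wpM2l; [exact: mulr_ge0 (ltW e0) rh0|rewrite gerBl].
      have -> : sg t * f t * e + e * rh t * f t = e * f t * (sg t + rh t) by ring.
      by rewrite sr mulr1 /e div1r mulrC.
    have s2 : 0 <= sg t ^+ 2 by rewrite exprn_ge0.
    apply: (@le_trans _ _ (q ^+ 2 / 4 / n%:R * sg t ^+ 2 * (f t / q))).
      apply: ler_pM => //; first by rewrite mulr_ge0// ltW.
        have fm : 0 <= f t - m t by rewrite subr_ge0.
        apply: addr_ge0; last exact: mulr_ge0 (mulr_ge0 (ltW e0) rh0) fm.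
        by apply: divr_ge0 => //; exact: mulr_ge0 sg0 (ltW ft).
      exact: ler_wpM2r s2 _ _ C2_le.
    by rewrite le_eqVlt; apply/orP; left; apply/eqP; field; rewrite !lt0r_neq0.
  have HK : (n%:R - 1) * K t <= (1 - n%:R^-1) * f t.
    have n1 : 0 <= n%:R - 1 :> R by rewrite subr_ge0 ler1n.
    have -> : (1 - n%:R^-1) * f t = (n%:R - 1) * (n%:R^-1 * f t).
      by rewrite mulrA; congr (_ * f t); rewrite mulrBl Nn mul1r.
    rewrite ler_wpM2l// /K; apply: ler_pM; rewrite ?(ltW c2) ?divr_ge0 ?(ltW ft)//.
      by apply: le_trans C2_le _; rewrite ler_piMl// ltW.
    by rewrite ler_pdivrMr// ler_peMr ?(ltW ft)//; lra.
  have HG : m t * ((q * rh t / 2) `^ q / n%:R) <= n%:R^-1 * ((q * rh t / 2) `^ q * f t).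
    have -> : n%:R^-1 * ((q * rh t / 2) `^ q * f t) = f t * ((q * rh t / 2) `^ q / n%:R) by ring.
    by rewrite ler_wpM2r// divr_ge0.
  rewrite Gp; have : n%:R^-1 * ((q / 4 * (1 - rh t) ^+ 2 + (q * rh t / 2) `^ q) * f t)
      <= n%:R^-1 * f t.
    by rewrite ler_pM2l// -[leRHS]mul1r ler_pM2r.
  rewrite -sE; lra.
have [t at0 ft] : exists2 t, a < t & f t <= d.
  by apply: cont_right_lt => //; exact: cf.
exists t => //; apply: le_trans ft; rewrite /K mulrA.
have : n%:R * C ^- 2 <= 1.
  apply: (@le_trans _ _ (n%:R * (q ^+ 2 / 4 / n%:R))); first by rewrite ler_pM2l.
  by rewrite mulrC divfK// lt0r_neq0.
have := f_gt0 t; nra.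
Qed.

Lemma case_negative_limit :
  (EI (fun t => 1 / (t * f t) `^ (1/2) + 1 / (f t) `^ (1 / q))%R 0 < +oo)%E ->
  forall x, O x -> ((u x)%:E <= Rinv (Rfun_iii n q f g) (dist_bd O x))%E.
Proof.
move=> hyp x Ox.
apply: (@profile_bound _ _ F f g q O u n0 f_incr g_incr F0 F_ell oO bO q0 usub C h
  (Rfun_iii n q f g) -oo%E C0 _ (fun a t _ => h_ge0 a t) h_cont h_dec h_conta
  (h_fin hyp) h_lim (fun a _ => profile a) x Ox (ltNyr _)).
move=> a; rewrite /Rfun_iii; congr (_ * _)%E; apply: EI_eq => t at0.
have at1 := ltW at0; have A0 := ltW (A_gt0 at0).
by rewrite (RIf at1) (RIg at1) -/(A a t) (powR_half A0).
Qed.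

End NegativeLimit.

End Cases.

(** * The three regimes of the limit of [g] *)

Theorem theorem3p6 (R : realType) (n : nat) (f g : R -> R)
  (F : 'rV[R]_n -> 'M[R]_n -> R) (O : set 'rV[R]_n) (q : R)
  (u : 'rV[R]_n -> R) :
  (* f, g *)
  continuous f -> continuous g ->
  {homo f : x y / x < y} -> {homo g : x y / x <= y} ->
  (forall t, 0 < f t) ->
  ((exists l : R, g t @[t --> +oo] --> l) -> f t @[t --> +oo] --> +oo) ->
  (* F *)
  {within [set p | symmetric_mx p.2], continuous (fun p => F p.1 p.2)} ->
  (forall x, F x 0 = 0) ->
  (forall x (X Y : 'M[R]_n), symmetric_mx X -> symmetric_mx Y -> psd_mx Y ->
     0 <= F x (X + Y) - F x X /\ F x (X + Y) - F x X <= \tr Y) ->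
  (* Omega *)
  open O -> connected O -> O !=set0 -> boundary O !=set0 ->
  (* q, u *)
  0 < q -> q <= 2 ->
  visc_sub F f g q O u ->
  (* (i) *)
  ((exists l : \bar R, (0 < l)%E /\ (g t)%:E @[t --> +oo] --> l) ->
   ~ (q <= 1 /\
      EI (fun t => 1 / ((t * f t) `^ (1/2) + (t * pos_part g t) `^ (1 / (2 - q))))%R 0
      = +oo%E) ->
   forall x, O x ->
     ((u x)%:E <= Order.max (t0_of g) (Rinv (Rfun_i n q f g) (dist_bd O x)))%E)
  /\
  (* (ii) *)
  (g t @[t --> +oo] --> (0:R) ->
   (EI (fun t => 1 / (RI (fun s => expR (- 2 * RI (fun r => (neg_part g r / f r) `^ (2 / q) * f r) s t) * f s) 0 t) `^ (1/2))%R 0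
    < +oo)%E ->
   forall x, O x ->
     ((u x)%:E <= Rinv (Rfun_ii n q f g) (dist_bd O x))%E)
  /\
  (* (iii) *)
  ((exists l : R, l < 0 /\ g t @[t --> +oo] --> l) ->
   (EI (fun t => 1 / (t * f t) `^ (1/2) + 1 / (f t) `^ (1 / q))%R 0 < +oo)%E ->
   forall x, O x ->
     ((u x)%:E <= Rinv (Rfun_iii n q f g) (dist_bd O x))%E).
Proof.
move=> cf cg f_incr g_incr f_gt0 f_lim _ F0 F_ell oO _ [c Oc] bO q0 q2 usub.
(* In dimension 0 the space is a single point, which lies in [O], so the boundary would be empty. *)
have n0 : (0 < n)%N.
  rewrite lt0n; apply/eqP => nE; subst n.
  by case: bO => b [_]; apply; rewrite [b]thinmx0 -[0](thinmx0 c).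
have [Phi [dPhi RIf]] := RI_primitive cf.
split; last split.
(* Values up to [t0] need no argument; above [t0] the function [g] is nonnegative, which the
   barriers of this case require. *)
- move=> glim ninf x Ox; rewrite le_max; have [//|tu] := leP (u x)%:E (t0_of g).
  have [gpos gfin] := limit_dichotomy glim.
  have fg : f t @[t --> +oo] --> +oo \/ (forall A, \forall t \near +oo, A < g t).
    by case: gfin => [gfin|]; [left; exact: f_lim|right].
  have [qlt|qge] := ltP q 2; last first.
    have qE : q = 2 by apply/eqP; rewrite eq_le q2.
    exact: (@case_q2 _ _ F f g q O u).
  have [Gam [dGam RIg]] := RI_primitive (pos_part_cont cg).
  apply: (@lower_gradient _ _ F f g q O u n0 cf cg f_incr g_incr f_gt0 F0 F_ell oO bO q0 usub
    qlt Phi Gam dPhi dGam RIf RIg gpos fg) => //.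
  have [q1|q1] := ltP 1 q; [by left|right].
  by rewrite ltey; apply/eqP => E; exact: ninf.
- move=> glim fin x Ox.
  have flim : f t @[t --> +oo] --> +oo by apply: f_lim; exists 0.
  exact: (@case_zero_limit _ _ F f g q O u).
- move=> [L [L0 glim]] fin x Ox.
  have flim : f t @[t --> +oo] --> +oo by apply: f_lim; exists L.
  have [Gam [dGam RIg]] := RI_primitive (neg_part_cont cg).
  exact: (@case_negative_limit _ _ F f g q O u n0 cf f_incr g_incr f_gt0 F0 F_ell oO bO q0
    q2 usub Phi Gam L L0 glim flim dPhi dGam RIf RIg).
Qed.
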